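(* Let $\lambda\ge 0$, $p_0=\frac{2\lambda}{2\lambda+1}$, $p_0\le p\le 1$ (with $p>0$) and $0<q<\infty$. Let $w:[0,1)\to(0,\infty)$ be a weight function (Lebesgue integrable over $[0,1)$) such that $$\int_r^1 w(s)\,ds\lesssim (1-r)\,w(r),\qquad r\in(0,1).$$ Put $\alpha=\frac{q+2\lambda+1}{p}-2\lambda-2$. Let $(X,\|\cdot\|_X)$ be a Banach space, let $T$ be a linear operator from the space of $\lambda$-analytic polynomials into $X$, let $x_n=T\phi_n$ for $n\ge0$, and let $$F_{\lambda,\alpha}(z)=\sum_{n=0}^{\infty}\frac{\Gamma(\lambda+1)\Gamma(n+\lambda+\alpha+2)}{\Gamma(\lambda+\alpha+2)\Gamma(n+\lambda+1)}\,x_n\,\phi_n(z),\qquad z\in\mathbb{D}.$$ If $F_{\lambda,\alpha}$ is an $X$-valued $\lambda$-analytic function on $\mathbb{D}$ and satisfies $$\|F_{\lambda,\alpha}(z)\|_X^p\lesssim \frac{|1-z^{2}|^{2\lambda(1-p)}}{(1-|z|)^{(\alpha+2)p-1}}\int_{|z|^{1/2}}^1 w(s)\,ds,\qquad z\in\mathbb{D},$$ then $T$ can be extended to a bounded operator from $A^{p}_{\lambda,w}(\mathbb{D})$ to $X$.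
   Context: $\mathbb{D}$ is the open unit disk in $\mathbb{C}$. For $\lambda\ge0$ the Dunkl operator $D_{\bar z}$ is $D_{\bar z}f(z)=\partial_{\bar z}f-\lambda\frac{f(z)-f(\bar z)}{z-\bar z}$ (the quotient being understood as its limit on the real axis). A $C^2$ function $f$ on $\mathbb{D}$ is $\lambda$-analytic if $D_{\bar z}f=0$. Equivalently, $f(z)=\sum_{n\ge0}c_n\phi_n(z)$ for $|z|<1$, where $$\phi_n(z)=\phi_n^{\lambda}(z)=\epsilon_n\sum_{j=0}^{n}\frac{(\lambda)_j(\lambda+1)_{n-j}}{j!(n-j)!}\bar z^{j}z^{n-j},\qquad \epsilon_n=\sqrt{n!/(2\lambda+1)_n},$$ and $(a)_j$ is the Pochhammer symbol. A $\lambda$-analytic polynomial is a finite linear combination of the $\phi_n$, $n\ge0$. Let $d\sigma_\lambda(z)=c_\lambda|y|^{2\lambda}\,dx\,dy$ ($z=x+iy$), $c_\lambda=\Gamma(\lambda+2)/(\Gamma(\lambda+1/2)\Gamma(1/2))$. For a weight $w$, i.e. a Lebesgue integrable function $w:[0,1)\to(0,\infty)$, and $0<p<\infty$, the weighted $\lambda$-Bergman space $A^p_{\lambda,w}(\mathbb{D})$ consists of the $\lambda$-analytic functions $f$ on $\mathbb{D}$ with $\|f\|_{A^p_{\lambda,w}}=\left(\int_{\mathbb{D}}|f(z)|^pw(|z|)\,d\sigma_\lambda(z)\right)^{1/p}<\infty$. ''Bounded'' means $\|Tf\|_X\le C\|f\|_{A^p_{\lambda,w}}$. ''$F_{\lambda,\alpha}$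 is an $X$-valued $\lambda$-analytic function'' means that the series defining it converges in $X$, locally uniformly in $z\in\mathbb{D}$. $\mathcal{X}\lesssim\mathcal{Y}$ means $\mathcal{X}\le c\,\mathcal{Y}$ with a constant $c>0$ independent of the variables ($r$, $z$, etc.). *)

(* Defs.v *)
From mathcomp Require Import all_boot all_order all_algebra complex.
From mathcomp Require Import all_classical all_reals all_analysis.

Set Implicit Arguments.
Unset Strict Implicit.
Unset Printing Implicit Defensive.

Import Order.TTheory GRing.Theory Num.Theory numFieldNormedType.Exports.

Local Open Scope classical_set_scope.
Local Open Scope ring_scope.
Local Open Scope complex_scope.

(* The norm of a normed space over R[i] takes its (real) values in R[i];
   [rnorm] is the same norm, with values in R. *)
Definition rnorm (R : realType) (V : normedZmodType R[i]) (x : V) : R :=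
  complex.Re `|x|.

Definition unit_disk (R : realType) : set R[i] := [set z | rnorm z < 1].

(* Only used at a > 0, where the integral converges. *)
Definition Gamma (R : realType) (a : R) : R :=
  \int[@lebesgue_measure R]_(t in `]0, +oo[) (t `^ (a - 1) * expR (- t)).

Definition pochhammer (R : realType) (a : R) (j : nat) : R :=
  \prod_(i < j) (a + i%:R).

Definition phi (R : realType) (lambda : R) (n : nat) (z : R[i]) : R[i] :=
  (Num.sqrt (n`!%:R / pochhammer (2 * lambda + 1) n))%:C *
  \sum_(j < n.+1)
     (pochhammer lambda j * pochhammer (lambda + 1) (n - j)
        / (j`!%:R * (n - j)`!%:R))%:C
     * (z^*)%C ^+ j * z ^+ (n - j).

Definition lambda_polynomial (R : realType) (lambda : R) :
    set (R[i] -> R[i]) :=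
  [set f | exists (N : nat) (c : nat -> R[i]),
     forall z, f z = \sum_(n < N) c n * phi lambda n z].

(* Functions on the disk are represented by total functions on R[i], whose
   values outside the disk play no role. *)

Definition Re_xy (R : realType) (f : R[i] -> R[i]) (v : R * R) : R :=
  complex.Re (f (v.1 +i* v.2)).

Definition Im_xy (R : realType) (f : R[i] -> R[i]) (v : R * R) : R :=
  complex.Im (f (v.1 +i* v.2)).

Definition disk_xy (R : realType) : set (R * R) :=
  [set v | unit_disk (v.1 +i* v.2)].

Definition C1_on (R : realType) (A : set (R * R)) (g : R * R -> R) : Prop :=
  forall v, A v ->
    [/\ derivable g v (1, 0), derivable g v (0, 1),
        {for v, continuous ('D_(1, 0) g)} &
        {for v, continuous ('D_(0, 1) g)}].

Definition C2_on (R : realType) (A : set (R * R)) (g : R * R -> R) : Prop :=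
  [/\ C1_on A g, C1_on A ('D_(1, 0) g) & C1_on A ('D_(0, 1) g)].

Definition C2_disk (R : realType) (f : R[i] -> R[i]) : Prop :=
  C2_on (@disk_xy R) (Re_xy f) /\ C2_on (@disk_xy R) (Im_xy f).

Definition partial_x (R : realType) (f : R[i] -> R[i]) (z : R[i]) : R[i] :=
  let v := (complex.Re z, complex.Im z) in
  ('D_(1, 0) (Re_xy f) v) +i* ('D_(1, 0) (Im_xy f) v).

Definition partial_y (R : realType) (f : R[i] -> R[i]) (z : R[i]) : R[i] :=
  let v := (complex.Re z, complex.Im z) in
  ('D_(0, 1) (Re_xy f) v) +i* ('D_(0, 1) (Im_xy f) v).

Definition partial_zbar (R : realType) (f : R[i] -> R[i]) (z : R[i]) : R[i] :=
  (partial_x f z + (0 +i* 1) * partial_y f z) / 2.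

Definition conj_quotient (R : realType) (f : R[i] -> R[i]) (z : R[i]) : R[i] :=
  (f z - f (z^*)%C) / (z - (z^*)%C).

(* The topology of R[i] is carried by its alias R[i]^o. *)
Definition dunkl_quotient (R : realType) (f : R[i] -> R[i]) (z : R[i]) : R[i] :=
  if complex.Im z == 0 then
    lim ((conj_quotient f : R[i]^o -> R[i]^o) @
           within [set u : R[i]^o | complex.Im u != 0] (nbhs (z : R[i]^o)))
  else conj_quotient f z.

Definition dunkl_zbar (R : realType) (lambda : R) (f : R[i] -> R[i])
    (z : R[i]) : R[i] :=
  partial_zbar f z - lambda%:C * dunkl_quotient f z.

Definition lambda_analytic (R : realType) (lambda : R) (f : R[i] -> R[i]) :
    Prop :=
  C2_disk f /\ forall z, unit_disk z -> dunkl_zbar lambda f z = 0.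

(* Lebesgue (and not just Borel) measurability of the weight is obtained by
   integrating against the completed measure. *)
Definition weight (R : realType) (w : R -> R) : Prop :=
  (forall r, 0 <= r < 1 -> 0 < w r) /\
  (@completed_lebesgue_measure R).-integrable `[0, 1[ (EFin \o w).

Definition weight_tail (R : realType) (w : R -> R) (r : R) : R :=
  \int[@completed_lebesgue_measure R]_(s in `]r, 1[) w s.

Definition c_lambda (R : realType) (lambda : R) : R :=
  Gamma (lambda + 2) / (Gamma (lambda + 2^-1) * Gamma 2^-1).

(* The integrand is nonnegative, so the integral is a supremum of integrals of
   simple functions; since a Lebesgue measurable function has a Borel minorant
   that is almost everywhere equal to it, the Borel product measure gives the
   usual value even when w is only Lebesgue measurable. *)
Definition bergman_norm (R : realType) (p lambda : R) (w : R -> R)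
    (f : R[i] -> R[i]) : \bar R :=
  ((\int[(@lebesgue_measure R) \x (@lebesgue_measure R)]_(v in @disk_xy R)
      (rnorm (f (v.1 +i* v.2)) `^ p * w (rnorm (v.1 +i* v.2))
         * (c_lambda lambda * `|v.2| `^ (2 * lambda)))%:E) `^ p^-1)%E.

Definition bergman (R : realType) (p lambda : R) (w : R -> R) :
    set (R[i] -> R[i]) :=
  [set f | lambda_analytic lambda f /\ (bergman_norm p lambda w f < +oo)%E].

Definition linear_on (R : realType) (X : lmodType R[i])
    (A : set (R[i] -> R[i])) (T : (R[i] -> R[i]) -> X) : Prop :=
  forall (a : R[i]) (f g : R[i] -> R[i]), A f -> A g ->
    T (fun z => a * f z + g z) = a *: T f + T g.

Definition X_partial_sum (R : realType) (X : completeNormedModType R[i])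
    (lambda : R) (x : nat -> X) (N : nat) (z : R[i]) : X :=
  \sum_(n < N) phi lambda n z *: x n.

Definition X_sum (R : realType) (X : completeNormedModType R[i])
    (lambda : R) (x : nat -> X) (z : R[i]) : X :=
  limn (fun N => X_partial_sum lambda x N z).

Definition X_lambda_analytic (R : realType) (X : completeNormedModType R[i])
    (lambda : R) (x : nat -> X) : Prop :=
  forall z : R[i], unit_disk z -> exists2 r : R, 0 < r &
    {uniform [set u | unit_disk u /\ rnorm (u - z) < r],
       (X_partial_sum lambda x) @ \oo --> X_sum lambda x}.

Definition F_coef (R : realType) (X : completeNormedModType R[i])
    (lambda alpha : R) (T : (R[i] -> R[i]) -> X) (n : nat) : X :=
  (Gamma (lambda + 1) * Gamma (n%:R + lambda + alpha + 2)
     / (Gamma (lambda + alpha + 2) * Gamma (n%:R + lambda + 1)))%:C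
  *: T (phi lambda n).

(* Linearity and the norm bound make S f depend only on f on the disk. *)
Definition extends_boundedly (R : realType) (X : completeNormedModType R[i])
    (p lambda : R) (w : R -> R) (T : (R[i] -> R[i]) -> X) : Prop :=
  exists S : (R[i] -> R[i]) -> X,
    [/\ linear_on (bergman p lambda w) S,
        (exists C : R, forall f, bergman p lambda w f ->
           ((rnorm (S f))%:E <= C%:E * bergman_norm p lambda w f)%E) &
        forall f, lambda_polynomial lambda f -> S f = T f].

(* Main.v *)
(* Write k = 2 lambda.  The even and odd parts in y of Re f and Im f solve
   u_xx + u_yy + (k/y) u_y = V u with V = 0 or V = k/y^2.  Comparison with
   explicit barriers bounds their first derivatives by sup |u| / d on boxes of
   size d, up to the edge y = 0.  Hence the sum of their moduli varies slowly, and
   its p-th power has a sub-mean value property for |y|^k dx dy, for every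
   0 < p <= 1.  On the box of size (1 - |z|) / 8 around z this gives a pointwise
   bound of |f| by the 1/p-th power of a local integral I of |f|^p w |y|^k;
   together with the growth condition on F = F_{lambda,alpha} and the estimate
   int I^(1/p) <= (sup I)^(1/p - 1) int I it gives
     int |f| |F| (1 - |z|^2)^alpha |y|^k dx dy <= C ||f||.
   Therefore
     S f = lim_{r -> 1} const * int_{|z| < r} f(z) F(conj z) (1 - |z|^2)^alpha |y|^k
   exists and is bounded.  The phi_n are orthogonal on circles, and the Gamma
   quotients in F are the inverses of the radial moments, so S phi_n = T phi_n.
   The integral is defined termwise in the series of F; Minkowski's inequality
   for finite sums replaces vector-valued integration. *)

Require Import Defs.
From HB Require Import structures.
From mathcomp Require Import all_boot all_order all_algebra complex.
From mathcomp Require Import all_classical all_reals all_analysis measurable_realfun.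
From mathcomp Require Import ring lra.
Import Order.TTheory GRing.Theory Num.Theory numFieldNormedType.Exports.
Local Open Scope classical_set_scope.
Local Open Scope ring_scope.
Local Open Scope complex_scope.

Set Implicit Arguments.
Unset Strict Implicit.
Unset Printing Implicit Defensive.

(** * Gradient bounds by the maximum principle *)

(** The equation is invariant under translation in x but singular at y = 0, so only the x-derivative
    is reached by reflection: h(x0 + x, y) - h(x0 - x, y) solves the same equation and vanishes at x
    = 0, and a quadratic barrier bounds its slope. The y-derivatives come from g_y = - v_x and v_y =
    g_x - (k / y) v, after a second barrier has bounded v / y. For p < 1 the mean value argument is
    self-improving: over a box of size e d the function drops by at most K e sup, and once a^p is
    weighted by the measure of the largest admissible box, the error for small e is half of a finite
    supremum, hence absorbed. The operator lives in polar coordinates, the Bergman norm in Cartesian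
    ones. They meet only in an inequality, through the kernel t (1 - t)^(-2) on pairs (polar point,
    Cartesian point of its box), whose mass in the polar variable is at most 1; thus no change of
    variables is made. Finally |1 - z^2|^2 = (1 - |z|^2)^2 + 4 y^2, so |1 - z^2| is at most a
    multiple of y + (1 - |z|) / 8, the quantity whose power k the mean value property loses. *)

Lemma is_derive1_epsP (R : realType) (f : R -> R) (x l : R) :
  is_derive x 1 f l <->
  (forall e : R, 0 < e -> exists2 d : R, 0 < d & forall h : R, h != 0 -> `|h| < d ->
     `|(f (x + h) - f x) / h - l| < e).
Proof.
have E (h : R) : h^-1 *: (f (h *: 1 + x) - f x) = (f (x + h) - f x) / h.
  by rewrite /GRing.scale/= mulr1 mulrC (addrC h).
split.
  move=> dfx e e0.
  have dx : derivable f x 1 by exact: ex_derive.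
  have : h^-1 *: (f (h *: 1 + x) - f x) @[h --> 0^'] --> l.
    by rewrite -(derive_val (df:=l)).
  move/cvgrPdist_lt => /(_ _ e0)[/= d d0 H]; exists d => // h h0 hd.
  have := H h; rewrite /= sub0r normrN => /(_ hd h0).
  by rewrite E distrC.
move=> H.
have c : h^-1 *: (f (h *: 1 + x) - f x) @[h --> 0^'] --> l.
  apply/cvgrPdist_lt => e e0; have [d d0 K] := H _ e0.
  exists d => //= h; rewrite /= sub0r normrN => hd h0.
  by rewrite E distrC; exact: K.
by apply: DeriveDef; [apply/cvg_ex; exists l|exact: cvg_lim c].
Qed.

Lemma is_derive1_continuous (R : realType) (f : R -> R) (x l : R) :
  is_derive x 1 f l -> {for x, continuous f}.
Proof.
move=> d; have dx : derivable f x 1 by exact: ex_derive.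
exact/differentiable_continuous/derivable1_diffP.
Qed.

Lemma MVT_open (R : realType) (f df : R -> R) (a b : R) : a <= b ->
  (forall x, a <= x <= b -> is_derive x 1 f (df x)) ->
  exists2 c, a <= c <= b & f b - f a = df c * (b - a).
Proof.
move=> ab H.
have [||c cab E] := @MVT_segment R f df a b ab.
- by move=> x /itvP xab; apply: H; rewrite !xab.
- apply: continuous_in_subspaceT => x; rewrite inE/= in_itv/= => xab.
  exact: is_derive1_continuous (H _ xab).
by exists c => //; rewrite in_itv in cab.
Qed.

(** If [ddu] were positive, [du], which vanishes at [c], would be positive just to the right of [c],
    and the mean value theorem would produce values of [u] above [u c]. *)
Lemma second_derivative_at_max (R : realType) (u du : R -> R) (a b c ddu : R) :
  a < c < b -> (forall x, a < x < b -> is_derive x 1 u (du x)) ->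
  is_derive c 1 du ddu -> (forall x, a < x < b -> u x <= u c) ->
  du c = 0 /\ ddu <= 0.
Proof.
move=> /andP[ac cb] Du Dc umax.
have du0 : du c = 0.
  have h1 : is_derive c 1 u 0.
    apply: (@derive1_at_max R u a b c).
    - by apply: ltW; apply: lt_trans cb.
    - move=> t /[!in_itv]/= tab; have := Du _ tab => hd; exact: ex_derive.
    - by rewrite in_itv/= ac cb.
    - by move=> t; rewrite in_itv/= => tab; exact: umax.
  have h2 := Du c; rewrite ac cb in h2; have {}h2 := h2 isT.
  by rewrite -(derive_val (df:=du c)) (derive_val (df:=0)).
split => //; rewrite leNgt; apply/negP => dd0.
have [d d0 H] := (@is_derive1_epsP R du c ddu).1 Dc _ dd0.
pose x := Num.min (c + d / 2) ((c + b) / 2).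
have cx : c < x by rewrite /x lt_min; apply/andP; split; lra.
have xd : x - c < d.
  have : x <= c + d / 2 by rewrite /x ge_min lexx.
  by lra.
have xb : x < b by rewrite /x gt_min; apply/orP; right; lra.
have P y : c < y -> y <= x -> 0 < du y.
  move=> cy yx; have h0 : y - c != 0 by rewrite subr_eq0 gt_eqF.
  have := H _ h0; rewrite gtr0_norm ?subr_gt0// => /(_ _).
  rewrite (addrC c) subrK du0 subr0 => /(_ _)/wrap[]; first lra.
  rewrite ltr_norml => /andP[+ _]; rewrite ltrBrDr addNr.
  by rewrite pmulr_lgt0// invr_gt0 subr_gt0.
have [||e] := @MVT R u du c x cx.
- move=> y; rewrite in_itv/= => /andP[cy yx]; apply: Du.
  by rewrite (lt_trans ac cy) (lt_trans yx xb).
- apply: continuous_in_subspaceT => y; rewrite inE/= in_itv/= => /andP[cy yx].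
  apply: is_derive1_continuous; apply: Du.
  by rewrite (lt_le_trans ac cy) (le_lt_trans yx xb).
rewrite in_itv/= => /andP[ce ex] E.
have := umax x; rewrite (lt_trans ac cx) xb => /(_ isT).
rewrite -subr_le0 E leNgt mulr_gt0// ?subr_gt0//.
by apply: P => //; exact: ltW.
Qed.

(** At an interior positive maximum [uy] vanishes, so the drift [k y * uy] drops out however
    singular [k] is, and the signs of the second derivatives contradict the strict inequality. The
    bottom side has its own condition: a positive value there is exceeded on the same vertical. It
    covers zero data as well as zero slope on the edge. *)
Lemma max_principle (R : realType) (u : R -> R -> R) (k : R -> R)
    (a b c e : R) : a < b -> c < e ->
  {within [set p : R * R | a <= p.1 <= b /\ c <= p.2 <= e],
     continuous (fun p => u p.1 p.2)} ->
  (forall x y, a <= x <= b -> c <= y <= e -> x = a \/ x = b \/ y = e ->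
     u x y <= 0) ->
  (forall x, a < x < b -> 0 < u x c -> exists2 y, c <= y <= e & u x c < u x y) ->
  (forall x y, a < x < b -> c < y < e -> 0 < u x y ->
     exists (ux uy : R -> R) (uxx uyy : R), [/\ forall s, a < s < b -> is_derive s 1 (u^~ y) (ux s),
       forall t, c < t < e -> is_derive t 1 (u x) (uy t),
       is_derive x 1 ux uxx, is_derive y 1 uy uyy &
       0 < uxx + uyy + k y * uy y]) ->
  forall x y, a <= x <= b -> c <= y <= e -> u x y <= 0.
Proof.
move=> ab ce cu bd bot int.
set K := [set p : R * R | a <= p.1 <= b /\ c <= p.2 <= e] in cu *.
have KE : K = `[a, b] `*` `[c, e].
  by apply/seteqP; split => -[x y]; rewrite /K/= !in_itv/=.
have cK : compact K by rewrite KE; apply: compact_setX; exact: segment_compact.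
have K0 : K !=set0 by exists (a, c); rewrite /K/= !lexx !ltW.
have [[x0 y0]] := compact_EVT_max K0 cK cu.
rewrite inE => -[/= xab yce] M.
suff u0 : u x0 y0 <= 0.
  move=> x y xx yy; apply: le_trans u0; apply: (M (x, y)).
  by rewrite inE.
rewrite leNgt; apply/negP => upos.
have [xa|xa] := eqVneq x0 a.
  by move: upos; rewrite ltNge bd//; left.
have [xb|xb] := eqVneq x0 b.
  by move: upos; rewrite ltNge bd//; right; left.
have [ye|ye] := eqVneq y0 e.
  by move: upos; rewrite ltNge bd//; right; right.
have xoo : a < x0 < b.
  move/andP: xab => [? ?]; by rewrite !lt_neqAle eq_sym xa xb; apply/andP.
have [yc|yc] := eqVneq y0 c.
  have [||y yy] := bot x0 => //; first by rewrite -yc.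
  rewrite ltNge -yc => /negP; case; apply: (M (x0, y)).
  by rewrite inE.
have yoo : c < y0 < e.
  move/andP: yce => [? ?]; by rewrite !lt_neqAle eq_sym yc ye; apply/andP.
have [ux [uy [uxx [uyy [d1 d2 d3 d4 pos]]]]] := int _ _ xoo yoo upos.
have [|_ x2] := second_derivative_at_max xoo d1 d3.
  move=> s /andP[? ?]; apply: (M (s, y0)); rewrite inE/K/= yce; split => //.
  by rewrite !ltW.
have [|y1 y2] := second_derivative_at_max yoo d2 d4.
  move=> s /andP[? ?]; apply: (M (x0, s)); rewrite inE/K/= xab; split => //.
  by rewrite !ltW.
by move: pos; rewrite y1; lra.
Qed.

Lemma is_derive1_ext (R : realType) (f g : R -> R) (x l l' : R) :
  is_derive x 1 f l -> f =1 g -> l = l' -> is_derive x 1 g l'.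
Proof. by move=> d /funext <- <-. Qed.

Lemma is_derive1_affine (R : realType) (f : R -> R) (a e s l : R) :
  is_derive (a + e * s) 1 f l -> is_derive s 1 (fun s => f (a + e * s)) (e * l).
Proof.
move=> df; have ds : is_derive s 1 (fun s : R => a + e * s) e.
  apply/is_derive1_epsP => r r0; exists 1 => // h h0 _.
  have -> : (a + e * (s + h) - (a + e * s)) / h - e = 0 by field.
  by rewrite normr0.
have := @is_derive1_comp R f (fun s : R => a + e * s) s l e df ds.
by move=> h; apply: is_derive1_ext h _ _ => //; rewrite mulrC.
Qed.

(** The barriers below are quadratic in each variable; this supplies their derivatives. *)
Lemma is_derive1_quad (R : realType) (a b c s : R) :
  is_derive s 1 (fun s => a + b * s + c * s ^+ 2) (b + 2 * c * s).
Proof.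
have d1 : is_derive s 1 (fun s : R => a + b * s) b.
  have /(@is_derive1_affine R id a b s) h := is_derive_id (a + b * s) 1.
  by apply: is_derive1_ext h _ _ => //; rewrite mulr1.
have d2 : is_derive s 1 (c \*: (@id R ^+ 2)) (c *: ((2%:R * s ^+ 1) *: 1)).
  exact: is_deriveZ.
have := is_deriveD d1 d2 => h; apply: is_derive1_ext h _ _ => //.
by rewrite /GRing.scale/=; ring.
Qed.

Section gradient_bounds.
Variables (R : realType) (lam : R) (P : R -> R -> Prop) (V : R -> R).
Hypotheses (lam0 : 0 <= lam) (V0 : forall y : R, 0 < y -> 0 <= V y).

(** The coefficient [2 * lam / y] is singular at [y = 0], so the equation is imposed only above the
    edge. The behaviour at the edge is the separate hypothesis [hbot]: zero data for parts odd in
    [y], zero slope for even ones. *)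
Definition solves (h hx hy hxx hyy : R -> R -> R) :=
  forall x y, P x y -> 0 < y ->
  [/\ is_derive x 1 (h^~ y) (hx x y), is_derive y 1 (h x) (hy x y),
      is_derive x 1 (hx^~ y) (hxx x y), is_derive y 1 (hy x) (hyy x y) &
      hxx x y + hyy x y + 2 * lam / y * hy x y = V y * h x y].

Variables (h hx hy hxx hyy : R -> R -> R).
Hypothesis hsol : solves h hx hy hxx hyy.
Hypothesis hcont : forall x y, P x y ->
  {for (x, y), continuous (fun p : R * R => h p.1 p.2)}.
Hypothesis hbot : (forall x, P x 0 -> h x 0 = 0) \/
  (forall x, P x 0 -> is_derive (0 : R) (1 : R) (h x) (0 : R)).

Variables (x0 y0 d S : R).
Hypotheses (y0pos : 0 < y0) (d0 : 0 < d) (S0 : 0 < S).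
Hypothesis boxP : forall x y, `|x - x0| <= d -> `|y - y0| <= d -> 0 <= y ->
  P x y.
Hypothesis hS : forall x y, `|x - x0| <= d -> `|y - y0| <= d -> 0 <= y ->
  `|h x y| <= S.

Let m := 3 + 2 * lam.

(* Adding [2 * S / d ^+ 2 * (y - y0) ^+ 2] makes the right-hand side a
   supersolution, by the choice of [m], that dominates the difference on the
   boundary of the box. *)
Lemma odd_difference_le (x : R) : 0 <= x <= d ->
  h (x0 + x) y0 - h (x0 - x) y0 <=
  2 * S / d ^+ 2 * (x ^+ 2 + m * (d * x - x ^+ 2)).
Proof.
have [l0 yp dp Sp] := And4 lam0 y0pos d0 S0.
move=> xd; set B := 2 * S / d ^+ 2.
have B0 : 0 < B by rewrite /B divr_gt0 ?exprn_gt0// mulr_gt0.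
(* The box is cut at the edge: [c] is the larger of [0] and [y0 - d]. *)
have [c [c0 cd cy cE]] : exists c : R,
    [/\ 0 <= c, y0 - d <= c, c < y0 & c = 0 \/ c = y0 - d].
  have [yd|yd] := lerP (y0 - d) 0; first by exists 0; split => //; left.
  exists (y0 - d); split => //; first exact: ltW.
    by rewrite ltrBlDr ltrDl.
  by right.
pose u x y := h (x0 + x) y - h (x0 - x) y -
  B * ((y - y0) ^+ 2 + x ^+ 2 + m * (d * x - x ^+ 2)).
have bx1 (s t : R) : 0 <= s <= d -> `|(x0 + s) - x0| <= d by rewrite ler_norml; lra.
have bx2 (s t : R) : 0 <= s <= d -> `|(x0 - s) - x0| <= d by rewrite ler_norml; lra.
have by1 (t : R) : c <= t <= y0 + d -> `|t - y0| <= d by rewrite ler_norml; lra.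
have by0 (t : R) : c <= t <= y0 + d -> 0 <= t by lra.
have m0 : 0 < m by rewrite /m; lra.
have bge0 (s t : R) : 0 <= s <= d ->
    0 <= B * ((t - y0) ^+ 2 + s ^+ 2 + m * (d * s - s ^+ 2)).
  move=> /andP[s0 sd]; apply: mulr_ge0; [exact: ltW|].
  apply: addr_ge0; first by rewrite addr_ge0 ?sqr_ge0.
  by apply: mulr_ge0; [exact: ltW|nra].
have diff2S (s t : R) : 0 <= s <= d -> c <= t <= y0 + d ->
    h (x0 + s) t - h (x0 - s) t <= 2 * S.
  move=> sd td.
  have := hS (bx1 _ 0 sd) (by1 _ td) (by0 _ td).
  have := hS (bx2 _ 0 sd) (by1 _ td) (by0 _ td).
  by rewrite !ler_norml; lra.
have BS : B * d ^+ 2 = 2 * S by rewrite /B divfK// expf_eq0/= gt_eqF.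
suff : u x y0 <= 0 by rewrite /u subrr expr0n/= add0r subr_le0.
apply: (@max_principle R u (fun y => 2 * lam / y) 0 d c (y0 + d)) => //.
- by lra.
- apply: continuous_in_subspaceT => -[s t]; rewrite inE/= => -[sd td].
  have P1 : P (x0 + s) t.
    by apply: boxP; [exact: bx1|exact: by1|exact: by0].
  have P2 : P (x0 - s) t.
    by apply: boxP; [exact: bx2|exact: by1|exact: by0].
  rewrite /u; apply: cvgB; first apply: cvgB.
  + apply: (@continuous_comp _ _ _ (fun p : R * R => (x0 + p.1, p.2))
      (fun p : R * R => h p.1 p.2)); last exact: hcont.
    exact: (cvg_pair (cvgD (cvg_cst _) cvg_fst) cvg_snd).
  + apply: (@continuous_comp _ _ _ (fun p : R * R => (x0 - p.1, p.2))
      (fun p : R * R => h p.1 p.2)); last exact: hcont.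
    exact: (cvg_pair (cvgB (cvg_cst _) cvg_fst) cvg_snd).
  + apply: cvgMr; apply: cvgD; first apply: cvgD.
    * by rewrite expr2; apply: cvgM; (apply: cvgB; [exact: cvg_snd|exact: cvg_cst]).
    * by rewrite expr2; apply: cvgM; exact: cvg_fst.
    * apply: cvgMr; apply: cvgB; first by apply: cvgMr; exact: cvg_fst.
      by rewrite expr2; apply: cvgM; exact: cvg_fst.
- move=> s t sd td [E|[E|E]]; rewrite /u.
  + have := bge0 _ t sd; rewrite E; rewrite addr0 subr0 subrr sub0r; lra.
  + have := diff2S _ _ sd td; rewrite E.
    have : 0 <= B * (t - y0) ^+ 2 by rewrite mulr_ge0 ?sqr_ge0// ltW.
    have -> : d * d - d ^+ 2 = 0 by ring.
    by rewrite mulr0 addr0 mulrDr BS; lra.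
  + have := diff2S _ _ sd td; rewrite E.
    have := bge0 _ y0 sd; rewrite subrr expr0n/= add0r.
    have -> : y0 + d - y0 = d by ring.
    by rewrite -(addrA (d ^+ 2)) (mulrDr B (d ^+ 2)) BS; lra.
- move=> s /andP[s0 sd] upos.
  have sdc : 0 <= s <= d by rewrite !ltW.
  have cc : c <= c <= y0 + d by rewrite lexx/=; lra.
  (* On a bottom side at distance [d] below [y0] the term [(y - y0) ^+ 2] alone dominates the
     difference; on the edge [hbot] decides. *)
  have [cz|cz] := cE; last first.
    move: upos; rewrite /u => upos; exfalso.
    have := diff2S _ _ sdc cc.
    have := bge0 _ y0 sdc; rewrite subrr expr0n/= add0r.
    move: upos; have -> : (c - y0) ^+ 2 = d ^+ 2 by rewrite cz; ring.
    by rewrite -(addrA (d ^+ 2)) (mulrDr B (d ^+ 2)) BS; lra.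
  have P1 : P (x0 + s) 0.
    by rewrite -{1}cz; apply: boxP; [exact: bx1|exact: by1|exact: by0].
  have P2 : P (x0 - s) 0.
    by rewrite -{1}cz; apply: boxP; [exact: bx2|exact: by1|exact: by0].
  case: hbot => H.
    exfalso; move: upos; rewrite /u cz !H// subrr sub0r.
    by have := bge0 _ 0 sdc; lra.
  have D1 := H _ P1. have D2 := H _ P2.
  (* With zero slope of [h] on the edge, the slope of [u s] there comes from [- B * (y - y0) ^+ 2]
     alone and is positive, so [u] increases on leaving the edge. *)
  have D : is_derive (0 : R) (1 : R) (u s) (2 * B * y0).
    have Q := @is_derive1_quad R (B * (y0 ^+ 2 + s ^+ 2 + m * (d * s - s ^+ 2)))
       (- (2 * B * y0)) B 0.
    have := is_deriveB (is_deriveB D1 D2) Q => HH.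
    by apply: is_derive1_ext HH _ _ => [t|]; rewrite /u ?fctE/=; ring.
  have By : 0 < 2 * B * y0 by apply: mulr_gt0 => //; apply: mulr_gt0.
  have [r r0 K] := (@is_derive1_epsP R _ _ _).1 D _ By.
  pose t : R := Num.min (r / 2) y0.
  have t0 : 0 < t by rewrite /t lt_min divr_gt0.
  have tr : t <= r / 2 by rewrite /t ge_min lexx.
  have ty : t <= y0 by rewrite /t ge_min lexx orbT.
  exists t; first by rewrite cz; lra.
  have := K t (lt0r_neq0 t0); rewrite gtr0_norm// => /(_ _)/wrap[]; first lra.
  rewrite add0r ltr_norml => /andP[+ _]; rewrite ltrBrDr addNr.
  by rewrite pmulr_lgt0 ?invr_gt0// subr_gt0 cz.
- move=> s t /andP[s0 sd] /andP[ct td] upos.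
  have sdc : 0 <= s <= d by rewrite !ltW.
  have tdc : c <= t <= y0 + d by rewrite !ltW.
  have tpos : 0 < t by apply: le_lt_trans ct.
  have PP1 (s' t' : R) : 0 < s' < d -> c < t' < y0 + d -> P (x0 + s') t'.
    move=> /andP[? ?] /andP[? ?].
    by apply: boxP; [apply: bx1|apply: by1|apply: by0]; rewrite ?(ltW, andbT)//; apply/andP; split; apply: ltW.
  have PP2 (s' t' : R) : 0 < s' < d -> c < t' < y0 + d -> P (x0 - s') t'.
    move=> /andP[? ?] /andP[? ?].
    by apply: boxP; [apply: bx2|apply: by1|apply: by0]; rewrite ?(ltW, andbT)//; apply/andP; split; apply: ltW.
  exists (fun s => hx (x0 + s) t + hx (x0 - s) t - B * (2 * s + m * (d - 2 * s))).
  exists (fun t => hy (x0 + s) t - hy (x0 - s) t - B * (2 * (t - y0))).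
  exists (hxx (x0 + s) t - hxx (x0 - s) t - B * (2 - 2 * m)).
  exists (hyy (x0 + s) t - hyy (x0 - s) t - B * 2).
  have s0d : 0 < s < d by apply/andP.
  have t0d : c < t < y0 + d by apply/andP.
  split.
  + move=> s' sd'.
    have [D1 _ _ _ _] := hsol (PP1 _ _ sd' t0d) tpos.
    have [D2 _ _ _ _] := hsol (PP2 _ _ sd' t0d) tpos.
    rewrite -[x0 + s']/(x0 + s') -[s' in x0 + s']mul1r in D1.
    rewrite -[x0 - s']/(x0 - s') -mulN1r in D2.
    have {}D1 := is_derive1_affine D1. have {}D2 := is_derive1_affine D2.
    have Q := @is_derive1_quad R (B * (t - y0) ^+ 2) (B * m * d) (B * (1 - m)) s'.
    have HH := is_deriveB (is_deriveB D1 D2) Q.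
    apply: is_derive1_ext HH _ _ => [w|]; rewrite /u ?fctE/= ?mul1r ?mulN1r; ring.
  + move=> t' td'.
    have t'0 : 0 < t' by apply: (le_lt_trans c0); case/andP: td'.
    have [_ D1 _ _ _] := hsol (PP1 _ _ s0d td') t'0.
    have [_ D2 _ _ _] := hsol (PP2 _ _ s0d td') t'0.
    have Q := @is_derive1_quad R (B * (y0 ^+ 2 + s ^+ 2 + m * (d * s - s ^+ 2)))
       (- (2 * B * y0)) B t'.
    have HH := is_deriveB (is_deriveB D1 D2) Q.
    apply: is_derive1_ext HH _ _ => [w|]; rewrite /u ?fctE/=; ring.
  + have [_ _ D1 _ _] := hsol (PP1 _ _ s0d t0d) tpos.
    have [_ _ D2 _ _] := hsol (PP2 _ _ s0d t0d) tpos.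
    rewrite -[s in x0 + s]mul1r in D1.
    rewrite -mulN1r in D2.
    have {}D1 := is_derive1_affine D1. have {}D2 := is_derive1_affine D2.
    have Q := @is_derive1_quad R (B * m * d) (2 * B * (1 - m)) 0 s.
    have HH := is_deriveB (is_deriveD D1 D2) Q.
    apply: is_derive1_ext HH _ _ => [w|]; rewrite ?fctE/=  ?mul1r ?mulN1r; ring.
  + have [_ _ _ D1 _] := hsol (PP1 _ _ s0d t0d) tpos.
    have [_ _ _ D2 _] := hsol (PP2 _ _ s0d t0d) tpos.
    have Q := @is_derive1_quad R (- (2 * B * y0)) (2 * B) 0 t.
    have HH := is_deriveB (is_deriveB D1 D2) Q.
    apply: is_derive1_ext HH _ _ => [w|]; rewrite ?fctE/=; ring.
  + have [_ _ _ _ E1] := hsol (PP1 _ _ s0d t0d) tpos.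
    have [_ _ _ _ E2] := hsol (PP2 _ _ s0d t0d) tpos.
    set k := 2 * lam / t in E1 E2 *.
    (* The drift of [(t - y0) ^+ 2] stays bounded above although [k] blows up at the edge, because
       the part with [- y0] has the favourable sign. *)
    have kle : k * (t - y0) <= 2 * lam.
      rewrite /k mulrBr -[2 * lam / t * t]mulrA mulVf ?gt_eqF// mulr1.
      by rewrite lerBlDr lerDl !mulr_ge0// ?invr_ge0 ltW.
    (* Where [u] is positive the difference exceeds a nonnegative barrier, so the zero-order term
       has the right sign. *)
    have VG : 0 <= V t * (h (x0 + s) t - h (x0 - s) t).
      rewrite mulr_ge0 ?V0//.
      by move: upos; rewrite /u; have := bge0 _ t sdc; lra.
    (* The operator without its zero-order term sends the barrier to at most
       [B * (4 - 2 * m + 4 * lam) = - 2 * B]; this is how [m = 3 + 2 * lam] is found. *)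
    have : 0 < B * (2 - 2 * (k * (t - y0) - 2 * lam)) by rewrite mulr_gt0//; lra.
    by move: VG; rewrite mulrBr -E1 -E2 /m; lra.
- by lra.
Qed.

(** Dividing [odd_difference_le] by [2 * x] and letting [x] tend to [0] leaves
    [S / d ^+ 2 * (m * d)]. The contradiction is run at one small [t], chosen from the derivative at
    [0] and from the size of the quadratic terms. *)
Lemma partial_x_le : hx x0 y0 <= m * S / d.
Proof.
have [l0 yp dp Sp] := And4 lam0 y0pos d0 S0.
have P0 : P x0 y0 by apply: boxP; rewrite ?subrr ?normr0 ?ltW.
have [D _ _ _ _] := hsol P0 y0pos.
have DG : is_derive (0 : R) (1 : R) (fun s => h (x0 + s) y0 - h (x0 - s) y0)
    (2 * hx x0 y0).
  have D1 : is_derive (0 : R) (1 : R) (fun s => h (x0 + 1 * s) y0) (1 * hx x0 y0).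
    by apply: (@is_derive1_affine R (h^~ y0) x0 1); rewrite mulr0 addr0.
  have D2 : is_derive (0 : R) (1 : R) (fun s => h (x0 + (-1) * s) y0) (-1 * hx x0 y0).
    by apply: (@is_derive1_affine R (h^~ y0) x0 (-1)); rewrite mulr0 addr0.
  have := is_deriveB D1 D2 => DD.
  by apply: is_derive1_ext DD _ _ => [t|]; rewrite ?fctE/= ?mul1r ?mulN1r//; ring.
clear D; rewrite leNgt; apply/negP => lt0.
have [e [e0 eE]] : exists e : R, 0 < e /\ hx x0 y0 = m * S / d + e.
  by exists (hx x0 y0 - m * S / d); rewrite subr_gt0; split => //; ring.
have [r r0 K] := (@is_derive1_epsP R _ _ _).1 DG _ e0.
have BE : 2 * S / d ^+ 2 * (m * d) = 2 * (m * S / d) by field; exact: lt0r_neq0.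
have B0 : 0 < 2 * S / d ^+ 2 by rewrite divr_gt0 ?exprn_gt0// mulr_gt0.
have odl := odd_difference_le.
set B := 2 * S / d ^+ 2 in B0 BE odl.
have [t [t0 tr td tB]] : exists t : R, [/\ 0 < t, t < r, t <= d & B * t <= e].
  exists (Num.min (r / 2) (Num.min d (e / B))); split.
  - by rewrite !lt_min d0 (divr_gt0 e0 B0) divr_gt0.
  - by rewrite gt_min; apply/orP; left; lra.
  - by rewrite !ge_min lexx !orbT.
  - by rewrite mulrC -ler_pdivlMr// !ge_min lexx !orbT.
have := K t (lt0r_neq0 t0); rewrite gtr0_norm// => /(_ tr).
rewrite !add0r addr0 !subr0 subrr subr0 ltr_norml => /andP[+ _].
have td' : 0 <= t <= d by rewrite (ltW t0).
have := odl _ td'.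
have -> : B * (t ^+ 2 + m * (d * t - t ^+ 2)) = (B * (m * d) - B * t * (m - 1)) * t.
  by ring.
rewrite BE -ler_pdivrMr//.
have : 0 <= B * t * (m - 1).
  by apply: mulr_ge0; [rewrite mulr_ge0 ?ltW|rewrite /m; lra].
rewrite eE; lra.
Qed.

(** The barrier [B * ((x - x0) ^+ 2 + 2 * (2 * d * y - y ^+ 2))] vanishes linearly in [y] above
    [x0]. Its Laplacian is [- 2 * B], and its drift [2 * lam / y * (B * (4 * (d - y)))] is
    outweighed by [V y] times the barrier; this is where the exact potential [2 * lam / y ^+ 2]
    enters. *)
Lemma quotient_y_le : (forall y, V y = 2 * lam / y ^+ 2) ->
  (forall x, P x 0 -> h x 0 = 0) -> y0 <= d -> h x0 y0 <= 4 * S / d * y0.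
Proof.
have [l0 yp dp Sp] := And4 lam0 y0pos d0 S0.
move=> VE h0 yd; pose B : R := S / d ^+ 2.
have B0 : 0 < B by rewrite /B divr_gt0 ?exprn_gt0.
have BE : B * d ^+ 2 = S by rewrite /B divfK// expf_eq0/= gt_eqF.
have BEd : 4 * S / d = B * d * 4 by rewrite /B; field; exact: lt0r_neq0.
clearbody B.
have b1 (s : R) : x0 - d <= s <= x0 + d -> `|s - x0| <= d by rewrite ler_norml; lra.
have b2 (t : R) : 0 <= t <= d -> `|t - y0| <= d by rewrite ler_norml; lra.
have PP (s t : R) : x0 - d <= s <= x0 + d -> 0 <= t <= d -> P s t.
  by move=> sd td; apply: boxP; [exact: b1|exact: b2|case/andP: td].
have HS (s t : R) : x0 - d <= s <= x0 + d -> 0 <= t <= d -> h s t <= S.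
  move=> sd td; apply: le_trans (ler_norm _) _.
  by apply: hS; [exact: b1|exact: b2|case/andP: td].
have q0 (t : R) : 0 <= t <= d -> 0 <= B * (2 * (2 * d * t - t ^+ 2)).
  move=> /andP[t0 td]; apply: mulr_ge0; first exact: ltW.
  have : 0 <= t * (2 * d - t) by apply: mulr_ge0 => //; lra.
  by rewrite mulrBr expr2; lra.
have p0 (s : R) : 0 <= B * (s - x0) ^+ 2 by rewrite mulr_ge0 ?sqr_ge0 ?ltW.
pose u x y := h x y - B * ((x - x0) ^+ 2 + 2 * (2 * d * y - y ^+ 2)).
suff : u x0 y0 <= 0.
  rewrite /u subrr expr0n/= add0r BEd subr_le0.
  move=> /le_trans; apply.
  have -> : B * d * 4 * y0 = B * (2 * (2 * d * y0 - y0 ^+ 2)) + 2 * (B * y0 ^+ 2) by ring.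
  by rewrite lerDl !mulr_ge0 ?sqr_ge0 ?ltW.
(* The rectangle reaches from the edge only up to height [d]: as [0 < y0 <= d], it lies where [hS]
   applies. *)
apply: (@max_principle R u (fun y => 2 * lam / y) (x0 - d) (x0 + d) 0 d) => //.
- by lra.
- apply: continuous_in_subspaceT => -[s t]; rewrite inE/= => -[sd td].
  rewrite /u; apply: cvgB; first exact/hcont/PP.
  apply: cvgMr; apply: cvgD.
    by rewrite expr2; apply: cvgM; (apply: cvgB; [exact: cvg_fst|exact: cvg_cst]).
  apply: cvgMr; apply: cvgB; first by apply: cvgMr; exact: cvg_snd.
  by rewrite expr2; apply: cvgM; exact: cvg_snd.
- move=> s t sd td E; rewrite /u mulrDr subr_le0.
  have hs := HS _ _ sd td; have := q0 _ td; have := p0 s.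
  case: E => [E|[E|E]].
  + have -> : (s - x0) ^+ 2 = d ^+ 2 by rewrite E; ring.
    by rewrite BE; lra.
  + have -> : (s - x0) ^+ 2 = d ^+ 2 by rewrite E; ring.
    by rewrite BE; lra.
  + have -> : B * (2 * (2 * d * t - t ^+ 2)) = 2 * (B * d ^+ 2) by rewrite E; ring.
    by rewrite BE; lra.
- move=> s /andP[s0 sd]; have sdc : x0 - d <= s <= x0 + d by rewrite !ltW.
  have z0 : 0 <= (0 : R) <= d by rewrite lexx ltW.
  rewrite /u h0; last exact: PP.
  by have := q0 _ z0; have := p0 s; rewrite mulrDr; lra.
- move=> s t /andP[s0 sd] /andP[t0 td] upos.
  have sdc : x0 - d <= s <= x0 + d by rewrite !ltW.
  have tdc : 0 <= t <= d by rewrite !ltW.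
  exists (fun s => hx s t - B * (2 * (s - x0))).
  exists (fun t => hy s t - B * (4 * (d - t))).
  exists (hxx s t - 2 * B), (hyy s t + 4 * B); split.
  + move=> s' /andP[? ?].
    have [|D _ _ _ _] := @hsol s' t _ t0; first by apply: PP; rewrite ?tdc ?ltW.
    have Q := @is_derive1_quad R (B * (x0 ^+ 2 + 2 * (2 * d * t - t ^+ 2))) (- (2 * B * x0)) B s'.
    have HH := is_deriveB D Q.
    apply: is_derive1_ext HH _ _ => [w|]; rewrite /u ?fctE/=; ring.
  + move=> t' /andP[t'0 ?].
    have [|_ D _ _ _] := @hsol s t' _ t'0; first by apply: PP; rewrite ?sdc ?ltW.
    have Q := @is_derive1_quad R (B * (s - x0) ^+ 2) (4 * B * d) (- (2 * B)) t'.
    have HH := is_deriveB D Q.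
    apply: is_derive1_ext HH _ _ => [w|]; rewrite /u ?fctE/=; ring.
  + have [_ _ D _ _] := hsol (PP _ _ sdc tdc) t0.
    have Q := @is_derive1_quad R (- (2 * B * x0)) (2 * B) 0 s.
    have HH := is_deriveB D Q.
    apply: is_derive1_ext HH _ _ => [w|]; rewrite ?fctE/=; ring.
  + have [_ _ _ D _] := hsol (PP _ _ sdc tdc) t0.
    have Q := @is_derive1_quad R (4 * B * d) (- (4 * B)) 0 t.
    have HH := is_deriveB D Q.
    apply: is_derive1_ext HH _ _ => [w|]; rewrite ?fctE/=; ring.
  + have [_ _ _ _ E] := hsol (PP _ _ sdc tdc) t0.
    rewrite VE in E.
    have kE : 2 * lam / t ^+ 2 * (B * (2 * (2 * d * t - t ^+ 2))) =
        2 * lam / t * (B * (4 * (d - t))) + 2 * (2 * lam * B).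
      by field; exact: lt0r_neq0.
    have k0 : 0 <= 2 * lam / t ^+ 2 by rewrite divr_ge0 ?exprn_ge0 ?mulr_ge0// ltW.
    have l1 : 0 <= 2 * lam * B by rewrite !mulr_ge0// ltW.
    have /(ler_wpM2l k0) : B * (2 * (2 * d * t - t ^+ 2)) <= h s t.
      by move: upos; rewrite /u mulrDr; have := p0 s; lra.
    rewrite kE -E mulrBr; lra.
- by lra.
- by rewrite yd ltW.
Qed.

End gradient_bounds.

Lemma solvesN (R : realType) (lam : R) (P : R -> R -> Prop) (V : R -> R)
    (h hx hy hxx hyy : R -> R -> R) : solves lam P V h hx hy hxx hyy ->
  solves lam P V (fun x y => - h x y) (fun x y => - hx x y)
    (fun x y => - hy x y) (fun x y => - hxx x y) (fun x y => - hyy x y).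
Proof.
move=> H x y Pxy y0; have [D1 D2 D3 D4 E] := H _ _ Pxy y0.
split; [exact: is_deriveN D1|exact: is_deriveN D2|exact: is_deriveN D3
  |exact: is_deriveN D4|by rewrite !mulrN -!opprD E].
Qed.

Lemma partial_x_norm_le (R : realType) (lam : R) (P : R -> R -> Prop)
    (V : R -> R) (h hx hy hxx hyy : R -> R -> R) (x0 y0 d S : R) :
  0 <= lam -> (forall y : R, 0 < y -> 0 <= V y) ->
  solves lam P V h hx hy hxx hyy ->
  (forall x y, P x y -> {for (x, y), continuous (fun p : R * R => h p.1 p.2)}) ->
  ((forall x, P x 0 -> h x 0 = 0) \/
   (forall x, P x 0 -> is_derive (0 : R) (1 : R) (h x) (0 : R))) ->
  0 < y0 -> 0 < d -> 0 < S ->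
  (forall x y, `|x - x0| <= d -> `|y - y0| <= d -> 0 <= y -> P x y) ->
  (forall x y, `|x - x0| <= d -> `|y - y0| <= d -> 0 <= y -> `|h x y| <= S) ->
  `|hx x0 y0| <= (3 + 2 * lam) * S / d.
Proof.
move=> l0 V0 sol c bot y0p d0 S0 bP bS.
rewrite ler_norml (partial_x_le l0 V0 sol c bot y0p d0 S0 bP bS) andbT.
rewrite lerNl; apply: (partial_x_le l0 V0 (solvesN sol) _ _ y0p d0 S0 bP _).
- by move=> x y Pxy; apply: cvgN; exact: c.
- case: bot => H; [left|right] => x Px; first by rewrite H// oppr0.
  by apply: is_derive1_ext (is_deriveN (H _ Px)) _ _ => //; rewrite oppr0.
- by move=> x y ? ? ?; rewrite normrN; exact: bS.
Qed.

(* [g + i v] is lambda-analytic, with [g] even and [v] odd in [y], and [g],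
   [v] real; only the half plane [y > 0] and the edge [y = 0] are recorded. *)
Definition conj_pair (R : realType) (lam : R) (P : R -> R -> Prop)
    (g v : R -> R -> R) : Prop :=
  exists gx gy gxx gyy vx vy vxx vyy : R -> R -> R,
  [/\ solves lam P (fun=> 0) g gx gy gxx gyy,
      solves lam P (fun y => 2 * lam / y ^+ 2) v vx vy vxx vyy,
      (forall x y, P x y -> 0 < y ->
        gy x y = - vx x y /\ vy x y = gx x y - 2 * lam / y * v x y),
      (forall x y, P x y -> {for (x, y), continuous (fun p : R * R => g p.1 p.2)} /\
        {for (x, y), continuous (fun p : R * R => v p.1 p.2)}) &
      forall x, P x 0 -> is_derive (0 : R) (1 : R) (g x) (0 : R) /\ v x 0 = 0].

Lemma MVT_norm_le (R : realType) (f df : R -> R) (a b M : R) :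
  (forall x, a <= x <= b \/ b <= x <= a -> is_derive x 1 f (df x) /\ `|df x| <= M) ->
  `|f b - f a| <= M * `|b - a|.
Proof.
move=> H; have [ab|/ltW ba] := leP a b.
  have [c cab ->] := MVT_open ab (fun x xab => (H x (or_introl xab)).1).
  by rewrite normrM ler_wpM2r//; apply: (H _ (or_introl cab)).2.
have [c cab E] := MVT_open ba (fun x xab => (H x (or_intror xab)).1).
rewrite distrC E normrM (distrC a) ler_wpM2r//; apply: (H _ (or_intror cab)).2.
Qed.

Section pair_estimates.
Variables (R : realType) (lam : R) (P : R -> R -> Prop) (g v : R -> R -> R).
Hypotheses (lam0 : 0 <= lam).
Variables gx gy gxx gyy vx vy vxx vyy : R -> R -> R.
Hypothesis gsol : solves lam P (fun=> 0) g gx gy gxx gyy.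
Hypothesis vsol : solves lam P (fun y => 2 * lam / y ^+ 2) v vx vy vxx vyy.
Hypothesis cr : forall x y, P x y -> 0 < y ->
  gy x y = - vx x y /\ vy x y = gx x y - 2 * lam / y * v x y.
Hypothesis cont : forall x y, P x y ->
  {for (x, y), continuous (fun p : R * R => g p.1 p.2)} /\
  {for (x, y), continuous (fun p : R * R => v p.1 p.2)}.
Hypothesis edge : forall x, P x 0 ->
  is_derive (0 : R) (1 : R) (g x) (0 : R) /\ v x 0 = 0.

(** Reflection bounds [gx] and [vx], and [gy = - vx]. For [vy] the term [2 * lam / y * v] adds
    [2 * lam * 4] to [3 + 2 * lam], whence [3 + 10 * lam]; when [y0 > d], the bound [S] on [v]
    already implies the one that is linear in [y0]. *)
Lemma pair_gradient_le (x0 y0 d S : R) : 0 < y0 -> 0 < d -> 0 < S ->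
  (forall x y, `|x - x0| <= d -> `|y - y0| <= d -> 0 <= y -> P x y) ->
  (forall x y, `|x - x0| <= d -> `|y - y0| <= d -> 0 <= y ->
     `|g x y| <= S /\ `|v x y| <= S) ->
  let M := (3 + 10 * lam) * S / d in
  [/\ `|gx x0 y0| <= M, `|gy x0 y0| <= M, `|vx x0 y0| <= M & `|vy x0 y0| <= M].
Proof.
move=> yp dp Sp bP bS M; have l0 := lam0.
have V0 (y : R) : 0 < y -> 0 <= 2 * lam / y ^+ 2.
  by move=> y0p; rewrite divr_ge0 ?exprn_ge0 ?mulr_ge0// ltW.
have bSg x y h1 h2 h3 := (bS x y h1 h2 h3).1.
have bSv x y h1 h2 h3 := (bS x y h1 h2 h3).2.
have P0 : P x0 y0 by apply: bP; rewrite ?subrr ?normr0 ?ltW.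
have G : `|gx x0 y0| <= (3 + 2 * lam) * S / d.
  apply: (partial_x_norm_le lam0 _ gsol _ _ yp dp Sp bP bSg) => //.
  - by move=> x y /cont[].
  - by right => x /edge[].
have W : `|vx x0 y0| <= (3 + 2 * lam) * S / d.
  apply: (partial_x_norm_le lam0 V0 vsol _ _ yp dp Sp bP bSv).
  - by move=> x y /cont[].
  - by left => x /edge[].
have SD : 0 <= S / d by rewrite divr_ge0 ?ltW.
have SM : (3 + 2 * lam) * S / d + 8 * lam * (S / d) = M.
  by rewrite /M; field; exact: lt0r_neq0.
have lSD : 0 <= 8 * lam * (S / d) by do 2 apply: mulr_ge0 => //.
have Q : `|v x0 y0| <= 4 * S / d * y0.
  have [yd|dy] := leP y0 d.
    rewrite ler_norml; apply/andP; split; last first.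
      apply: (quotient_y_le l0 vsol _ yp dp Sp bP bSv) => //.
        by move=> x y /cont[].
      by move=> x /edge[].
    rewrite lerNl.
    apply: (quotient_y_le l0 (solvesN vsol) _ yp dp Sp bP) => //.
    + by move=> x y /cont[_ c]; exact: cvgN.
    + by move=> x y ? ? ?; rewrite normrN; exact: bSv.
    + by move=> x /edge[_ ->]; rewrite oppr0.
  apply: le_trans (bSv x0 y0 _ _ _) _; rewrite ?subrr ?normr0 ?ltW//.
  have : S <= S / d * y0 by rewrite mulrAC ler_pdivlMr// ler_wpM2l// ltW.
  have : 0 <= S / d * y0 by rewrite mulr_ge0// ltW.
  by rewrite -mulrA -(mulrA 4); lra.
have [gyE vyE] := cr P0 yp.
split; [by lra|by rewrite gyE normrN; lra|by lra|].
rewrite vyE; apply: le_trans (ler_normB _ _) _.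
have -> : M = (3 + 2 * lam) * S / d + 8 * lam * (S / d) by [].
apply: lerD => //; rewrite normrM ger0_norm; last first.
  by rewrite divr_ge0 ?mulr_ge0// ltW.
have -> : 8 * lam * (S / d) = 2 * lam / y0 * (4 * S / d * y0).
  by field; rewrite !lt0r_neq0.
by rewrite ler_wpM2l// divr_ge0 ?mulr_ge0// ltW.
Qed.

(** The gradient bound holds at every point within [d / 2], with box size [d / 2]. A vertical and a
    horizontal step of length at most [e * d] then cost [2 * ((3 + 10 * lam) * S / (d / 2)) * (e *
    d)]. *)
Lemma pair_lipschitz (x0 y0 d S e : R) : 0 < y0 -> 0 < d -> 0 < S ->
  0 < e <= 2^-1 ->
  (forall x y, `|x - x0| <= d -> `|y - y0| <= d -> 0 <= y -> P x y) ->
  (forall x y, `|x - x0| <= d -> `|y - y0| <= d -> 0 <= y ->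
     `|g x y| <= S /\ `|v x y| <= S) ->
  forall x y, `|x - x0| <= e * d -> `|y - y0| <= e * d -> 0 < y ->
  `|g x y - g x0 y0| <= 4 * (3 + 10 * lam) * e * S /\
  `|v x y - v x0 y0| <= 4 * (3 + 10 * lam) * e * S.
Proof.
move=> yp dp Sp /andP[e0 e2] bP bS x y xx yy y0p.
have ed : e * d <= d / 2 by rewrite mulrC ler_pM2l.
pose M := (3 + 10 * lam) * S / (d / 2).
have gr s t : `|s - x0| <= d / 2 -> `|t - y0| <= d / 2 -> 0 < t ->
  [/\ `|gx s t| <= M, `|gy s t| <= M, `|vx s t| <= M & `|vy s t| <= M].
  move=> ss tt t0.
  have tri (a b c : R) : `|a - b| <= d / 2 -> `|b - c| <= d / 2 -> `|a - c| <= d.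
    by rewrite !ler_norml; lra.
  apply: pair_gradient_le => //; first exact: divr_gt0.
  - by move=> p q pp qq q0; apply: bP => //; [exact: tri ss|exact: tri tt].
  - by move=> p q pp qq q0; apply: bS => //; [exact: tri ss|exact: tri tt].
have PP s t : `|s - x0| <= d / 2 -> `|t - y0| <= d / 2 -> 0 < t -> P s t.
  move=> ss tt t0; apply: bP; rewrite ?(ltW t0)//.
    by apply: le_trans ss _; lra.
  by apply: le_trans tt _; lra.
have M0 : 0 <= M by rewrite /M divr_ge0 ?mulr_ge0 ?ltW//; have := lam0; lra.
have ME : 4 * (3 + 10 * lam) * e * S = M * (e * d) + M * (e * d).
  by rewrite /M; field; exact: lt0r_neq0.
have x0d : `|y0 - y0| <= d / 2 by rewrite subrr normr0 divr_ge0// ltW.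
have key (h hx hy : R -> R -> R) :
    (forall s t, `|s - x0| <= d / 2 -> `|t - y0| <= d / 2 -> 0 < t ->
       [/\ is_derive s 1 (h^~ t) (hx s t), is_derive t 1 (h s) (hy s t),
           `|hx s t| <= M & `|hy s t| <= M]) ->
    `|h x y - h x0 y0| <= 4 * (3 + 10 * lam) * e * S.
  move=> H; rewrite ME.
  have -> : h x y - h x0 y0 = (h x y - h x y0) + (h x y0 - h x0 y0) by ring.
  apply: le_trans (ler_normD _ _) _; apply: lerD.
    apply: (le_trans (y := M * `|y - y0|)); last by rewrite ler_wpM2l.
    apply: (@MVT_norm_le R (h x) (hy x)) => t tt.
    have t0 : 0 < t by case: tt => ?; lra.
    have td : `|t - y0| <= d / 2.
      by move: yy; rewrite !ler_norml; case: tt => ? ?; lra.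
    by have [||_ ? _ ?] := H x t _ _ t0; [exact: le_trans xx ed|exact: td|].
  apply: (le_trans (y := M * `|x - x0|)); last by rewrite ler_wpM2l.
  apply: (@MVT_norm_le R (h^~ y0) (hx^~ y0)) => s ss.
  have sd : `|s - x0| <= d / 2.
    by move: xx; rewrite !ler_norml; case: ss => ? ?; lra.
  by have [||? _ ? _] := H s y0 _ _ yp; [exact: sd|exact: x0d|].
split.
  apply: (key g gx gy) => s t ss tt t0; have [? ? ? ?] := gr _ _ ss tt t0.
  by have [? ? _ _ _] := gsol (PP _ _ ss tt t0) t0.
apply: (key v vx vy) => s t ss tt t0; have [? ? ? ?] := gr _ _ ss tt t0.
by have [? ? _ _ _] := vsol (PP _ _ ss tt t0) t0.
Qed.

End pair_estimates.

(** * The sub-mean value property *)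

(** The integral of a nonnegative function is a supremum over simple functions below it, so
    monotonicity holds for arbitrary sets and functions. This lets the weight, which is only
    Lebesgue measurable, stand under an integral for the Borel product measure. *)
Lemma ge0_le_integral_subset d (T : measurableType d) (R : realType)
    (mu : {measure set T -> \bar R}) (D E : set T) (f g : T -> \bar R) :
  (forall x, D x -> 0 <= f x)%E -> (forall x, E x -> 0 <= g x)%E ->
  (forall x, D x -> E x /\ (f x <= g x)%E) ->
  (\int[mu]_(x in D) f x <= \int[mu]_(x in E) g x)%E.
Proof.
move=> f0 g0 fg; rewrite !ge0_integralE//.
apply: ub_ereal_sup => _ /= [h hf <-]; apply: ereal_sup_ubound; exists h => // x.
apply: le_trans (hf x) _; rewrite /patch; case: ifPn => [|_].
  by rewrite inE => /fg[Ex fgx]; rewrite mem_set.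
by case: ifPn => //; rewrite inE; exact: g0.
Qed.

(** For [c] equal to [a] or [b], the ratio [c / (a + b)] is at most [1], hence at most its [p]-th
    power; the two ratios add up to [1]. *)
Lemma powR_subadd (R : realType) (a b p : R) : 0 <= a -> 0 <= b -> 0 < p <= 1 ->
  (a + b) `^ p <= a `^ p + b `^ p.
Proof.
move=> a0 b0 /andP[p0 p1].
have [ab0|ab0] := eqVneq (a + b) 0.
  by rewrite ab0 powR0 ?gt_eqF// addr_ge0// powR_ge0.
have abp : 0 < a + b by rewrite lt_neqAle eq_sym ab0 addr_ge0.
have key c : 0 <= c -> c <= a + b -> (a + b) `^ p * (c / (a + b)) <= c `^ p.
  move=> c0 cab; have [->|cn0] := eqVneq c 0.
    by rewrite mul0r mulr0 powR_ge0.
  have cp : 0 < c by rewrite lt_neqAle eq_sym cn0.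
  have {2}-> : c = (a + b) * (c / (a + b)) by rewrite mulrC divfK.
  rewrite powRM ?(ltW abp) ?divr_ge0 ?(ltW abp)// ler_pM2l ?powR_gt0//.
  by apply: ger1_powR => //; rewrite divr_gt0//= ler_pdivrMr// mul1r.
have ka := key a a0; have kb := key b b0.
apply: le_trans (lerD (ka _) (kb _)); rewrite ?lerDl ?lerDr//.
by rewrite -mulrDr -mulrDl divff// mulr1.
Qed.

Lemma ler_powR_base (R : realType) (a b r : R) : 0 <= r -> 0 <= a -> a <= b ->
  a `^ r <= b `^ r.
Proof.
by move=> r0 a0 ab; apply: ge0_ler_powR; rewrite ?nnegrE//; exact: le_trans ab.
Qed.

(** All that the mean value argument keeps of the gradient bounds. It is one-sided, since a lower
    bound of [a] near the centre is what bounds the central value by an average. *)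
Definition slowly_varying (R : realType) (K : R) (P : R -> R -> Prop)
    (a : R -> R -> R) : Prop :=
  forall x0 y0 d S e : R, 0 < y0 -> 0 < d -> 0 < S -> 0 < e <= 2^-1 ->
  (forall x y, `|x - x0| <= d -> `|y - y0| <= d -> 0 <= y -> P x y) ->
  (forall x y, `|x - x0| <= d -> `|y - y0| <= d -> 0 <= y -> a x y <= S) ->
  forall x y, `|x - x0| <= e * d -> `|y - y0| <= e * d -> 0 < y ->
  a x0 y0 <= a x y + K * e * S.

Definition amplitude (R : realType) (g1 v1 g2 v2 : R -> R -> R) (x y : R) : R :=
  `|g1 x y| + `|v1 x y| + `|g2 x y| + `|v2 x y|.

(** The constant is four times that of [pair_lipschitz], once for each modulus. *)
Lemma amplitude_slowly_varying (R : realType) (lam : R) (P : R -> R -> Prop)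
    (g1 v1 g2 v2 : R -> R -> R) : 0 <= lam ->
  conj_pair lam P g1 v1 -> conj_pair lam P g2 v2 ->
  slowly_varying (16 * (3 + 10 * lam)) P (amplitude g1 v1 g2 v2).
Proof.
move=> l0 [g1x [g1y [g1xx [g1yy [v1x [v1y [v1xx [v1yy [A1 A2 A3 A4 A5]]]]]]]]].
move=> [g2x [g2y [g2xx [g2yy [v2x [v2y [v2xx [v2yy [B1 B2 B3 B4 B5]]]]]]]]].
move=> x0 y0 d S e yp dp Sp ep bP bS x y xx yy y0p.
have bd (i a b c w : R) : i = `|a| + `|b| + `|c| + `|w| -> i <= S ->
    [/\ `|a| <= S, `|b| <= S, `|c| <= S & `|w| <= S].
  by have [? ? ? ?] := And4 (normr_ge0 a) (normr_ge0 b) (normr_ge0 c) (normr_ge0 w); split; lra.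
have [|E1 E2] := @pair_lipschitz R lam P g1 v1 l0 _ _ _ _ _ _ _ _ A1 A2 A3 A4 A5 x0 y0 d S e yp dp Sp ep bP _ x y xx yy y0p.
  by move=> s t ss tt t0; have [] := bd _ _ _ _ _ erefl (bS s t ss tt t0).
have [|E3 E4] := @pair_lipschitz R lam P g2 v2 l0 _ _ _ _ _ _ _ _ B1 B2 B3 B4 B5 x0 y0 d S e yp dp Sp ep bP _ x y xx yy y0p.
  by move=> s t ss tt t0; have [] := bd _ _ _ _ _ erefl (bS s t ss tt t0).
have tri (b c M : R) : `|b - c| <= M -> `|c| <= `|b| + M.
  move=> h; have := ler_normD b (c - b); rewrite addrC subrK (distrC c); lra.
have := And4 (tri _ _ _ E1) (tri _ _ _ E2) (tri _ _ _ E3) (tri _ _ _ E4).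
move=> [F1 F2 F3 F4]; rewrite /amplitude.
have -> : 16 * (3 + 10 * lam) * e * S = 4 * (4 * (3 + 10 * lam) * e * S) by ring.
lra.
Qed.

Lemma amplitude_continuous (R : realType) (lam : R) (P : R -> R -> Prop)
    (g1 v1 g2 v2 : R -> R -> R) :
  conj_pair lam P g1 v1 -> conj_pair lam P g2 v2 ->
  forall x y, P x y ->
  {for (x, y), continuous (fun p : R * R => amplitude g1 v1 g2 v2 p.1 p.2)}.
Proof.
move=> [g1x [g1y [g1xx [g1yy [v1x [v1y [v1xx [v1yy [A1 A2 A3 A4 A5]]]]]]]]].
move=> [g2x [g2y [g2xx [g2yy [v2x [v2y [v2xx [v2yy [B1 B2 B3 B4 B5]]]]]]]]].
move=> x y Pxy; have [c1 c2] := A4 _ _ Pxy; have [c3 c4] := B4 _ _ Pxy.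
by rewrite /amplitude; apply: cvgD; [apply: cvgD; [apply: cvgD|]|]; apply: cvg_norm.
Qed.

Lemma lebesgue_measure_rectangle (R : realType) (a b c d : R) : a <= b -> c <= d ->
  ((@lebesgue_measure R \x @lebesgue_measure R) (`[a, b] `*` `[c, d]) =
   ((b - a) * (d - c))%:E)%E.
Proof.
move=> ab cd.
transitivity (@lebesgue_measure R `[a, b] * @lebesgue_measure R `[c, d])%E.
  exact: product_measure1E.
have E (s t : R) : s <= t -> @lebesgue_measure R `[s, t] = (t - s)%:E.
  move=> st; rewrite lebesgue_measure_itv/= lte_fin -EFinB.
  by case: ltgtP st => // <-; rewrite subrr.
by rewrite !E// EFinM.
Qed.

Definition upper_box (R : realType) (x0 y0 d : R) : set (R * R) :=
  [set z | [/\ `|z.1 - x0| <= d, `|z.2 - y0| <= d & 0 < z.2]].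

(** Subadditivity of the [p]-th power turns slow variation into [a x y ^ p >= a x0 y0 ^ p - (K * e)
    ^ p * S ^ p] on a small box, and this lower bound is integrated there. If it is not positive,
    the claim is immediate. *)
Lemma submean_with_error (R : realType) (K p k : R) (P : R -> R -> Prop)
    (a : R -> R -> R) (x0 y0 d S e J : R) (D : set (R * R)) :
  0 < K -> 0 < p <= 1 -> 0 <= k -> (forall x y, 0 <= a x y) ->
  slowly_varying K P a ->
  0 < y0 -> 0 < d -> 0 < S -> 0 < e <= 2^-1 ->
  (forall x y, `|x - x0| <= d -> `|y - y0| <= d -> 0 <= y -> P x y) ->
  (forall x y, `|x - x0| <= d -> `|y - y0| <= d -> 0 <= y -> a x y <= S) ->
  upper_box x0 y0 d `<=` D -> (forall z, D z -> 0 < z.2) ->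
  (\int[(@lebesgue_measure R \x @lebesgue_measure R)%E]_(z in D) (a z.1 z.2 `^ p * z.2 `^ k)%:E <= J%:E)%E ->
  a x0 y0 `^ p * (d ^+ 2 * (y0 + d) `^ k) <=
  (e ^+ 2 * (e / 2) `^ k)^-1 * J +
  (K * e) `^ p * (S `^ p * (d ^+ 2 * (y0 + d) `^ k)).
Proof.
move=> Kp /andP[p0 p1] kge0 a0 sv yp dp Sp /andP[e0 e2] bP bS subD D0 JD.
pose c := (a x0 y0 `^ p - (K * e) `^ p * S `^ p) * ((e / 2) `^ k * (y0 + d) `^ k).
have cE : e ^+ 2 * d ^+ 2 * c = (a x0 y0 `^ p * (d ^+ 2 * (y0 + d) `^ k) -
   (K * e) `^ p * (S `^ p * (d ^+ 2 * (y0 + d) `^ k))) * (e ^+ 2 * (e / 2) `^ k).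
  by rewrite /c; ring.
have ek0 : 0 < e ^+ 2 * (e / 2) `^ k by rewrite mulr_gt0 ?exprn_gt0 ?powR_gt0 ?divr_gt0.
suff : e ^+ 2 * d ^+ 2 * c <= J.
  rewrite cE -ler_pdivlMr// (mulrC _ J); lra.
have J0 : 0 <= J.
  rewrite -lee_fin; apply: le_trans JD; apply: integral_ge0 => z _.
  by rewrite lee_fin mulr_ge0 ?powR_ge0.
have [c0|c0] := leP c 0.
  by apply: le_trans J0; rewrite mulr_ge0_le0// mulr_ge0// exprn_ge0// ltW.
(* The top quarter of the box of half-size [e * d]. Its area is [e ^+ 2 * d ^+ 2], and on it [y] is
   at least [e / 2 * (y0 + d)], however small [y0] is compared with [d]. *)
pose B : set (R * R) := `[x0 - e * d, x0 + e * d] `*` `[y0 + e * d / 2, y0 + e * d].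
have ed0 : 0 < e * d by rewrite mulr_gt0.
have edd : e * d <= d / 2 by rewrite mulrC ler_pM2l.
have mB : measurable B by apply: measurableX.
have muB : ((@lebesgue_measure R \x @lebesgue_measure R) B = (e ^+ 2 * d ^+ 2)%:E)%E.
  rewrite lebesgue_measure_rectangle; [|lra|lra].
  by congr EFin; field.
rewrite -lee_fin; apply: le_trans JD.
rewrite mulrC EFinM -muB -integral_cst//.
apply: ge0_le_integral_subset.
- by move=> z _; rewrite lee_fin ltW.
- by move=> z _; rewrite lee_fin mulr_ge0 ?powR_ge0.
move=> [x y]; rewrite /B/= !in_itv/= => -[/andP[x1 x2] /andP[y1 y2]].
have xx : `|x - x0| <= e * d by rewrite ler_norml; lra.
have yy : `|y - y0| <= e * d by rewrite ler_norml; lra.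
have y0p : 0 < y by lra.
split.
  by apply: subD; split => //=; [move: xx edd dp|move: yy edd dp]; rewrite !ler_norml; clear; lra.
rewrite lee_fin /c.
have Kes : a x0 y0 `^ p - (K * e) `^ p * S `^ p <= a x y `^ p.
  rewrite -powRM ?mulr_ge0// ?(ltW e0) ?(ltW Sp) ?(ltW Kp)//.
  rewrite lerBlDr; apply: le_trans (powR_subadd _ _ _); rewrite ?p0 ?mulr_ge0 ?(ltW e0) ?(ltW Sp) ?(ltW Kp)//.
  apply: ler_powR_base => //; first exact: ltW.
  by apply: sv bP bS _ _ xx yy y0p => //; rewrite e0.
apply: ler_pM => //.
- by move: c0; rewrite /c pmulr_lgt0 ?mulr_gt0 ?powR_gt0 ?divr_gt0//; [exact: ltW|lra].
- by rewrite mulr_ge0 ?powR_ge0.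
rewrite -powRM; [|by rewrite divr_ge0 ?(ltW e0)|by rewrite addr_ge0 ?ltW].
apply: ler_powR_base => //; first by rewrite mulr_ge0 ?divr_ge0 ?addr_ge0 ?ltW.
have ey : e * y0 <= 2^-1 * y0 by rewrite ler_pM2r.
by move: ey y1 yp; clear; lra.
Qed.

(** Slow variation asks for a bound on the closed box, whereas suprema are taken over points with
    [y > 0]; continuity up to the edge bridges the two. *)
Lemma edge_bound (R : realType) (P : R -> R -> Prop) (a : R -> R -> R)
    (x y d S : R) :
  (forall x y, P x y -> {for (x, y), continuous (fun p : R * R => a p.1 p.2)}) ->
  0 < y -> `|0 - y| <= d -> P x 0 ->
  (forall t, `|t - y| <= d -> 0 < t -> a x t <= S) -> a x 0 <= S.
Proof.
move=> ca y0p yd Px H; rewrite leNgt; apply/negP => lt.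
have e0 : 0 < a x 0 - S by rewrite subr_gt0.
have := ca _ _ Px; move/cvgrPdist_lt => /(_ _ e0) /=.
move=> /nbhs_ballP[r /= r0 Br].
pose t := Num.min (r / 2) y.
have t0 : 0 < t by rewrite /t lt_min divr_gt0.
have tr : t <= r / 2 by rewrite /t ge_min lexx.
have ty : t <= y by rewrite /t ge_min lexx orbT.
have xt : ball (x, 0) r (x, t).
  split; rewrite /= /ball/= ?subrr ?normr0//.
  by rewrite sub0r normrN gtr0_norm//; lra.
have := Br _ xt; rewrite /= ltr_norml.
have : a x t <= S by apply: H => //; move: yd; rewrite !ler_norml; lra.
lra.
Qed.

(* comparable to the measure [|y|^k dx dy] of the box of half-size [d] *)
Definition box_weight (R : realType) (k y d : R) : R := d ^+ 2 * (y + d) `^ k.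

Lemma box_weight_ge0 (R : realType) (k y d : R) : 0 <= box_weight k y d.
Proof. by rewrite /box_weight mulr_ge0 ?powR_ge0 ?sqr_ge0. Qed.

Lemma box_weight_gt0 (R : realType) (k y d : R) : 0 <= y -> 0 < d -> 0 < box_weight k y d.
Proof. by move=> y0 d0; rewrite /box_weight mulr_gt0 ?exprn_gt0 ?powR_gt0 ?ltr_wpDl. Qed.

Lemma le_box_weight (R : realType) (k c y d y' d' : R) : 0 <= k -> 0 < c -> 0 <= y -> 0 <= d -> d <= d' ->
  y + d <= c * (y' + d') -> box_weight k y d <= c `^ k * box_weight k y' d'.
Proof.
move=> k0 c0 y0 d0 dd h; have yd : 0 <= y' + d'.
  by rewrite -(pmulr_rge0 _ c0); apply: le_trans h; rewrite addr_ge0.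
rewrite /box_weight mulrCA -powRM// ?(ltW c0)//; apply: ler_pM; rewrite ?sqr_ge0 ?powR_ge0//.
  by rewrite ler_pXn2r ?nnegrE//; exact: le_trans dd.
by apply: ler_powR_base => //; rewrite addr_ge0.
Qed.

Lemma box_weight_double (R : realType) (k y d : R) : 0 <= k -> 0 <= y -> 0 <= d -> box_weight k y (2 * d) <= 4 * 2 `^ k * box_weight k y d.
Proof.
move=> k0 y0 d0; have yd : 0 <= y + d by rewrite addr_ge0.
have -> : 4 * 2 `^ k * box_weight k y d = (2 * d) ^+ 2 * (2 * (y + d)) `^ k.
  by rewrite /box_weight powRM//; ring.
rewrite /box_weight; apply: ler_wpM2l; first exact: sqr_ge0.
by apply: ler_powR_base => //; [rewrite addr_ge0 ?mulr_ge0|lra].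
Qed.

(** Distance in the maximum norm to the boundary of the square of centre [(x0, y0)] and half-size
    [R0]. *)
Definition depth (R : realType) (x0 y0 R0 x y : R) : R := R0 - Num.max `|x - x0| `|y - y0|.

(** Any bound [M] of the weighted power improves to a multiple of the integral plus [M / 2]. At a
    point of depth [2 * d] the box of half-size [d] is used: its points have depth at least [d], so
    [M] bounds [a] there at the price of [2 ^ k]. Returning from size [d] to size [2 * d] costs
    [4 * 2 ^ k]. These are the factors in the condition on [e]. *)
Lemma submean_step (R : realType) (K p k : R) (P : R -> R -> Prop)
    (a : R -> R -> R) (e x0 y0 R0 j M : R) :
  0 < K -> 0 < p <= 1 -> 0 <= k -> (forall x y, 0 <= a x y) ->
  slowly_varying K P a ->
  (forall x y, P x y -> {for (x, y), continuous (fun p : R * R => a p.1 p.2)}) ->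
  0 < e <= 2^-1 ->
  (K * e) `^ p * (4 * 2 `^ k * 2 `^ k) <= 2^-1 ->
  (forall x y, `|x - x0| <= R0 -> `|y - y0| <= R0 -> 0 <= y -> P x y) ->
  (\int[(@lebesgue_measure R \x @lebesgue_measure R)%E]_(z in upper_box x0 y0 R0) (a z.1 z.2 `^ p * z.2 `^ k)%:E <= j%:E)%E ->
  0 < M ->
  (forall x y, upper_box x0 y0 R0 (x, y) ->
    a x y `^ p * box_weight k y (depth x0 y0 R0 x y) <= M) ->
  forall x y, upper_box x0 y0 R0 (x, y) ->
    a x y `^ p * box_weight k y (depth x0 y0 R0 x y) <=
    4 * 2 `^ k * (e ^+ 2 * (e / 2) `^ k)^-1 * j + M / 2.
Proof.
move=> K0 p01 k0 a0 sv ca e01 eK bP JJ M0 leM x y [/= xx yy zp].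
have j0 : 0 <= j.
  rewrite -lee_fin; apply: le_trans JJ; apply: integral_ge0 => z _.
  by rewrite lee_fin mulr_ge0 ?powR_ge0.
have [p0 p1] := andP p01; have [ep e2] := andP e01.
have d_ge0 : 0 <= depth x0 y0 R0 x y by rewrite /depth subr_ge0 ge_max xx.
have Ce0 : 0 <= (e ^+ 2 * (e / 2) `^ k)^-1 by rewrite invr_ge0 mulr_ge0 ?sqr_ge0 ?powR_ge0.
have [dz|dn0] := eqVneq (depth x0 y0 R0 x y) 0.
  rewrite /box_weight dz expr0n/= mul0r mulr0 addr_ge0 ?divr_ge0 ?(ltW M0)//.
  by rewrite !mulr_ge0 ?powR_ge0.
have [d [d0 ddE]] : exists d, 0 < d /\ depth x0 y0 R0 x y = 2 * d.
  exists (depth x0 y0 R0 x y / 2); split; last by field.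
  by rewrite divr_gt0// lt_neqAle eq_sym dn0.
have [mx my] : `|x - x0| <= R0 - 2 * d /\ `|y - y0| <= R0 - 2 * d.
  have -> : R0 - 2 * d = Num.max `|x - x0| `|y - y0| by rewrite -ddE /depth opprB addrC subrK.
  by rewrite !le_max !lexx orbT.
have inK s t : `|s - x| <= d -> `|t - y| <= d ->
    `|s - x0| <= R0 - d /\ `|t - y0| <= R0 - d.
  have E : R0 - d = d + (R0 - 2 * d) by ring.
  move=> h1 h2; rewrite E; split.
    by apply: le_trans (ler_distD x _ _) _; exact: lerD.
  by apply: le_trans (ler_distD y _ _) _; exact: lerD.
have R0d : R0 - d <= R0 by rewrite lerBlDr lerDl ltW.
have inR s t : `|s - x| <= d -> `|t - y| <= d -> `|s - x0| <= R0 /\ `|t - y0| <= R0.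
  by move=> h1 h2; have [h3 h4] := inK _ _ h1 h2; split; exact: le_trans R0d.
have ddd s t : `|s - x| <= d -> `|t - y| <= d -> d <= depth x0 y0 R0 s t.
  move=> h1 h2; have [h3 h4] := inK _ _ h1 h2.
  by rewrite /depth lerBrDr -lerBrDl ge_max h3.
have V0 : 0 < box_weight k y d by rewrite box_weight_gt0// ltW.
(* The bound for [a] on the box of half-size [d] around [(x, y)] that [M] implies. *)
pose S := (2 `^ k * M / box_weight k y d) `^ p^-1.
have SpE : S `^ p * box_weight k y d = 2 `^ k * M.
  rewrite /S -powRrM mulVf ?gt_eqF// powRr1 ?divfK ?gt_eqF//.
  by rewrite divr_ge0 ?(ltW V0)// mulr_ge0 ?powR_ge0 ?(ltW M0).
have Sp : 0 < S by rewrite /S powR_gt0// divr_gt0// mulr_gt0// powR_gt0.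
have bP' s t : `|s - x| <= d -> `|t - y| <= d -> 0 <= t -> P s t.
  by move=> h1 h2 t0; have [h3 h4] := inR _ _ h1 h2; exact: bP.
have aS' s t : `|s - x| <= d -> `|t - y| <= d -> 0 < t -> a s t <= S.
  move=> h1 h2 t0; have [h3 h4] := inR _ _ h1 h2.
  have Kst : upper_box x0 y0 R0 (s, t) by [].
  have le1 := leM _ _ Kst; have dst := ddd _ _ h1 h2.
  have V1 : box_weight k y d <= 2 `^ k * box_weight k t (depth x0 y0 R0 s t).
    apply: le_box_weight => //; [exact: ltW|exact: ltW|].
    by move: dst h2 t0 d0; rewrite ler_norml; clear; lra.
  have : a s t `^ p * box_weight k y d <= S `^ p * box_weight k y d.
    rewrite SpE; apply: le_trans (ler_wpM2l (powR_ge0 _ _) V1) _.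
    by rewrite mulrCA; apply: ler_wpM2l le1; exact: powR_ge0.
  rewrite ler_pM2r// leNgt => /negP h; rewrite leNgt; apply/negP => lt.
  by apply: h; apply: gt0_ltr_powR; rewrite ?nnegrE ?(ltW Sp).
have aS s t : `|s - x| <= d -> `|t - y| <= d -> 0 <= t -> a s t <= S.
  move=> h1 h2; rewrite le_eqVlt => /predU1P[t0|t0]; last exact: aS'.
  rewrite -t0 in h2 *.
  apply: (@edge_bound R P a s y d S ca zp h2 (bP' _ _ h1 h2 (lexx _))) => t' h3 t'0.
  exact: aS'.
have subD : upper_box x y d `<=` upper_box x0 y0 R0.
  by move=> [s t] [/= h1 h2 t0]; have [h3 h4] := inR _ _ h1 h2.
have pos z : upper_box x0 y0 R0 z -> 0 < z.2 by case.
have := submean_with_error K0 p01 k0 a0 sv zp d0 Sp e01 bP' aS subD pos JJ.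
rewrite -/(box_weight k y d) SpE => le2.
have q4 : 0 <= 4 * 2 `^ k :> R by rewrite mulr_ge0 ?powR_ge0.
have h1 := ler_wpM2l (powR_ge0 (a x y) p) (box_weight_double k0 (ltW zp) (ltW d0)).
have h2 := ler_wpM2l q4 le2.
have h3 := ler_wpM2r (ltW M0) eK.
rewrite ddE; apply: le_trans h1 _.
rewrite mulrCA; apply: le_trans h2 _.
rewrite mulrDr; apply: lerD; first by rewrite mulrA.
apply: (le_trans (y := (K * e) `^ p * (4 * 2 `^ k * 2 `^ k) * M)).
  by rewrite le_eqVlt; apply/orP; left; apply/eqP; ring.
by rewrite (mulrC M).
Qed.

(** Let [M] be the supremum of the weighted power. By [submean_step] it is at most a multiple of the
    integral plus [M / 2], hence at most twice that multiple; then it is evaluated at the centre,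
    where the depth is [R0]. *)
Lemma submean_explicit (R : realType) (K p k : R) (P : R -> R -> Prop)
    (a : R -> R -> R) (e x0 y0 R0 : R) :
  0 < K -> 0 < p <= 1 -> 0 <= k -> (forall x y, 0 <= a x y) ->
  slowly_varying K P a ->
  (forall x y, P x y -> {for (x, y), continuous (fun p : R * R => a p.1 p.2)}) ->
  0 < e <= 2^-1 ->
  (K * e) `^ p * (4 * 2 `^ k * 2 `^ k) <= 2^-1 -> 0 < y0 -> 0 < R0 ->
  (forall x y, `|x - x0| <= R0 -> `|y - y0| <= R0 -> 0 <= y -> P x y) ->
  ((a x0 y0 `^ p * (R0 ^+ 2 * (y0 + R0) `^ k))%:E <=
   (2 * (4 * 2 `^ k * (e ^+ 2 * (e / 2) `^ k)^-1))%:E *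
   \int[(@lebesgue_measure R \x @lebesgue_measure R)%E]_(z in upper_box x0 y0 R0) (a z.1 z.2 `^ p * z.2 `^ k)%:E)%E.
Proof.
move=> K0 p01 k0 a0 sv ca e01 eK yp Rp bP; have [p0 p1] := andP p01; have [ep e2] := andP e01.
have Ce0 : 0 < (e ^+ 2 * (e / 2) `^ k)^-1.
  by rewrite invr_gt0 mulr_gt0 ?exprn_gt0 ?powR_gt0 ?divr_gt0.
have C1 : 0 < 4 * 2 `^ k * (e ^+ 2 * (e / 2) `^ k)^-1 by rewrite !mulr_gt0 ?powR_gt0.
set J := (\int[(@lebesgue_measure R \x @lebesgue_measure R)%E]_(z in _) _)%E.
have J0 : (0 <= J)%E.
  by apply: integral_ge0 => z _; rewrite lee_fin mulr_ge0 ?powR_ge0.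
case JE : J J0 => [j| |]//; last first.
  by move=> _; rewrite mulry gtr0_sg ?mul1e ?leey// mulr_gt0.
rewrite lee_fin => j0; rewrite -EFinM lee_fin.
have JJ : (J <= j%:E)%E by rewrite JE.
pose E := [set a z.1 z.2 `^ p * box_weight k z.2 (depth x0 y0 R0 z.1 z.2) | z in upper_box x0 y0 R0].
have Kz0 : upper_box x0 y0 R0 (x0, y0) by split => //=; rewrite subrr normr0 ltW.
have dd0 : depth x0 y0 R0 x0 y0 = R0 by rewrite /depth !subrr normr0 maxxx subr0.
(* Boundedness on the compact box, edge included, makes the supremum finite; without it [M / 2]
   could not be absorbed. *)
have [S0 S0a] : exists S0, forall x y, `|x - x0| <= R0 -> `|y - y0| <= R0 -> 0 <= y ->
    a x y <= S0.
  have [c [c0 cR cy ccase]] : exists c : R, [/\ 0 <= c, y0 - R0 <= c, c <= y0 &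
      forall t, 0 <= t -> y0 - R0 <= t -> c <= t].
    exists (Num.max 0 (y0 - R0)); rewrite le_max lexx le_max lexx orbT ge_max (ltW yp)/=.
    by split => //; [rewrite lerBlDr lerDl ltW|move=> t t0 t1; rewrite ge_max t0].
  have cK : compact (`[x0 - R0, x0 + R0] `*` `[c, y0 + R0] : set (R * R)).
    by apply: compact_setX; exact: segment_compact.
  have [||/= [x1 y1] _ M] := compact_EVT_max _ cK (f := fun z => a z.1 z.2).
  - exists (x0, y0); rewrite /= !in_itv/= cy.
    by move: Rp; clear; split; lra.
  - apply: continuous_in_subspaceT => -[x y]; rewrite inE/= !in_itv/= => -[xx /andP[y1 y2]].
    apply: ca; apply: bP; rewrite ?ler_norml.
    + by move: xx; clear; lra.
    + by move: y1 y2 cR; clear; lra.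
    + exact: le_trans y1.
  exists (a x1 y1) => x y xx yy y0p; apply: (M (x, y)).
  rewrite inE/= !in_itv/=; split; first by move: xx; rewrite ler_norml; clear; lra.
  rewrite ccase//=; first by move: yy; rewrite ler_norml; clear; lra.
  by move: yy; rewrite ler_norml; clear; lra.
have ubE : has_ubound E.
  exists (S0 `^ p * (R0 ^+ 2 * (y0 + R0 + R0) `^ k)) => _ [[x y] [/= xx yy y1] <-].
  have dxy : 0 <= depth x0 y0 R0 x y by rewrite /depth subr_ge0 ge_max xx.
  have dxy' : depth x0 y0 R0 x y <= R0 by rewrite /depth lerBlDr lerDl le_max normr_ge0.
  apply: ler_pM; rewrite ?powR_ge0 ?box_weight_ge0//.
    by apply: ler_powR_base; [exact: ltW|exact: a0|exact: S0a (ltW y1)].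
  apply: ler_pM; rewrite ?powR_ge0 ?sqr_ge0//.
    by rewrite ler_pXn2r ?nnegrE// ltW.
  apply: ler_powR_base => //; first by rewrite addr_ge0// ltW.
  by apply: lerD => //; move: yy; rewrite ler_norml; clear; lra.
pose M := sup E.
have leM x y : upper_box x0 y0 R0 (x, y) -> a x y `^ p * box_weight k y (depth x0 y0 R0 x y) <= M.
  by move=> Kz; apply: ub_le_sup => //; exists (x, y).
have : a x0 y0 `^ p * box_weight k y0 (depth x0 y0 R0 x0 y0) <=
    2 * (4 * 2 `^ k * (e ^+ 2 * (e / 2) `^ k)^-1) * j.
  have Cj := mulr_ge0 (ltW C1) j0.
  have [M0|M0] := leP M 0.
    apply: le_trans (leM _ _ Kz0) _; rewrite -mulrA.
    by move: M0 Cj; clear; lra.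
  have : M <= 4 * 2 `^ k * (e ^+ 2 * (e / 2) `^ k)^-1 * j + M / 2.
    apply: ge_sup => [|_ [[x y] Kz <-]].
      by exists (a x0 y0 `^ p * box_weight k y0 (depth x0 y0 R0 x0 y0)); exists (x0, y0).
    exact: (submean_step K0 p01 k0 a0 sv ca e01 eK bP JJ M0 leM Kz).
  have := leM _ _ Kz0; rewrite -(mulrA 2).
  by clear; lra.
by rewrite /box_weight dd0.
Qed.

Lemma submean (R : realType) (K p k : R) : 0 < K -> 0 < p <= 1 -> 0 <= k ->
  exists2 C : R, 0 < C &
  forall (P : R -> R -> Prop) (a : R -> R -> R), (forall x y, 0 <= a x y) ->
  slowly_varying K P a ->
  (forall x y, P x y -> {for (x, y), continuous (fun p : R * R => a p.1 p.2)}) ->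
  forall x0 y0 R0 : R, 0 < y0 -> 0 < R0 ->
  (forall x y, `|x - x0| <= R0 -> `|y - y0| <= R0 -> 0 <= y -> P x y) ->
  ((a x0 y0 `^ p * (R0 ^+ 2 * (y0 + R0) `^ k))%:E <=
   C%:E * \int[(@lebesgue_measure R \x @lebesgue_measure R)%E]_(z in upper_box x0 y0 R0)
     (a z.1 z.2 `^ p * z.2 `^ k)%:E)%E.
Proof.
move=> K0 /andP[p0 p1] k0.
have q0 : 0 < 4 * 2 `^ k * 2 `^ k :> R by rewrite !mulr_gt0 ?powR_gt0.
have [e [e0 e2 eK]] : exists e : R, [/\ 0 < e, e <= 2^-1 &
    (K * e) `^ p * (4 * 2 `^ k * 2 `^ k) <= 2^-1].
  (* With this value the left side of the required inequality equals [2^-1]; taking the minimum with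
     [2^-1] only lowers it. *)
  pose e1 := (2 * (4 * 2 `^ k * 2 `^ k))^-1 `^ p^-1 / K.
  have e10 : 0 < e1 by rewrite divr_gt0 ?powR_gt0 ?invr_gt0// mulr_gt0.
  exists (Num.min e1 2^-1); rewrite lt_min e10 invr_gt0 ltr0n; split => //.
    by rewrite ge_min lexx orbT.
  rewrite -ler_pdivlMr// -invfM.
  have me : 0 <= Num.min e1 2^-1 by rewrite le_min (ltW e10) invr_ge0 ler0n.
  have : K * Num.min e1 2^-1 <= (2 * (4 * 2 `^ k * 2 `^ k))^-1 `^ p^-1.
    by rewrite mulrC -ler_pdivlMr// -/e1 ge_min lexx.
  move=> /(ler_powR_base (ltW p0) (mulr_ge0 (ltW K0) me)) /le_trans; apply.
  by rewrite -powRrM mulVf ?gt_eqF// powRr1// invr_ge0 ltW// mulr_gt0.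
exists (2 * (4 * 2 `^ k * (e ^+ 2 * (e / 2) `^ k)^-1)).
  by rewrite !mulr_gt0 ?invr_gt0 ?mulr_gt0 ?exprn_gt0 ?powR_gt0 ?divr_gt0.
move=> P a a0 sv ca x0 y0 R0 y0p R0p bP.
by apply: (@submean_explicit R K p k P) => //; [rewrite p0|rewrite e0].
Qed.

(** * The Dunkl equation in real coordinates *)

Lemma is_derive_partial_x (R : realType) (g : R * R -> R) (x y : R) :
  derivable g (x, y) (1, 0) ->
  is_derive x 1 (fun t => g (t, y)) ('D_(1, 0) g (x, y)).
Proof.
have E : (fun h : R => h^-1 *: ((g \o shift (x, y)) (h *: (1, 0)) - g (x, y))) =
    (fun h : R => h^-1 *: (((fun t => g (t, y)) \o shift x) (h *: (1 : R^o)) - g (x, y))).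
  apply/funext => h; congr (_ *: (g _ - _)).
  by apply: injective_projections; [exact: erefl|rewrite /= scaler0 add0r].
move=> dg; apply: DeriveDef; rewrite /derivable /derive -E//.
Qed.

Lemma is_derive_partial_y (R : realType) (g : R * R -> R) (x y : R) :
  derivable g (x, y) (0, 1) ->
  is_derive y 1 (fun t => g (x, t)) ('D_(0, 1) g (x, y)).
Proof.
have E : (fun h : R => h^-1 *: ((g \o shift (x, y)) (h *: (0, 1)) - g (x, y))) =
    (fun h : R => h^-1 *: (((fun t => g (x, t)) \o shift y) (h *: (1 : R^o)) - g (x, y))).
  apply/funext => h; congr (_ *: (g _ - _)).
  by apply: injective_projections; [rewrite /= scaler0 add0r|exact: erefl].
move=> dg; apply: DeriveDef; rewrite /derivable /derive -E//.
Qed.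

Lemma is_derive1_unique (R : realType) (f g : R -> R) (x l l' : R) :
  (\forall t \near x, f t = g t) -> is_derive x 1 f l -> is_derive x 1 g l' -> l = l'.
Proof.
move=> fg df dg; have dg' : is_derive x 1 g l := near_eq_is_derive fg df.
by rewrite -(derive_val (df:=l)) (derive_val (df:=l')).
Qed.

Lemma continuous2P (R : realType) (F : R -> R -> R) (x0 y0 : R) :
  {for (x0, y0), continuous (fun p : R * R => F p.1 p.2)} <->
  (forall e : R, 0 < e -> exists2 r : R, 0 < r & forall x y : R,
     `|x - x0| < r -> `|y - y0| < r -> `|F x y - F x0 y0| < e).
Proof.
split=> [c e e0|H].
  have := c; move/cvgrPdist_lt => /(_ _ e0)/nbhs_ballP[r /= r0 B].
  exists r => // x y xx yy; rewrite distrC; apply: (B (x, y)).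
  by split; rewrite /ball/= distrC.
apply/cvgrPdist_lt => e e0; have [r r0 B] := H _ e0.
have br : nbhs (x0, y0) (ball (x0, y0) r) by exact: nbhsx_ballx.
apply: filterS br => -[x y] [/=]; rewrite /ball/= => xx yy.
by rewrite distrC; apply: B; rewrite distrC.
Qed.

(** The second difference of [F] over a square of side [h] is [h * h] times [Fxy] at one point and
    times [Fyx] at another, by the mean value theorem in either order; continuity lets [h]
    shrink. *)
Lemma mixed_partials_eq (R : realType) (F Fx Fy Fxy Fyx : R -> R -> R)
    (x0 y0 r : R) : 0 < r ->
  (forall x y, `|x - x0| < r -> `|y - y0| < r ->
    [/\ is_derive x 1 (F^~ y) (Fx x y), is_derive y 1 (F x) (Fy x y),
        is_derive y 1 (Fx x) (Fxy x y) & is_derive x 1 (Fy^~ y) (Fyx x y)]) ->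
  {for (x0, y0), continuous (fun p : R * R => Fxy p.1 p.2)} ->
  {for (x0, y0), continuous (fun p : R * R => Fyx p.1 p.2)} ->
  Fxy x0 y0 = Fyx x0 y0.
Proof.
move=> r0 H c1 c2; apply/eqP; rewrite -subr_eq0 -normr_le0.
apply/ler_addgt0Pr => e e0; rewrite add0r.
have e2 : 0 < e / 2 by rewrite divr_gt0.
have [r1 r10 B1] := (@continuous2P R Fxy x0 y0).1 c1 _ e2.
have [r2 r20 B2] := (@continuous2P R Fyx x0 y0).1 c2 _ e2.
have [h [h0 hr h1 h2]] : exists h : R, [/\ 0 < h, h < r, h < r1 & h < r2].
  exists (Num.min (r / 2) (Num.min (r1 / 2) (r2 / 2))).
  rewrite !lt_min !divr_gt0//; split => //.
  - by rewrite gt_min; apply/orP; left; move: r0; clear; lra.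
  - by rewrite !gt_min; apply/orP; right; apply/orP; left; move: r10; clear; lra.
  - by rewrite !gt_min; apply/orP; right; apply/orP; right; move: r20; clear; lra.
have near1 (a c : R) : a <= c <= a + h -> `|c - a| <= h.
  by move: h0; rewrite ler_norml; clear; lra.
have near2 (a c : R) : a <= c <= a + h -> `|c - a| < r.
  by move=> /near1 /le_lt_trans; exact.
have xx0 : `|x0 - x0| < r by rewrite subrr normr0.
have yy0 : `|y0 - y0| < r by rewrite subrr normr0.
have hE (a : R) : a <= a + h by rewrite lerDl ltW.
have yh : `|y0 + h - y0| < r by apply: near2; rewrite hE lexx.
have xh : `|x0 + h - x0| < r by apply: near2; rewrite hE lexx.
have [c [c' [cx cy E1]]] : exists c c', [/\ x0 <= c <= x0 + h, y0 <= c' <= y0 + h &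
    F (x0 + h) (y0 + h) - F (x0 + h) y0 - F x0 (y0 + h) + F x0 y0 = Fxy c c' * h * h].
  have [|c cx E] := @MVT_open R (fun s => F s (y0 + h) - F s y0)
      (fun s => Fx s (y0 + h) - Fx s y0) x0 (x0 + h) (hE _).
    move=> s sx; have [D1 _ _ _] := H _ _ (near2 _ _ sx) yh.
    have [D2 _ _ _] := H _ _ (near2 _ _ sx) yy0.
    exact: is_deriveB D1 D2.
  have [|c' cy E'] := @MVT_open R (Fx c) (Fxy c) y0 (y0 + h) (hE _).
    by move=> t ty; have [_ _ ? _] := H _ _ (near2 _ _ cx) (near2 _ _ ty).
  exists c, c'; split => //.
  have -> : F (x0 + h) (y0 + h) - F (x0 + h) y0 - F x0 (y0 + h) + F x0 y0 =
    F (x0 + h) (y0 + h) - F (x0 + h) y0 - (F x0 (y0 + h) - F x0 y0) by ring.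
  by rewrite E E'; ring.
have [d [d' [dx dy E2]]] : exists d d', [/\ x0 <= d <= x0 + h, y0 <= d' <= y0 + h &
    F (x0 + h) (y0 + h) - F (x0 + h) y0 - F x0 (y0 + h) + F x0 y0 = Fyx d d' * h * h].
  have [|c1' cy1 E] := @MVT_open R (fun t => F (x0 + h) t - F x0 t)
      (fun t => Fy (x0 + h) t - Fy x0 t) y0 (y0 + h) (hE _).
    move=> t ty; have [_ D1 _ _] := H _ _ xh (near2 _ _ ty).
    have [_ D2 _ _] := H _ _ xx0 (near2 _ _ ty).
    exact: is_deriveB D1 D2.
  have [|c1'' cx1 E'] := @MVT_open R (Fy^~ c1') (Fyx^~ c1') x0 (x0 + h) (hE _).
    by move=> s sx; have [_ _ _ ?] := H _ _ (near2 _ _ sx) (near2 _ _ cy1).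
  exists c1'', c1'; split => //.
  have -> : F (x0 + h) (y0 + h) - F (x0 + h) y0 - F x0 (y0 + h) + F x0 y0 =
    F (x0 + h) (y0 + h) - F x0 (y0 + h) - (F (x0 + h) y0 - F x0 y0) by ring.
  by rewrite E E'; ring.
have EE : Fxy c c' = Fyx d d'.
  have hh : h * h != 0 by rewrite mulf_neq0 ?gt_eqF.
  by apply: (mulIf hh); rewrite !mulrA -E1 -E2.
have g1 := B1 c c' (le_lt_trans (near1 _ _ cx) h1) (le_lt_trans (near1 _ _ cy) h1).
have g2 := B2 d d' (le_lt_trans (near1 _ _ dx) h2) (le_lt_trans (near1 _ _ dy) h2).
rewrite EE in g1; rewrite distrC in g1; rewrite distrC in g2.
have -> : Fxy x0 y0 - Fyx x0 y0 = (Fxy x0 y0 - Fyx d d') - (Fyx x0 y0 - Fyx d d').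
  by ring.
apply: le_trans (ler_normB _ _) _; move: g1 g2; clear; lra.
Qed.

(** [C1_on] records the continuity of the partial derivatives but not of the function itself.
    Continuous partials are locally bounded, so the function is locally Lipschitz. *)
Lemma continuous_of_partials (R : realType) (F Fx Fy : R -> R -> R)
    (x0 y0 r : R) : 0 < r ->
  (forall x y, `|x - x0| < r -> `|y - y0| < r ->
    is_derive x 1 (F^~ y) (Fx x y) /\ is_derive y 1 (F x) (Fy x y)) ->
  {for (x0, y0), continuous (fun p : R * R => Fx p.1 p.2)} ->
  {for (x0, y0), continuous (fun p : R * R => Fy p.1 p.2)} ->
  {for (x0, y0), continuous (fun p : R * R => F p.1 p.2)}.
Proof.
move=> r0 H c1 c2.
have [r1 r10 B1] := (@continuous2P R Fx x0 y0).1 c1 _ ltr01.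
have [r2 r20 B2] := (@continuous2P R Fy x0 y0).1 c2 _ ltr01.
pose M := Num.max (`|Fx x0 y0| + 1) (`|Fy x0 y0| + 1).
have bnd (a b : R) : `|b - a| < 1 -> `|b| <= `|a| + 1.
  by move=> h; have := ler_normD a (b - a); rewrite addrC subrK; move: h; clear; lra.
have M0 : 0 < M by rewrite /M lt_max ltr_wpDl.
apply/continuous2P => e e0.
have [d [d0 dr d1 d2 dM]] : exists d : R, [/\ 0 < d, d <= r, d <= r1, d <= r2 & M * (2 * d) <= e].
  exists (Num.min r (Num.min r1 (Num.min r2 ((M * 2)^-1 * e)))).
  rewrite !lt_min r0 r10 r20 mulr_gt0 ?invr_gt0 ?mulr_gt0//; split => //.
  - by rewrite ge_min lexx.
  - by rewrite !ge_min lexx orbT.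
  - by rewrite !ge_min lexx !orbT.
  - rewrite mulrA -ler_pdivlMl ?mulr_gt0//.
    by rewrite !ge_min lexx !orbT.
exists d => // x y xx yy.
have b1 s t : `|s - x0| < d -> `|t - y0| < d -> `|Fx s t| <= M.
  move=> h1 h2; rewrite /M le_max; apply/orP; left; apply: bnd; apply: B1;
    exact: lt_le_trans d1.
have b2 s t : `|s - x0| < d -> `|t - y0| < d -> `|Fy s t| <= M.
  move=> h1 h2; rewrite /M le_max; apply/orP; right; apply: bnd; apply: B2;
    exact: lt_le_trans d2.
have -> : F x y - F x0 y0 = (F x y - F x y0) + (F x y0 - F x0 y0) by ring.
apply: le_lt_trans (ler_normD _ _) _.
have btw (a b c : R) : `|b - a| < d -> a <= c <= b \/ b <= c <= a -> `|c - a| < d.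
  by rewrite !ltr_norml => h []; move: h d0; clear; lra.
have l1 : `|F x y0 - F x0 y0| <= M * `|x - x0|.
  apply: (@MVT_norm_le R (F^~ y0) (Fx^~ y0)) => s /(btw _ _ _ xx) sd.
  split; last by apply: b1 => //; rewrite subrr normr0.
  by have [||? _] := H s y0; rewrite ?subrr ?normr0//; exact: lt_le_trans dr.
have l2 : `|F x y - F x y0| <= M * `|y - y0|.
  apply: (@MVT_norm_le R (F x) (Fy x)) => t /(btw _ _ _ yy) td.
  split; last exact: b2.
  by have [||_ ?] := H x t; rewrite ?subrr ?normr0//; exact: lt_le_trans dr.
apply: le_lt_trans (lerD l2 l1) _; rewrite -mulrDr; apply: lt_le_trans dM.
by rewrite ltr_pM2l//; move: xx yy; clear; lra.
Qed.

Definition C2_partials (R : realType) (P : R -> R -> Prop)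
    (F Fx Fy Fxx Fxy Fyx Fyy : R -> R -> R) : Prop :=
  forall x y, P x y ->
  [/\ is_derive x 1 (F^~ y) (Fx x y) /\ is_derive y 1 (F x) (Fy x y),
      is_derive x 1 (Fx^~ y) (Fxx x y) /\ is_derive y 1 (Fx x) (Fxy x y),
      is_derive x 1 (Fy^~ y) (Fyx x y) /\ is_derive y 1 (Fy x) (Fyy x y),
      Fxy x y = Fyx x y &
      {for (x, y), continuous (fun p : R * R => F p.1 p.2)}].

(** The even part in [y] for [s = 1], the odd part for [s = -1]. A derivative in [y] changes the
    sign of [s]. *)
Definition parity_part (R : realType) (s : R) (F : R -> R -> R) (x y : R) : R :=
  (F x y + s * F x (- y)) / 2.

Lemma parity_part_x (R : realType) (s : R) (F Fx : R -> R -> R) (x y : R) :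
  is_derive x 1 (F^~ y) (Fx x y) -> is_derive x 1 (F^~ (- y)) (Fx x (- y)) ->
  is_derive x 1 ((parity_part s F)^~ y) (parity_part s Fx x y).
Proof.
move=> D1 D2; have := is_deriveZ (2^-1) (is_deriveD D1 (is_deriveZ s D2)) => DD.
apply: is_derive1_ext DD _ _ => [t|]; rewrite /parity_part ?fctE/= /GRing.scale/=; ring.
Qed.

Lemma parity_part_y (R : realType) (s : R) (F Fy : R -> R -> R) (x y : R) :
  is_derive y 1 (F x) (Fy x y) -> is_derive (- y) 1 (F x) (Fy x (- y)) ->
  is_derive y 1 (parity_part s F x) (parity_part (- s) Fy x y).
Proof.
move=> D1 D2.
have {}D2 : is_derive y 1 (fun t => F x (0 + (-1) * t)) ((-1) * Fy x (- y)).
  by apply: is_derive1_affine; rewrite add0r mulN1r.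
have := is_deriveZ (2^-1) (is_deriveD D1 (is_deriveZ s D2)) => DD.
apply: is_derive1_ext DD _ _ => [t|]; rewrite /parity_part ?fctE/= /GRing.scale/=.
  by rewrite add0r mulN1r; ring.
ring.
Qed.

(** The right-hand sides of the first-order system are even in [y], being an odd part divided by
    [y]. Combining the equations at [y] and [- y] therefore decouples the even part of [U] and the
    odd part of [W] from the other two parts. The second-order equations follow by differentiating
    once more and exchanging mixed partials. *)
Lemma conj_pair_of_C2 (R : realType) (lam : R) (P : R -> R -> Prop)
    (U Ux Uy Uxx Uxy Uyx Uyy W Wx Wy Wxx Wxy Wyx Wyy : R -> R -> R) :
  (forall x y, P x y -> P x (- y)) ->
  (forall x y, P x y -> exists2 r : R, 0 < r & forall s t,
     `|s - x| < r -> `|t - y| < r -> P s t) ->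
  C2_partials P U Ux Uy Uxx Uxy Uyx Uyy ->
  C2_partials P W Wx Wy Wxx Wxy Wyx Wyy ->
  (forall x y, P x y -> y != 0 ->
     Ux x y - Wy x y = 2 * lam / y * ((W x y - W x (- y)) / 2) /\
     Wx x y + Uy x y = - (2 * lam / y * ((U x y - U x (- y)) / 2))) ->
  conj_pair lam P (parity_part 1 U) (parity_part (-1) W).
Proof.
move=> Psym Popen HU HW CR.
exists (parity_part 1 Ux), (parity_part (-1) Uy), (parity_part 1 Uxx), (parity_part 1 Uyy).
exists (parity_part (-1) Wx), (parity_part 1 Wy), (parity_part (-1) Wxx), (parity_part (-1) Wyy).
have first x y : P x y -> 0 < y -> parity_part (-1) Uy x y = - parity_part (-1) Wx x y /\
    parity_part 1 Wy x y = parity_part 1 Ux x y - 2 * lam / y * parity_part (-1) W x y.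
  move=> Pxy y0; have [E1 E2] := CR _ _ Pxy (lt0r_neq0 y0).
  have [|E3 E4] := CR _ _ (Psym _ _ Pxy); first by rewrite oppr_eq0 lt0r_neq0.
  rewrite opprK in E3 E4.
  have e1 : 2 * lam / - y * ((W x (- y) - W x y) / 2) = 2 * lam / y * ((W x y - W x (- y)) / 2).
    by field; rewrite ?oppr_eq0 lt0r_neq0.
  have e2 : 2 * lam / - y * ((U x (- y) - U x y) / 2) = 2 * lam / y * ((U x y - U x (- y)) / 2).
    by field; rewrite ?oppr_eq0 lt0r_neq0.
  rewrite e1 in E3; rewrite e2 in E4; rewrite /parity_part !mul1r !mulN1r.
  move: E1 E2 E3 E4.
  set a := 2 * lam / y * ((W x y - W x (- y)) / 2).
  set b := 2 * lam / y * ((U x y - U x (- y)) / 2).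
  by clear; move=> *; split; lra.
have nearx x y : P x y -> \forall t \near x, P t y.
  move=> /Popen[r r0 H]; apply/nbhs_ballP; exists r => //= t.
  by rewrite /ball/= distrC => tx; apply: H => //; rewrite subrr normr0.
have neary x y : P x y -> \forall t \near y, P x t.
  move=> /Popen[r r0 H]; apply/nbhs_ballP; exists r => //= t.
  by rewrite /ball/= distrC => tx; apply: H => //; rewrite subrr normr0.
have UW (s : R) F Fx Fy Fxx Fxy Fyx Fyy x y : C2_partials P F Fx Fy Fxx Fxy Fyx Fyy -> P x y ->
    [/\ is_derive x 1 ((parity_part s F)^~ y) (parity_part s Fx x y) /\
        is_derive y 1 (parity_part s F x) (parity_part (- s) Fy x y),
       is_derive x 1 ((parity_part s Fx)^~ y) (parity_part s Fxx x y) /\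
       is_derive y 1 (parity_part s Fx x) (parity_part (- s) Fxy x y),
       is_derive x 1 ((parity_part s Fy)^~ y) (parity_part s Fyx x y) /\
       is_derive y 1 (parity_part s Fy x) (parity_part (- s) Fyy x y) &
       parity_part s Fxy x y = parity_part s Fyx x y].
  move=> HF Pxy; have [[a1 a2] [a3 a4] [a5 a6] a7 _] := HF _ _ Pxy.
  have [[b1 b2] [b3 b4] [b5 b6] b7 _] := HF _ _ (Psym _ _ Pxy).
  by split; [split; [exact: parity_part_x|exact: parity_part_y]..|rewrite /parity_part a7 b7].
have Wc x y : P x y -> {for (x, y), continuous (fun p : R * R => W p.1 p.2)} by move=> /HW[].
have Uc x y : P x y -> {for (x, y), continuous (fun p : R * R => U p.1 p.2)} by move=> /HU[].
have pc (s : R) F x y : (forall x y, P x y -> {for (x, y), continuous (fun p : R * R => F p.1 p.2)}) ->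
    P x y -> {for (x, y), continuous (fun p : R * R => parity_part s F p.1 p.2)}.
  move=> Fc Pxy; rewrite /parity_part; apply: cvgMl; apply: cvgD; first exact: Fc.
  apply: cvgMr.
  apply: (@continuous_comp _ _ _ (fun p : R * R => (p.1, - p.2))
      (fun p : R * R => F p.1 p.2)); last exact/Fc/Psym.
  exact: (cvg_pair cvg_fst (cvgN cvg_snd)).
have DW := UW; split.
- move=> x y Pxy y0.
  have [[u1 u2] [u3 u4] [u5 u6] u7] := UW 1 _ _ _ _ _ _ _ _ _ HU Pxy.
  have [_ _ [_ u6'] _] := UW (-1) _ _ _ _ _ _ _ _ _ HU Pxy.
  have [_ [_ w4] _ _] := UW (-1) _ _ _ _ _ _ _ _ _ HW Pxy.
  have [_ _ [w5 _] w7] := UW 1 _ _ _ _ _ _ _ _ _ HW Pxy.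
  have [[w1 _] _ _ _] := UW (-1) _ _ _ _ _ _ _ _ _ HW Pxy.
  rewrite opprK in u6' w4.
  have A : parity_part 1 Wyx x y = parity_part 1 Uxx x y - 2 * lam / y * parity_part (-1) Wx x y.
    apply: (is_derive1_unique _ w5 (is_deriveB u3 (is_deriveZ (2 * lam / y) w1))).
    by apply: filterS (nearx _ _ Pxy) => t Pt; rewrite (first _ _ Pt y0).2.
  have B : parity_part 1 Uyy x y = - parity_part 1 Wxy x y.
    apply: (is_derive1_unique _ u6' (is_deriveN w4)).
    apply: filterS2 (neary _ _ Pxy) (lt_nbhsr y0) => t Pt t0.
    by rewrite (first _ _ Pt t0).1.
  split => //; rewrite mul0r B w7 A (first _ _ Pxy y0).1; ring.
- move=> x y Pxy y0.
  have [[w1 w2] [w3 _] _ _] := UW (-1) _ _ _ _ _ _ _ _ _ HW Pxy.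
  have [_ _ [_ w6] _] := UW 1 _ _ _ _ _ _ _ _ _ HW Pxy.
  have [_ _ [u5 _] u7] := UW (-1) _ _ _ _ _ _ _ _ _ HU Pxy.
  have [_ [_ u4] _ _] := UW 1 _ _ _ _ _ _ _ _ _ HU Pxy.
  rewrite opprK in w2.
  have C : parity_part (-1) Uyx x y = - parity_part (-1) Wxx x y.
    apply: (is_derive1_unique _ u5 (is_deriveN w3)).
    by apply: filterS (nearx _ _ Pxy) => t Pt; rewrite (first _ _ Pt y0).1.
  have yn0 := lt0r_neq0 y0.
  (* The first-order relation is multiplied by [y] before it is differentiated in [y], which avoids
     the derivative of [1 / y]. *)
  have D : y * (parity_part (-1) Uxy x y - parity_part (-1) Wyy x y) +
      (parity_part 1 Ux x y - parity_part 1 Wy x y) = 2 * lam * parity_part 1 Wy x y.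
    have d1 := is_deriveM (is_derive_id y (1 : R)) (is_deriveB u4 w6).
    have d2 := is_deriveZ (2 * lam) w2.
    have := is_derive1_unique _ d1 d2; rewrite /GRing.scale/= mulr1 => -> //.
    apply: filterS2 (neary _ _ Pxy) (lt_nbhsr y0) => t Pt t0.
    rewrite ?fctE/= /GRing.scale/= (first _ _ Pt t0).2.
    by field; rewrite lt0r_neq0.
  split => //.
  have E : parity_part (-1) Wyy x y = parity_part (-1) Uxy x y -
      (2 * lam * parity_part 1 Wy x y - 2 * lam / y * parity_part (-1) W x y) / y.
    apply: (mulfI yn0); rewrite mulrBr (mulrC y (_ / y)) divfK//.
    by have := (first _ _ Pxy y0).2; move: D; clear; lra.
  rewrite E u7 C; by field.
- exact: first.
- by move=> x y Pxy; split; exact: pc.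
- move=> x Px; split.
    have [[_ u2] _ _ _] := UW 1 _ _ _ _ _ _ _ _ _ HU Px.
    apply: is_derive1_ext u2 _ _ => //.
    by rewrite /parity_part oppr0 mulN1r subrr mul0r.
  by rewrite /parity_part oppr0 mulN1r subrr mul0r.
Qed.

Definition C1_partials (R : realType) (P : R -> R -> Prop) (F Fx Fy : R -> R -> R) : Prop :=
  forall x y, P x y ->
  [/\ is_derive x 1 (F^~ y) (Fx x y), is_derive y 1 (F x) (Fy x y),
      {for (x, y), continuous (fun p : R * R => Fx p.1 p.2)} &
      {for (x, y), continuous (fun p : R * R => Fy p.1 p.2)}].

Lemma C1_on_partials (R : realType) (P : R -> R -> Prop) (G : R * R -> R) :
  C1_on [set v | P v.1 v.2] G ->
  C1_partials P (fun x y => G (x, y))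
    (fun x y => 'D_(1, 0) G (x, y)) (fun x y => 'D_(0, 1) G (x, y)).
Proof.
move=> C0 s t Pst; have [d1 d2 c1 c2] := C0 (s, t) Pst.
have eta (F : R * R -> R) : {for (s, t), continuous F} ->
    {for (s, t), continuous (fun p : R * R => F (p.1, p.2))}.
  by suff -> : (fun p => F (p.1, p.2)) = F by []; apply/funext => -[].
by split; [exact: is_derive_partial_x|exact: is_derive_partial_y|exact: eta c1|exact: eta c2].
Qed.

Lemma C2_partials_of_C1 (R : realType) (P : R -> R -> Prop)
    (F Fx Fy Fxx Fxy Fyx Fyy : R -> R -> R) :
  (forall x y, P x y -> exists2 r : R, 0 < r & forall s t,
     `|s - x| < r -> `|t - y| < r -> P s t) ->
  C1_partials P F Fx Fy -> C1_partials P Fx Fxx Fxy -> C1_partials P Fy Fyx Fyy ->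
  C2_partials P F Fx Fy Fxx Fxy Fyx Fyy.
Proof.
move=> Popen C0 C1 C2 x y Pxy.
have [r r0 Pr] := Popen _ _ Pxy.
have [a1 a2 a3 a4] := C0 _ _ Pxy; have [b1 b2 b3 b4] := C1 _ _ Pxy.
have [c1 c2 c3 c4] := C2 _ _ Pxy.
split; [by split|by split|by split| |].
- apply: (@mixed_partials_eq R F Fx Fy Fxy Fyx x y r r0 _ b4 c3).
  move=> s t ss tt; have Pst := Pr _ _ ss tt.
  have [? ? _ _] := C0 _ _ Pst; have [_ ? _ _] := C1 _ _ Pst.
  by have [? _ _ _] := C2 _ _ Pst.
- apply: (@continuous_of_partials R F Fx Fy x y r r0 _ a3 a4).
  by move=> s t ss tt; have [? ? _ _] := C0 _ _ (Pr _ _ ss tt).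
Qed.

Lemma C2_on_partials (R : realType) (P : R -> R -> Prop) (G : R * R -> R) :
  (forall x y, P x y -> exists2 r : R, 0 < r & forall s t,
     `|s - x| < r -> `|t - y| < r -> P s t) ->
  C2_on [set v | P v.1 v.2] G ->
  C2_partials P (fun x y => G (x, y))
    (fun x y => 'D_(1, 0) G (x, y)) (fun x y => 'D_(0, 1) G (x, y))
    (fun x y => 'D_(1, 0) ('D_(1, 0) G) (x, y)) (fun x y => 'D_(0, 1) ('D_(1, 0) G) (x, y))
    (fun x y => 'D_(1, 0) ('D_(0, 1) G) (x, y)) (fun x y => 'D_(0, 1) ('D_(0, 1) G) (x, y)).
Proof.
move=> Popen [/C1_on_partials C0 /C1_on_partials C1 /C1_on_partials C2].
exact: C2_partials_of_C1 Popen C0 C1 C2.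
Qed.

(** * Norms with real values, and the disk in real coordinates *)

Section rnorm_theory.
Variables (R : realType) (V : normedZmodType R[i]).
Implicit Types x y : V.

Lemma rnormK x : (rnorm x)%:C = `|x|.
Proof.
by have := normr_ge0 x; rewrite /rnorm; case: `|x| => a b; rewrite lecE/= => /andP[/eqP-> _].
Qed.

Lemma rnorm_ge0 x : 0 <= rnorm x.
Proof. by have := normr_ge0 x; rewrite -rnormK -[0]/(0%:C) lecR. Qed.

Lemma rnormD x y : rnorm (x + y) <= rnorm x + rnorm y.
Proof. by rewrite -lecR rmorphD/= !rnormK ler_normD. Qed.

Lemma rnorm0 : rnorm (0 : V) = 0.
Proof. by apply: (@complexI R); rewrite rnormK normr0. Qed.

Lemma rnormN x : rnorm (- x) = rnorm x.
Proof. by rewrite /rnorm normrN. Qed.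

Lemma rnorm_distC x y : rnorm (x - y) = rnorm (y - x).
Proof. by rewrite -rnormN opprB. Qed.

Lemma rnorm_sum (I : Type) (r : seq I) (P : pred I) (F : I -> V) :
  rnorm (\sum_(i <- r | P i) F i) <= \sum_(i <- r | P i) rnorm (F i).
Proof.
elim/big_rec2: _ => [|i a b _ h]; first by rewrite rnorm0.
by apply: le_trans (rnormD _ _) _; rewrite lerD2l.
Qed.

End rnorm_theory.

Definition disk2 (R : realType) (x y : R) : Prop := x ^+ 2 + y ^+ 2 < 1.

Lemma rnormE (R : realType) (x y : R) : rnorm (x +i* y) = Num.sqrt (x ^+ 2 + y ^+ 2).
Proof. by rewrite /rnorm normc_def. Qed.

Lemma unit_diskE (R : realType) (x y : R) : unit_disk (x +i* y) = disk2 x y.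
Proof.
rewrite /unit_disk/= rnormE /disk2; apply/propext; split.
  by rewrite -{1}sqrtr1 ltr_sqrt.
by move=> h; rewrite -[ltRHS]sqrtr1 ltr_sqrt.
Qed.

Lemma disk2_open (R : realType) (x y : R) : disk2 x y ->
  exists2 r : R, 0 < r & forall s t, `|s - x| < r -> `|t - y| < r -> disk2 s t.
Proof.
move=> xy; have e0 : 0 < 1 - (x ^+ 2 + y ^+ 2) by rewrite subr_gt0.
have c : {for (x, y), continuous (fun p : R * R => p.1 ^+ 2 + p.2 ^+ 2)}.
  apply: cvgD; rewrite expr2; apply: cvgM; [exact: cvg_fst..|exact: cvg_snd|exact: cvg_snd].
have [r r0 H] := (@continuous2P R (fun a b => a ^+ 2 + b ^+ 2) x y).1 c _ e0.
exists r => // s t ss tt; have := H _ _ ss tt; rewrite ltr_norml /disk2; lra.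
Qed.

Lemma disk2N (R : realType) (x y : R) : disk2 x y -> disk2 x (- y).
Proof. by rewrite /disk2 sqrrN. Qed.

(** * Lambda-analytic functions as two conjugate pairs *)

Section lambda_analytic_pairs.
Variables (R : realType) (lam : R) (f : R[i] -> R[i]).

Definition re_part (x y : R) : R := complex.Re (f (x +i* y)).
Definition im_part (x y : R) : R := complex.Im (f (x +i* y)).

(** The second pair is the one of [- i f], whose real part is [im_part] and whose imaginary part is
    [- re_part]. *)
Definition amp (x y : R) : R :=
  amplitude (parity_part 1 re_part) (parity_part (-1) im_part)
    (parity_part 1 im_part) (parity_part (-1) (fun x y => - re_part x y)) x y.

Hypothesis f_an : lambda_analytic lam f.

Let disk_xyE : @disk_xy R = [set v | disk2 v.1 v.2].
Proof. by apply/seteqP; split => -[x y]; rewrite /disk_xy/= unit_diskE. Qed.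

(** The Dunkl equation is multiplied by [z - conj z = 2 i y] and split into real and imaginary
    parts. *)
Lemma dunkl_cauchy_riemann (x y : R) : disk2 x y -> y != 0 ->
  'D_(1, 0) (Re_xy f) (x, y) - 'D_(0, 1) (Im_xy f) (x, y) =
    2 * lam / y * ((im_part x y - im_part x (- y)) / 2) /\
  'D_(1, 0) (Im_xy f) (x, y) + 'D_(0, 1) (Re_xy f) (x, y) =
    - (2 * lam / y * ((re_part x y - re_part x (- y)) / 2)).
Proof.
move=> xy y0; have [_ /(_ (x +i* y))] := f_an; rewrite unit_diskE => /(_ xy).
rewrite /dunkl_zbar /dunkl_quotient /= (negbTE y0) /partial_zbar /partial_x /partial_y /conj_quotient /=.
set Ux := 'D_(1, 0) (Re_xy f) (x, y); set Uy := 'D_(0, 1) (Re_xy f) (x, y).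
set Wx := 'D_(1, 0) (Im_xy f) (x, y); set Wy := 'D_(0, 1) (Im_xy f) (x, y).
rewrite /re_part /im_part; set F := f (x +i* y); set G := f (x -i* y).
set e := (x +i* y) - (x -i* y); move=> E.
have eE : e = 0 +i* (2 * y).
  by apply/eqP; rewrite /e eq_complex/=; apply/andP; split; apply/eqP; ring.
have e0 : e != 0.
  by rewrite eE eq_complex/= negb_and mulf_neq0 ?orbT// pnatr_eq0.
have E2 : (Ux +i* Wx + (0 +i* 1) * (Uy +i* Wy)) * e = 2 * lam%:C * (F - G).
  have /eqP := E; rewrite subr_eq0 => /eqP E'.
  have -> : (Ux +i* Wx + (0 +i* 1) * (Uy +i* Wy)) * e =
      2 * ((Ux +i* Wx + (0 +i* 1) * (Uy +i* Wy)) / 2) * e by field.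
  by rewrite E'; field.
move: E2; rewrite eE; move: F G {E} => [a b] [c d] /= /eqP.
rewrite eq_complex/= => /andP[/eqP E1 /eqP E2].
have y1 : 2 * y != 0 by rewrite mulf_neq0// pnatr_eq0.
split; apply: (mulIf y1).
  have -> : (Ux - Wy) * (2 * y) = 2 * lam * (b - d) by move: E2; clear; lra.
  by field.
have -> : (Wx + Uy) * (2 * y) = - (2 * lam * (a - c)) by move: E1; clear; lra.
by field.
Qed.

Lemma lambda_analytic_conj_pair1 :
  conj_pair lam (@disk2 R) (parity_part 1 re_part) (parity_part (-1) im_part).
Proof.
have [[cr ci] _] := f_an; rewrite disk_xyE in cr ci.
exact: (conj_pair_of_C2 (@disk2N R) (@disk2_open R)
  (C2_on_partials (@disk2_open R) cr) (C2_on_partials (@disk2_open R) ci)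
  dunkl_cauchy_riemann).
Qed.

Lemma C2_partialsN (P : R -> R -> Prop) (F Fx Fy Fxx Fxy Fyx Fyy : R -> R -> R) :
  C2_partials P F Fx Fy Fxx Fxy Fyx Fyy ->
  C2_partials P (fun x y => - F x y) (fun x y => - Fx x y) (fun x y => - Fy x y)
    (fun x y => - Fxx x y) (fun x y => - Fxy x y) (fun x y => - Fyx x y)
    (fun x y => - Fyy x y).
Proof.
move=> H x y Pxy; have [[a1 a2] [a3 a4] [a5 a6] a7 c] := H _ _ Pxy.
split; [split; exact: is_deriveN..|by rewrite a7|exact: cvgN].
Qed.

Lemma lambda_analytic_conj_pair2 :
  conj_pair lam (@disk2 R) (parity_part 1 im_part)
    (parity_part (-1) (fun x y => - re_part x y)).
Proof.
have [[cr ci] _] := f_an; rewrite disk_xyE in cr ci.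
apply: (conj_pair_of_C2 (@disk2N R) (@disk2_open R)
  (C2_on_partials (@disk2_open R) ci) (C2_partialsN (C2_on_partials (@disk2_open R) cr))).
move=> x y xy y0; have [E1 E2] := dunkl_cauchy_riemann xy y0.
by split; [rewrite opprK E2; field|rewrite addrC -opprB E1].
Qed.

Lemma amp_ge0 x y : 0 <= amp x y.
Proof. by rewrite /amp /amplitude !addr_ge0. Qed.

Lemma amp_slowly_varying : 0 <= lam ->
  slowly_varying (16 * (3 + 10 * lam)) (@disk2 R) amp.
Proof.
move=> lam0; exact: (amplitude_slowly_varying lam0 lambda_analytic_conj_pair1
  lambda_analytic_conj_pair2).
Qed.

Lemma amp_continuous x y : disk2 x y ->
  {for (x, y), continuous (fun p : R * R => amp p.1 p.2)}.
Proof.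
exact: (amplitude_continuous lambda_analytic_conj_pair1 lambda_analytic_conj_pair2).
Qed.

Lemma rnorm_le_ReIm (z : R[i]) : rnorm z <= `|complex.Re z| + `|complex.Im z|.
Proof.
case: z => a b; rewrite rnormE /=.
rewrite -[leRHS]ger0_norm ?addr_ge0// -sqrtr_sqr ler_sqrt ?sqr_ge0//.
rewrite sqrrD !real_normK ?num_real//.
by rewrite -addrA lerD2l lerDr mulrn_wge0// mulr_ge0.
Qed.

Lemma ReIm_le_rnorm (z : R[i]) : `|complex.Re z| <= rnorm z /\ `|complex.Im z| <= rnorm z.
Proof.
case: z => a b; rewrite rnormE /= -!sqrtr_sqr !ler_sqrt ?addr_ge0 ?sqr_ge0//.
by rewrite lerDl lerDr !sqr_ge0.
Qed.

(** Conjugating the point changes only the signs of the odd parts, so one value of [amp] controls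
    both points; this is why the upper half disk suffices from here on. *)
Lemma rnorm_le_amp x y : rnorm (f (x +i* y)) <= amp x y /\ rnorm (f (x -i* y)) <= amp x y.
Proof.
have tri (a b : R) : `|a + b| <= `|a| + `|b| /\ `|a - b| <= `|a| + `|b|.
  by split; [exact: ler_normD|exact: ler_normB].
pose a := parity_part 1 re_part x y; pose b := parity_part (-1) im_part x y.
pose c := parity_part 1 im_part x y; pose d := parity_part (-1) (fun x y => - re_part x y) x y.
have E1 : complex.Re (f (x +i* y)) = a - d.
  by rewrite /a /d /parity_part /re_part; field.
have E2 : complex.Im (f (x +i* y)) = c + b.
  by rewrite /c /b /parity_part /im_part; field.
have E3 : complex.Re (f (x -i* y)) = a + d.
  by rewrite /a /d /parity_part /re_part; field.
have E4 : complex.Im (f (x -i* y)) = c - b.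
  by rewrite /c /b /parity_part /im_part; field.
have -> : amp x y = (`|a| + `|d|) + (`|c| + `|b|).
  by rewrite /amp /amplitude -/a -/b -/c -/d; ring.
split; apply: le_trans (rnorm_le_ReIm _) _.
  by rewrite E1 E2; apply: lerD; [exact: (tri a d).2|exact: (tri c b).1].
by rewrite E3 E4; apply: lerD; [exact: (tri a d).1|exact: (tri c b).2].
Qed.

Lemma amp_le_rnorm x y : amp x y <= 2 * (rnorm (f (x +i* y)) + rnorm (f (x -i* y))).
Proof.
have [h1 h2] := ReIm_le_rnorm (f (x +i* y)).
have [h3 h4] := ReIm_le_rnorm (f (x -i* y)).
have hf (s a b u v : R) : `|s| = 1 -> `|a| <= u -> `|b| <= v -> `|(a + s * b) / 2| <= (u + v) / 2.
  move=> s1 au bv; rewrite normrM (ger0_norm (x := 2^-1)) ?invr_ge0//.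
  rewrite ler_pM2r ?invr_gt0//; apply: le_trans (ler_normD _ _) _.
  by rewrite normrM s1 mul1r; exact: lerD.
have n1 : `|1 : R| = 1 by rewrite normr1.
have nn1 : `|-1 : R| = 1 by rewrite normrN normr1.
rewrite /amp /amplitude /parity_part /re_part /im_part.
rewrite -(normrN (complex.Re (f (x +i* y)))) in h1.
rewrite -(normrN (complex.Re (f (x -i* y)))) in h3.
have g1 := hf 1 _ _ _ _ n1 h1 h3; rewrite -normrN -mulNr mulrN -opprD opprK mul1r in g1.
have g2 := hf (-1) _ _ _ _ nn1 h2 h4.
have g3 := hf 1 _ _ _ _ n1 h2 h4.
have g4 := hf (-1) _ _ _ _ nn1 h1 h3.
rewrite !mul1r in g3 *; move: g1 g2 g3 g4; clear; lra.
Qed.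

End lambda_analytic_pairs.

(** * The integral estimate in polar coordinates *)

(** The plane carries the product sigma-algebra; an open set is the union of the countably many
    rational boxes that it contains. *)
Lemma open_measurable2 (R : realType) (U : set (R * R)) : open U -> measurable U.
Proof.
move=> oU.
pose box (i : rat * rat * rat) : set (R * R) :=
  `]ratr i.1.1 - ratr i.2, ratr i.1.1 + ratr i.2[ `*`
  `]ratr i.1.2 - ratr i.2, ratr i.1.2 + ratr i.2[.
have -> : U = \bigcup_(i in [set: rat * rat * rat]) (if `[< box i `<=` U >] then box i else set0).
  apply/seteqP; split => [[x y] Uxy|z [i _]]; last by case: asboolP => // H /H.
  have /nbhs_ballP[r /= r0 B] : nbhs (x, y) U by exact: open_nbhs_nbhs.
  have r3 : 0 < r / 3 by rewrite divr_gt0.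
  have [q] := rat_in_itvoo r3; rewrite in_itv/= => /andP[q0 qr].
  have near (s : R) : exists a : rat, s < ratr a < s + ratr q.
    have sq : s < s + ratr q by rewrite ltrDl.
    by have [a] := rat_in_itvoo sq; rewrite in_itv; exists a.
  have [a a1] := near x; have [b b1] := near y.
  exists (a, b, q) => //; case: asboolP => [_|H].
    rewrite /box/= !in_itv/=; move: a1 b1; clear; lra.
  exfalso; apply: H => -[s t]; rewrite /box/= !in_itv/= => -[s1 t1].
  apply: B; split; rewrite /ball/= ltr_norml.
    by move: a1 s1 qr; clear; lra.
  by move: b1 t1 qr; clear; lra.
apply: countable_bigcupT_measurable => [|i]; first exact: countableP.
case: ifP => // _; apply: measurableX; exact: measurable_itv.
Qed.

Lemma continuous2_measurable (R : realType) (A : set (R * R)) (F : R * R -> R) :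
  open A -> (forall z, A z -> {for z, continuous F}) -> measurable_fun A F.
Proof.
move=> oA cF; apply: (measurability _ (measurable_realfun.RGenOpens.measurableE R)).
move=> _ [_ [a [b ->] <-]]; set V := `]a, b[%classic.
have oV : open V by exact: interval_open.
apply: open_measurable2; rewrite openE => z [Az FVz]; rewrite /interior.
apply: filterI; first exact: open_nbhs_nbhs.
by apply: (cF _ Az); apply: open_nbhs_nbhs.
Qed.

Lemma lebesgue_integral_oppr (R : realType) (f : R -> \bar R) :
  measurable_fun [set: R] f -> (forall x, 0 <= f x)%E ->
  (\int[@lebesgue_measure R]_x f (- x)%R = \int[@lebesgue_measure R]_x f x)%E.
Proof.
move=> mf f0.
transitivity (\int[pushforward (@lebesgue_measure R) (-%R : _ -> measurableTypeR R)]_x f x)%E.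
  rewrite ge0_integral_pushforward//=; exact: oppr_measurable.
by apply: eq_measure_integral => //= A mA AS; exact: lebesgue_measureN.
Qed.

Lemma integral2_oppr (R : realType) (f : R * R -> \bar R) :
  measurable_fun [set: R * R] f -> (forall x, 0 <= f x)%E ->
  (\int[@lebesgue_measure R \x @lebesgue_measure R]_z f (z.1, (- z.2)%R) =
   \int[@lebesgue_measure R \x @lebesgue_measure R]_z f z)%E.
Proof.
move=> mf f0; rewrite !fubini_tonelli1//; last first.
  apply: (measurableT_comp mf); apply: measurable_fun_pair => //.
  by apply: measurableT_comp.
apply: eq_integral => x _; rewrite /fubini_F/=.
rewrite -(lebesgue_integral_oppr (f := fun y => f (x, y)))//.
exact: measurable_fun_pair2.
Qed.

(** From [u * cos u <= sin u] at [u = v / 2], the double angle formulas give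
    [sin v >= v / 2 * (1 + cos v)], and [cos v] is nonnegative here. *)
Lemma half_le_sin (R : realType) (v : R) : 0 <= v <= pi / 2 -> v / 2 <= sin v.
Proof.
move=> /andP[v0 vpi]; have p0 := pi_gt0 R.
have small (u : R) : 0 <= u -> u <= pi / 2 -> u * cos u <= sin u.
  move=> u0 upi.
  have [c /andP[c0 cu] E] := MVT_open u0 (fun x _ => is_derive_sin x).
  move: E; rewrite sin0 !subr0 mulrC => ->; apply: ler_wpM2l => //.
  have cI : c \in `[0, pi] by rewrite in_itv/= c0/=; move: cu upi p0; clear; lra.
  have uI : u \in `[0, pi] by rewrite in_itv/= u0/=; move: upi p0; clear; lra.
  by rewrite leNgt (ltr_cos uI cI) -leNgt.
have v20 : 0 <= v / 2 by rewrite divr_ge0.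
have v2pi : v / 2 <= pi / 2 by move: v0 vpi p0; clear; lra.
have h := small _ v20 v2pi.
have cv : 0 <= cos v by rewrite cos_ge0_pihalf// vpi andbT; move: v0 p0; clear; lra.
have cv2 : 0 <= cos (v / 2) by rewrite cos_ge0_pihalf// v2pi andbT; move: v20 p0; clear; lra.
have E1 : sin v = 2 * (cos (v / 2) * sin (v / 2)).
  by rewrite {1}(splitr v) sinD mulrC -mulr2n mulr_natl.
have E2 : cos v = 2 * cos (v / 2) ^+ 2 - 1.
  by rewrite {1}(splitr v) cosD; have := cos2Dsin2 (v / 2); rewrite -!expr2; clear; lra.
rewrite E1; apply: le_trans (_ : 2 * (cos (v / 2) * (v / 2 * cos (v / 2))) <= _).
  have -> : 2 * (cos (v / 2) * (v / 2 * cos (v / 2))) = v / 2 * (1 + cos v) by rewrite E2; field.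
  by rewrite ler_peMr// lerDl.
by rewrite ler_pM2l// ler_wpM2l.
Qed.

(** The chord between the two points of the circle has length [2 * sin v] with [v] half the
    difference of the angles, and [v] stays in [[0, pi / 2]]. *)
Lemma angle_diff_le (R : realType) (s t : R) : 0 <= s <= pi -> 0 <= t <= pi ->
  (s - t) ^+ 2 <= 4 * ((cos s - cos t) ^+ 2 + (sin s - sin t) ^+ 2).
Proof.
wlog st : s t / t <= s.
  move=> H sp tp; have [ts|/ltW ts] := leP t s; first exact: H.
  have := H _ _ ts tp sp; rewrite -sqrrN opprB => /le_trans; apply.
  by rewrite le_eqVlt; apply/orP; left; apply/eqP; ring.
move=> sp tp; set v := (s - t) / 2.
have vE : s - t = 2 * v by rewrite /v; field.
have v0 : 0 <= v by rewrite /v divr_ge0// subr_ge0.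
have vp : v <= pi / 2 by rewrite /v; move: sp tp; clear; lra.
have h := @half_le_sin R v; rewrite v0 vp in h; have {}h := h isT.
have E : (cos s - cos t) ^+ 2 + (sin s - sin t) ^+ 2 = 4 * sin v ^+ 2.
  have e1 : cos (s - t) = 1 - 2 * sin v ^+ 2.
    have -> : s - t = v + v by rewrite vE mulr_natl.
    by rewrite cosD; have := cos2Dsin2 v; rewrite -!expr2; clear; lra.
  have e2 := cosB s t; rewrite e1 in e2.
  have e3 := cos2Dsin2 s; have e4 := cos2Dsin2 t.
  by move: e2 e3 e4; clear; lra.
rewrite E vE.
have v20 : 0 <= v / 2 by rewrite divr_ge0.
have : (v / 2) ^+ 2 <= sin v ^+ 2 by rewrite ler_pXn2r ?nnegrE// (le_trans v20 h).
by clear; lra.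
Qed.

Lemma lebesgue_measure_diam_le (R : realType) (S : set R) (l : R) : measurable S -> 0 <= l ->
  (forall s t, S s -> S t -> `|s - t| <= l) ->
  (@lebesgue_measure R S <= (2 * l)%:E)%E.
Proof.
move=> mS l0 H; have [->|/set0P[s Ss]] := eqVneq S set0.
  by rewrite measure0 lee_fin mulr_ge0.
apply: (@le_trans _ _ (@lebesgue_measure R `[s - l, s + l])).
  apply: le_measure; rewrite ?inE//=.
  move=> t St; have := H _ _ Ss St; rewrite /= in_itv/= ler_norml; clear; lra.
rewrite lebesgue_measure_itv/= lte_fin; case: ifP => _; last by rewrite lee_fin mulr_ge0.
by rewrite -EFinB lee_fin; clear; lra.
Qed.

(** * Tails of the weight *)

Section weight_tail_theory.
Variables (R : realType) (w : R -> R).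
Hypothesis weight_w : weight w.

Lemma weight_tail_EFin (r : R) : 0 <= r ->
  (\int[@completed_lebesgue_measure R]_(s in `]r, 1%R[) (w s)%:E = (weight_tail w r)%:E)%E.
Proof.
move=> r0; rewrite /weight_tail /Rintegral fineK//.
have [w0 iw] := weight_w; apply: integrable_fin_num.
  by apply: sub_caratheodory; exact: measurable_itv.
apply: integrableS iw; [by apply: sub_caratheodory; exact: measurable_itv..|].
by apply: subset_itvW; rewrite ?bnd_simp.
Qed.

Lemma weight_tail_ge0 (r : R) : 0 <= r -> 0 <= weight_tail w r.
Proof.
move=> r0; apply: Rintegral_ge0 => x /=; rewrite in_itv/= => /andP[rx x1].
by apply/ltW/(proj1 weight_w); rewrite x1 (le_trans r0 (ltW rx)).
Qed.

Lemma weight_tail_nonincreasing (r s : R) : 0 <= r -> r <= s ->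
  weight_tail w s <= weight_tail w r.
Proof.
move=> r0 rs; rewrite -lee_fin -!weight_tail_EFin ?(le_trans r0)//.
have pos x : r < x < 1 -> 0 <= w x.
  by move=> /andP[rx x1]; apply/ltW/(proj1 weight_w); rewrite x1 (le_trans r0 (ltW rx)).
apply: ge0_le_integral_subset => x /=; rewrite in_itv/= => /andP[rx x1].
- by rewrite lee_fin pos// x1 (le_lt_trans rs).
- by rewrite lee_fin pos// x1 rx.
- by split => //; rewrite in_itv/= x1 (le_lt_trans rs).
Qed.

(** If the tail vanished, [w] would be zero almost everywhere on an interval of positive length,
    although it is positive everywhere. Strict positivity matters because tails will be divided
    by. *)
Lemma weight_tail_gt0 (r : R) : 0 <= r < 1 -> 0 < weight_tail w r.
Proof.
move=> /andP[r0 r1]; rewrite lt_neqAle weight_tail_ge0// andbT eq_sym.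
apply/eqP => W0; have := weight_tail_EFin r0; rewrite W0 => I0.
have [w0 iw] := weight_w.
pose mu := @completed_lebesgue_measure R.
have mr : (@measurable _ (caratheodory_type ((wlength idfun)^*)%mu)) (`]r, 1[ : set R).
  by apply: sub_caratheodory; exact: measurable_itv.
have ir : mu.-integrable `]r, 1[ (EFin \o w).
  apply: integrableS iw; [by apply: sub_caratheodory; exact: measurable_itv|exact: mr|].
  by apply: subset_itvW; rewrite ?bnd_simp.
have /ae_eq_integral_abs : (\int[mu]_(x in `]r, 1%R[) `|(EFin \o w) x| = 0)%E.
  rewrite -[RHS]I0; apply: eq_integral => x; rewrite inE/= in_itv/= => /andP[rx x1].
  by rewrite ger0_norm// ltW// w0// x1 (le_trans r0 (ltW rx)).
case=> //; first exact: measurable_int ir.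
move=> N [mN N0 sub].
have : (mu (`]r, 1%R[%classic : set R) <= mu N)%E.
  apply: le_measure; rewrite ?inE// => x /=; rewrite in_itv/= => /andP[rx x1].
  apply: sub => /=; apply/not_implyP; split; first by rewrite in_itv/= rx.
  by move=> [wx]; have := w0 x; rewrite wx x1 (le_trans r0 (ltW rx)) ltxx => /(_ isT).
rewrite [mu N]N0 [mu _](_ : _ = @lebesgue_measure R `]r, 1%R[%classic) //.
by rewrite lebesgue_measure_itv/= lte_fin r1 -EFinB lee_fin subr_le0 leNgt r1.
Qed.

End weight_tail_theory.

Lemma polar_box_radius (R : realType) (t th x y d : R) : 0 <= t -> 0 <= d ->
  `|x - t * cos th| <= d -> `|y - t * sin th| <= d ->
  `|Num.sqrt (x ^+ 2 + y ^+ 2) - t| <= 2 * d.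
Proof.
move=> t0 d0 hx hy; set s := Num.sqrt _.
have s0 : 0 <= s by exact: sqrtr_ge0.
have sE : s ^+ 2 = x ^+ 2 + y ^+ 2 by rewrite sqr_sqrtr// addr_ge0// sqr_ge0.
have cs := cos2Dsin2 th.
set c := cos th in hx cs *; set u := sin th in hy cs *.
have c1 : `|c| <= 1 by exact: cos_max.
have u1 : `|u| <= 1 by exact: sin_max.
set e := x - t * c in hx; set g := y - t * u in hy.
have m : `|e * c + g * u| <= 2 * d.
  rewrite (le_trans (ler_normD _ _))// !normrM mulr_natl mulr2n lerD//.
    by rewrite -[leRHS]mulr1 ler_pM.
  by rewrite -[leRHS]mulr1 ler_pM.
have N : e ^+ 2 + g ^+ 2 <= 2 * d ^+ 2.
  by rewrite -(real_normK (num_real e)) -(real_normK (num_real g)) mulr_natl mulr2n lerD// ler_pXn2r ?nnegrE.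
move: m; rewrite !ler_norml => /andP[m1 m2].
have xE : x = t * c + e by rewrite /e; ring.
have yE : y = t * u + g by rewrite /g; ring.
have mE : x ^+ 2 + y ^+ 2 = t ^+ 2 + 2 * t * (e * c + g * u) + (e ^+ 2 + g ^+ 2).
  by rewrite xE yE -[t ^+ 2 in RHS]mulr1 -[X in t ^+ 2 * X]cs; ring.
have up : s <= t + 2 * d.
  rewrite -(@ler_pXn2r _ 2)// ?nnegrE ?addr_ge0 ?mulr_ge0// sE mE.
  have := ler_wpM2l (mulr_ge0 (ler0n R 2) t0) m2.
  have := sqr_ge0 d; move: N; clear; nra.
(* The lower bound projects [(x, y)] on the direction [th]: the projection is [t + (e * c + g * u)]
   and is at most [s]. *)
have low : t - 2 * d <= s.
  have [h|/ltW h] := leP (t - 2 * d) 0; first exact: le_trans s0.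
  rewrite -(@ler_pXn2r _ 2)// ?nnegrE// sE.
  apply: (@le_trans _ _ ((t + (e * c + g * u)) ^+ 2)).
    rewrite ler_pXn2r ?nnegrE//; last by move: h m1; clear; lra.
    by move: h m1; clear; lra.
  have -> : t + (e * c + g * u) = x * c + y * u.
    by rewrite xE yE -[t in LHS]mulr1 -[X in t * X]cs; ring.
  have -> : x ^+ 2 + y ^+ 2 = (x * c + y * u) ^+ 2 + (x * u - y * c) ^+ 2.
    by rewrite -[LHS]mulr1 -[X in _ * X]cs; ring.
  by rewrite lerDl sqr_ge0.
by move: up low; clear; lra.
Qed.

Lemma gt0_powRD (R : realType) (a r s : R) : 0 < a -> a `^ (r + s) = a `^ r * a `^ s.
Proof. by move=> a0; rewrite powRD// (gt_eqF a0) implybT. Qed.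

(** The bookkeeping of exponents at one point: [M] is the value of the amplitude, [D = 1 - t], [Y]
    the chord [|1 - z^2|], [u = y + D / 8], and [J], [I] are local integrals. Inside the [p]-th
    root, [Y ^ (k * (1 - p)) * y ^ (k * p)] cancels the [u ^ k] lost by the mean value property. The
    powers of [D] there come from the area of the box, from [hW] and from the growth bound, and add
    up to [- (alpha + 2) * p]. After the root and the factor [D ^ alpha], exactly [D ^- 2] is
    left. *)
Lemma polar_power_bound (R : realType) (p k alpha M W Y u y D t J I C1 C2 : R) :
  0 < p <= 1 -> 0 <= k -> 0 <= M -> 0 <= W -> 0 <= Y <= 16 * u -> 0 <= y <= u -> 0 < u ->
  0 < D -> 0 <= t <= 1 -> 0 < C1 -> 0 < C2 -> 0 <= J -> 0 <= I ->
  M `^ p * ((D / 8) ^+ 2 * u `^ k) <= C1 * J -> W * J <= C2 * D * I ->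
  M * (Y `^ (k * (1 - p)) / D `^ ((alpha + 2) * p - 1) * W) `^ p^-1
    * (t * y `^ k * (D * (1 + t)) `^ alpha) <=
  (64 * 16 `^ k * C1 * C2) `^ p^-1 * 2 `^ `|alpha| * (t * D ^- 2 * I `^ p^-1).
Proof.
move=> /andP[p0 p1] k0 M0 W0 /andP[Y0 Yu] /andP[y0 yu] u0 D0 /andP[t0 t1] C10 C20 J0 I0 hM hW.
have [u0' D0' C10' C20'] : [/\ 0 <= u, 0 <= D, 0 <= C1 & 0 <= C2] by split; exact: ltW.
have De0 r : 0 < D `^ r by exact: powR_gt0.
have pn0 : p != 0 by rewrite gt_eqF.
have Dn0 : D != 0 by rewrite gt_eqF.
set e := (alpha + 2) * p - 1.
pose X := M `^ p * (Y `^ (k * (1 - p)) / D `^ e * W) * y `^ (k * p).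
have XE : M * (Y `^ (k * (1 - p)) / D `^ e * W) `^ p^-1 * y `^ k = X `^ p^-1.
  rewrite /X !powRM ?mulr_ge0 ?invr_ge0 ?powR_ge0// -!powRrM mulfV// powRr1// -mulrA.
  by rewrite mulfK// !mulrA.
have uk0 : 0 < u `^ k by exact: powR_gt0.
have YY : Y `^ (k * (1 - p)) * y `^ (k * p) <= 16 `^ k * u `^ k.
  apply: (@le_trans _ _ ((16 * u) `^ (k * (1 - p)) * u `^ (k * p))).
    apply: ler_pM; rewrite ?powR_ge0//; apply: ler_powR_base => //.
      by rewrite mulr_ge0// subr_ge0.
    by rewrite mulr_ge0// ltW.
  rewrite powRM// -mulrA -gt0_powRD//.
  have -> : k * (1 - p) + k * p = k by ring.
  rewrite ler_wpM2r ?powR_ge0// ler_powR ?ler1n//.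
  by rewrite ler_piMr// lerBlDr lerDl ltW.
have hM' : M `^ p <= 64 * C1 * J / (D ^+ 2 * u `^ k).
  rewrite ler_pdivlMr ?mulr_gt0 ?exprn_gt0//; move: hM.
  have -> : (D / 8) ^+ 2 = D ^+ 2 / 64 by field.
  by move=> h; rewrite -mulrA -ler_pdivrMl//; apply: le_trans h; rewrite le_eqVlt; apply/orP; left; apply/eqP; field.
have hX : X <= 64 * 16 `^ k * C1 * C2 * (I / D `^ ((alpha + 2) * p)).
  have -> : X = M `^ p * (Y `^ (k * (1 - p)) * y `^ (k * p)) * W / D `^ e by rewrite /X; field; rewrite gt_eqF.
  apply: (@le_trans _ _ (64 * C1 * J / (D ^+ 2 * u `^ k) * (16 `^ k * u `^ k) * W / D `^ e)).
    rewrite ler_wpM2r ?invr_ge0 ?powR_ge0// ler_wpM2r//.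
    by rewrite ler_pM ?mulr_ge0 ?powR_ge0.
  have -> : 64 * C1 * J / (D ^+ 2 * u `^ k) * (16 `^ k * u `^ k) * W / D `^ e
    = 64 * C1 * 16 `^ k / (D ^+ 2 * D `^ e) * (W * J).
    by field; rewrite !gt_eqF.
  apply: (@le_trans _ _ (64 * C1 * 16 `^ k / (D ^+ 2 * D `^ e) * (C2 * D * I))).
    by rewrite ler_wpM2l// !mulr_ge0 ?invr_ge0 ?mulr_ge0 ?powR_ge0 ?exprn_ge0.
  have -> : D `^ ((alpha + 2) * p) = D `^ e * D.
    rewrite -[X in _ = _ * X]powRr1// -gt0_powRD//.
    by congr (_ `^ _); rewrite /e; ring.
  by rewrite le_eqVlt; apply/orP; left; apply/eqP; field; rewrite !gt_eqF.
have X0 : 0 <= X by rewrite /X !mulr_ge0 ?invr_ge0 ?powR_ge0.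
have c0 : 0 <= 64 * 16 `^ k * C1 * C2 by rewrite !mulr_ge0 ?powR_ge0.
have hX2 : X `^ p^-1 <= (64 * 16 `^ k * C1 * C2) `^ p^-1 * (I `^ p^-1 / D `^ (alpha + 2)).
  apply: (@le_trans _ _ ((64 * 16 `^ k * C1 * C2 * (I / D `^ ((alpha + 2) * p))) `^ p^-1)).
    by apply: ler_powR_base; rewrite ?invr_ge0// ltW.
  rewrite powRM ?divr_ge0 ?powR_ge0// [X in _ * X <= _](_ : _ = I `^ p^-1 / D `^ (alpha + 2))//.
  rewrite powRM ?invr_ge0 ?powR_ge0//; congr (_ * _).
  by rewrite -powR_inv1 ?powR_ge0// -!powRrM -powRN; congr (_ `^ _); field.
have t11 : (1 + t) `^ alpha <= 2 `^ `|alpha|.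
  apply: (@le_trans _ _ ((1 + t) `^ `|alpha|)).
    by rewrite ler_powR ?lerDl// ler_norm.
  by apply: ler_powR_base; rewrite ?addr_ge0//; move: t1; clear; lra.
have -> : M * (Y `^ (k * (1 - p)) / D `^ e * W) `^ p^-1 * (t * y `^ k * (D * (1 + t)) `^ alpha) =
   t * (M * (Y `^ (k * (1 - p)) / D `^ e * W) `^ p^-1 * y `^ k) * (D * (1 + t)) `^ alpha by ring.
rewrite XE powRM ?addr_ge0//.
have Da : D `^ (alpha + 2) = D `^ alpha * D ^+ 2.
  by rewrite gt0_powRD// powR_mulrn.
have -> : (64 * 16 `^ k * C1 * C2) `^ p^-1 * 2 `^ `|alpha| * (t * D ^- 2 * I `^ p^-1) =
  t * ((64 * 16 `^ k * C1 * C2) `^ p^-1 * (I `^ p^-1 / D `^ (alpha + 2))) * (D `^ alpha * 2 `^ `|alpha|).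
  by rewrite Da; field; rewrite !gt_eqF ?powR_gt0.
by apply: ler_pM; rewrite ?mulr_ge0 ?powR_ge0// ler_wpM2l// powR_ge0.
Qed.

(** For [s <= sqrt t] monotonicity is enough. Otherwise [v = sqrt t] satisfies
    [v < v ^+ 2 + (1 - v ^+ 2) / 4], that is [(3 * v - 1) * (v - 1) > 0], so [v < 1/3]. Then
    [s <= 1/3] as well, and the ratio of [W 0] to [W 3^-1] bounds the quotient. *)
Lemma nonincreasing_sqrt_bound (R : realType) (W : R -> R) :
  (forall r s, 0 <= r -> r <= s -> W s <= W r) -> (forall r, 0 <= r -> 0 <= W r) -> 0 < W 3^-1 ->
  exists2 K : R, 0 < K & forall t s, 0 <= t <= 1 -> 0 <= s -> s - t <= (1 - t) / 4 ->
    W (Num.sqrt t) <= K * W s.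
Proof.
move=> mW W0 W3; exists (1 + W 0 / W 3^-1); first by rewrite ltr_wpDr// divr_ge0 ?W0// ltW.
move=> t s /andP[t0 t1] s0 st.
have q0 := sqrtr_ge0 t.
have h : 0 <= W 0 / W 3^-1 by rewrite divr_ge0 ?W0// ltW.
have [sq|sq] := leP s (Num.sqrt t).
  by rewrite (le_trans (mW _ _ s0 sq))// mulrDl mul1r lerDl mulr_ge0// W0.
have tE : t = Num.sqrt t ^+ 2 by rewrite sqr_sqrtr.
have q1 : Num.sqrt t <= 1 by rewrite -sqrtr1 ler_sqrt.
have q3 : Num.sqrt t < 3^-1.
  rewrite ltNge; apply/negP => q3; move: sq st q3 q1 q0; rewrite {2 3}tE; move: (Num.sqrt t) => v; clear; nra.
have s3 : s <= 3^-1.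
  have : Num.sqrt t ^+ 2 <= (3^-1 : R) ^+ 2 by rewrite ler_pXn2r ?nnegrE ?invr_ge0// ltW.
  by rewrite -tE; move: st; clear; lra.
apply: (le_trans (mW _ _ (lexx 0) q0)).
have e := mW _ _ s0 s3.
rewrite mulrDl mul1r; apply: ler_wpDl; first exact: W0.
by rewrite -mulrA -[leLHS]mulr1 ler_wpM2l ?W0// mulrC ler_pdivlMr// mul1r.
Qed.

(** Here [z] is given in polar and [zeta] in Cartesian coordinates. Keeping both as variables of one
    relation allows Tonelli to exchange the integral over centres with the integrals over boxes. *)
Definition polar_box (R : realType) (z zeta : R * R) : bool :=
  [&& 0 < z.1, z.1 < 1, 0 < z.2, z.2 < pi, 0 < zeta.2,
      `|zeta.1 - z.1 * cos z.2| <= (1 - z.1) / 8 &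
      `|zeta.2 - z.1 * sin z.2| <= (1 - z.1) / 8].

Lemma measurable_polar_box (R : realType) :
  measurable_fun [set: (R * R) * (R * R)] (fun v => polar_box v.1 v.2).
Proof.
have m1 : measurable_fun [set: (R * R) * (R * R)] (fun v => v.1.1).
  by apply: measurableT_comp.
have m2 : measurable_fun [set: (R * R) * (R * R)] (fun v => v.1.2).
  by apply: measurableT_comp.
have m3 : measurable_fun [set: (R * R) * (R * R)] (fun v => v.2.1).
  by apply: measurableT_comp.
have m4 : measurable_fun [set: (R * R) * (R * R)] (fun v => v.2.2).
  by apply: measurableT_comp.
have mc : measurable_fun [set: (R * R) * (R * R)] (fun v => cos v.1.2).
  by apply: (measurableT_comp _ m2); apply: continuous_measurable_fun; exact: continuous_cos.
have ms : measurable_fun [set: (R * R) * (R * R)] (fun v => sin v.1.2).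
  by apply: (measurableT_comp _ m2); apply: continuous_measurable_fun; exact: continuous_sin.
have mR : measurable_fun [set: (R * R) * (R * R)] (fun v => (1 - v.1.1) / 8).
  by apply: measurable_funM => //; apply: measurable_funB.
have ma (F : (R * R) * (R * R) -> R) : measurable_fun setT F -> measurable_fun setT (fun v => `|F v|).
  by move=> mF; apply: measurableT_comp.
rewrite /polar_box; repeat apply: measurable_and; try exact: measurable_fun_ltr.
all: by apply: measurable_fun_ler => //; apply: ma; apply: measurable_funB => //; apply: measurable_funM.
Qed.

Lemma measurable_polar_box_indicator (R : realType) :
  measurable_fun [set: (R * R) * (R * R)] (fun v => ((polar_box v.1 v.2)%:R : R)).
Proof.
rewrite (_ : (fun _ => _) = (fun v => if polar_box v.1 v.2 then 1 else 0)); last first.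
  by apply/funext => v; case: ifP.
by apply: measurable_fun_if => //; exact: measurable_polar_box.
Qed.

Lemma measurable_polar_box_section (R : realType) (t : R) (zeta : R * R) :
  measurable [set th | polar_box (t, th) zeta].
Proof.
rewrite -[X in measurable X]setTI.
rewrite [X in _ `&` X](_ : _ = (fun th => polar_box (t, th) zeta) @^-1` [set true]); last first.
  by apply/seteqP; split => th /=.
have m : measurable_fun setT (fun th : R => polar_box (t, th) zeta).
  exact: (measurable_fun_pair2 t (measurable_fun_pair1 zeta (@measurable_polar_box R))).
exact: m.
Qed.

(** Two centres of radius [t] whose boxes contain [zeta] differ by at most [2 * d] in each
    coordinate, [d = (1 - t) / 8]. By [angle_diff_le], [t] times the difference of the angles has
    square at most [32 * d ^+ 2], so the angles have diameter at most [6 * d / t]. *)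
Lemma polar_box_angles (R : realType) (t : R) (zeta : R * R) :
  0 < t < 1 -> (@lebesgue_measure R [set th | polar_box (t, th) zeta] <=
    (12 * ((1 - t) / 8) / t)%:E)%E.
Proof.
move=> /andP[t0 t1].
rewrite (_ : 12 * _ / t = 2 * (6 * ((1 - t) / 8) / t)); last by ring.
apply: lebesgue_measure_diam_le.
- exact: measurable_polar_box_section.
- by rewrite !mulr_ge0 ?invr_ge0 ?subr_ge0 ?ltW.
move=> a b /and5P[_ _ a0 ap /and3P[_ a1 a2]] /and5P[_ _ b0 bp /and3P[_ b1 b2]].
set d := (1 - t) / 8 in a1 a2 b1 b2 *.
have h : (a - b) ^+ 2 <= 4 * ((cos a - cos b) ^+ 2 + (sin a - sin b) ^+ 2).
  by apply: angle_diff_le; rewrite !ltW.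
have sq (u : R) : `|u| <= 2 * d -> u ^+ 2 <= (2 * d) ^+ 2.
  by move=> hu; rewrite -(real_normK (num_real u)) ler_pXn2r ?nnegrE// (le_trans _ hu).
have c1 : (t * cos a - t * cos b) ^+ 2 <= (2 * d) ^+ 2.
  by apply: sq; move: a1 b1; rewrite /= !ler_norml; clear; lra.
have c2 : (t * sin a - t * sin b) ^+ 2 <= (2 * d) ^+ 2.
  by apply: sq; move: a2 b2; rewrite /= !ler_norml; clear; lra.
rewrite ler_pdivlMr// -(@ler_pXn2r _ 2)// ?nnegrE ?mulr_ge0//.
- rewrite exprMn real_normK ?num_real//.
  have := ler_wpM2r (sqr_ge0 t) h; have := sqr_ge0 d.
  by move: c1 c2; clear; nra.
- exact: ltW.
- by rewrite subr_ge0 ltW.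
Qed.

Lemma plane_tonelli (R : realType) (f : R * R -> \bar R) :
  measurable_fun [set: R * R] f -> (forall z, 0 <= f z)%E ->
  (\int[(@lebesgue_measure R \x @lebesgue_measure R)%E]_z f z =
   \int[@lebesgue_measure R]_x \int[@lebesgue_measure R]_y f (x, y))%E.
Proof. by move=> mf f0; rewrite fubini_tonelli1. Qed.

(** Integrating the angle first leaves [3 / 2 / (1 - t)]. With [E = 1 - |zeta|], only radii with
    [1 - t] between [4 / 5 * E] and [4 / 3 * E] count: an interval of length [8 / 15 * E], on which
    the integrand is at most [15 / (8 * E)]. *)
Lemma polar_box_mass (R : realType) (zeta : R * R) :
  (\int[(@lebesgue_measure R \x @lebesgue_measure R)%E]_z
     (z.1 * (1 - z.1) `^ (- 2) * (polar_box z zeta)%:R)%:E <= 1)%E.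
Proof.
pose s := Num.sqrt (zeta.1 ^+ 2 + zeta.2 ^+ 2).
have near t th : polar_box (t, th) zeta -> 0 < t < 1 /\ `|s - t| <= (1 - t) / 4.
  move=> /and5P[/= t0 t1 _ _ /and3P[_ a1 a2]]; rewrite t0 t1; split => //.
  apply: le_trans (polar_box_radius (ltW t0) _ a1 a2) _.
    by move: t1; clear; lra.
  by rewrite le_eqVlt; apply/orP; left; apply/eqP; field.
have mI : measurable_fun [set: R * R] (fun z => ((polar_box z zeta)%:R : R)).
  exact: (measurable_fun_pair1 zeta (@measurable_polar_box_indicator R)).
have mF : measurable_fun [set: R * R] (fun z => (z.1 * (1 - z.1) `^ (- 2) * (polar_box z zeta)%:R)%:E).
  apply/measurable_EFinP; apply: measurable_funM => //; apply: measurable_funM => //.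
  apply: (measurableT_comp (measurable_powR (-2))).
  by apply: measurable_funB.
have F0 (z : R * R) : 0 <= z.1 * (1 - z.1) `^ (- 2) * (polar_box z zeta)%:R.
  have [h|_] := boolP (polar_box z zeta); last by rewrite mulr0.
  have [/andP[z0 _] _] := near z.1 z.2 (eq_ind _ (fun z => polar_box z zeta) h _ (surjective_pairing z)).
  by rewrite !mulr_ge0 ?invr_ge0 ?powR_ge0// ltW.
rewrite plane_tonelli//.
have [s1|s1] := ltP s 1; last first.
  rewrite integral0_eq// => t _; rewrite integral0_eq// => th _.
  have [h|_] := boolP (polar_box _ _); last by rewrite mulr0.
  exfalso; have [/andP[t0 t1]] := near _ _ h; rewrite ler_norml; move: s1 t1; clear; lra.
pose E := 1 - s; have E0 : 0 < E by rewrite subr_gt0.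
pose I : set R := `[1 - 4 / 3 * E, 1 - 4 / 5 * E]%classic.
apply: (@le_trans _ _ (\int[@lebesgue_measure R]_t ((15 / (8 * E))%:E * (\1_I t)%:E)))%E.
  apply: ge0_le_integral_subset => [t _|t _|t _].
  - by apply: integral_ge0 => th _; rewrite lee_fin F0.
  - by rewrite mule_ge0// lee_fin divr_ge0// mulr_ge0// ltW.
  split => //=.
  have [ne|em] := pselect (exists th, polar_box (t, th) zeta); last first.
    rewrite integral0_eq.
      by rewrite mule_ge0// lee_fin divr_ge0// mulr_ge0// ltW.
    move=> th _; have [h|_] := boolP (polar_box _ _); last by rewrite mulr0.
    by exfalso; apply: em; exists th.
  have [th0 /near[/andP[t0 t1] st]] := ne.
  have tI : I t by rewrite /I/= in_itv/= /E; move: st; rewrite ler_norml; clear; lra.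
  rewrite indicE mem_set// mule1.
  under eq_integral do rewrite EFinM.
  rewrite ge0_integralZl_EFin//; last 2 first.
  - apply/measurable_EFinP; exact: (measurable_fun_pair2 t mI).
  - by rewrite mulr_ge0 ?powR_ge0// ltW.
  have -> : (\int[@lebesgue_measure R]_x ((polar_box (t, x) zeta)%:R)%:E)%E =
            @lebesgue_measure R [set th | polar_box (t, th) zeta].
    rewrite -[X in lebesgue_measure X]setIT -integral_indic//; last exact: measurable_polar_box_section.
    by apply: eq_integral => th _; rewrite indicE mem_setE.
  apply: (@le_trans _ _ ((t * (1 - t) `^ (- 2))%:E * (12 * ((1 - t) / 8) / t)%:E))%E.
    by apply: lee_wpmul2l; [rewrite lee_fin mulr_ge0 ?powR_ge0// ltW|apply: polar_box_angles; rewrite t0].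
  rewrite -EFinM lee_fin.
  have t1' : 0 < 1 - t by rewrite subr_gt0.
  have -> : t * (1 - t) `^ (- 2) * (12 * ((1 - t) / 8) / t) = 3 / 2 / (1 - t).
    by rewrite powRN powR_mulrn ?ltW//; field; rewrite !gt_eqF.
  rewrite ler_pdivrMr// mulrAC ler_pdivlMr ?mulr_gt0//.
  by move: st; rewrite ler_norml /E; clear; lra.
rewrite ge0_integralZl_EFin//; last 2 first.
- by apply/measurable_EFinP; apply: measurable_indic; exact: measurable_itv.
- by rewrite divr_ge0// mulr_ge0// ltW.
rewrite integral_indic//=; last exact: measurable_itv.
rewrite setIT lebesgue_measure_itv/= lte_fin.
case: ifPn => [_|]; last by rewrite mule0.
rewrite -EFinB -EFinM lee_fin le_eqVlt; apply/orP; left; apply/eqP; field.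
by rewrite gt_eqF.
Qed.

(** After Tonelli, the mass of the kernel in its first variable becomes a factor of [h]. *)
Lemma kernel_integral_le d1 d2 (T1 : measurableType d1) (T2 : measurableType d2)
    (R : realType) (m1 : {sigma_finite_measure set T1 -> \bar R})
    (m2 : {sigma_finite_measure set T2 -> \bar R}) (k : T1 * T2 -> R) (h : T2 -> \bar R) :
  measurable_fun setT k -> (forall v, 0 <= k v) ->
  measurable_fun setT h -> (forall y, 0 <= h y)%E ->
  (forall y, \int[m1]_x (k (x, y))%:E <= 1)%E ->
  (\int[m1]_x \int[m2]_y ((k (x, y))%:E * h y) <= \int[m2]_y h y)%E.
Proof.
move=> mk k0 mh h0 k1.
pose F v := ((k v)%:E * h v.2)%E.
have F0 v : (0 <= F v)%E by rewrite mule_ge0// lee_fin.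
have mF : measurable_fun setT F.
  by apply: emeasurable_funM; [exact/measurable_EFinP|exact: measurableT_comp].
rewrite (fubini_tonelli F mF F0).
apply: ge0_le_integral_subset => [y _|//|y _].
  by apply: integral_ge0 => x _; exact: (F0 (x, y)).
split => //; rewrite /F/= ge0_integralZr//; last 2 first.
- by apply/measurable_EFinP; exact: measurable_fun_pair1.
- by move=> x _; rewrite lee_fin.
rewrite -[leRHS]mul1e; exact: lee_wpmul2r.
Qed.

Lemma plane_sigma_finite (R : realType) :
  sigma_finite setT (@lebesgue_measure R \x @lebesgue_measure R)%E.
Proof.
exists (fun n => `[- n%:R, n%:R] `*` `[- n%:R, n%:R]).
  apply/esym/seteqP; split => // -[x y] _.
  have [n nx] : exists n, Num.max `|x| `|y| < n%:R.
    by exists (Num.bound (Num.max `|x| `|y|)); apply: archi_boundP; rewrite le_max normr_ge0.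
  exists n => //=; rewrite !in_itv/= -!ler_norml.
  by move: nx; rewrite gt_max => /andP[/ltW -> /ltW ->].
move=> n; split; first by apply: measurableX; exact: measurable_itv.
by rewrite lebesgue_measure_rectangle ?ltry// ge0_cp// ler0n.
Qed.

(* The library's sigma-finite instance on products is shadowed by the one for
   subprobabilities, hence the explicit packing. *)
Lemma plane_kernel_integral_le (R : realType) (k : (R * R) * (R * R) -> R) (h : R * R -> \bar R) :
  measurable_fun setT k -> (forall v, 0 <= k v) ->
  measurable_fun setT h -> (forall y, 0 <= h y)%E ->
  (forall y, \int[(@lebesgue_measure R \x @lebesgue_measure R)%E]_x (k (x, y))%:E <= 1)%E ->
  (\int[(@lebesgue_measure R \x @lebesgue_measure R)%E]_x
    \int[(@lebesgue_measure R \x @lebesgue_measure R)%E]_y ((k (x, y))%:E * h y) <=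
   \int[(@lebesgue_measure R \x @lebesgue_measure R)%E]_y h y)%E.
Proof.
pose mu := HB.pack_for {sigma_finite_measure set _ -> \bar R}
  (@lebesgue_measure R \x @lebesgue_measure R)%E
  (Measure_isSigmaFinite.Build _ _ _ _ (@plane_sigma_finite R)).
exact: (@kernel_integral_le _ _ _ _ _ mu mu).
Qed.

Lemma polar_box_tonelli (R : realType) (h : R * R -> \bar R) :
  measurable_fun [set: R * R] h -> (forall z, 0 <= h z)%E ->
  (\int[(@lebesgue_measure R \x @lebesgue_measure R)%E]_z
      \int[(@lebesgue_measure R \x @lebesgue_measure R)%E]_zeta
        ((z.1 * (1 - z.1) `^ (- 2) * (polar_box z zeta)%:R)%:E * h zeta)
   <= \int[(@lebesgue_measure R \x @lebesgue_measure R)%E]_zeta h zeta)%E.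
Proof.
move=> mh h0.
apply: (@plane_kernel_integral_le _ (fun v => v.1.1 * (1 - v.1.1) `^ (- 2) * (polar_box v.1 v.2)%:R)) => //.
- have m1 : measurable_fun [set: (R * R) * (R * R)] (fun v => v.1.1).
    by apply: measurableT_comp.
  apply: measurable_funM; last exact: measurable_polar_box_indicator.
  apply: measurable_funM => //; apply: (measurableT_comp (measurable_powR (-2))).
  by apply: measurable_funB.
- move=> v; have [/andP[/ltW v0 _]|_] := boolP (polar_box _ _); last by rewrite mulr0.
  by rewrite !mulr_ge0 ?powR_ge0.
- exact: polar_box_mass.
Qed.

Definition half_disk (R : realType) : set (R * R) := [set z | disk2 z.1 z.2 /\ 0 < z.2].

Definition polar_rect (R : realType) : set (R * R) := [set z | 0 < z.1 < 1 /\ 0 < z.2 < pi].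

(** [|y|^k (1 - |z|^2)^alpha] at the point with polar coordinates [z], with the Jacobian included:
    this is the [1] in the exponent [k + 1]. *)
Definition polar_weight (R : realType) (k alpha : R) (z : R * R) : R :=
  z.1 `^ (k + 1) * (1 - z.1 ^+ 2) `^ alpha * sin z.2 `^ k.

(** For [W = weight_tail w] the tail hypothesis bounds it by a multiple of [w] at [|z|]. It is
    easier to handle than [w]: being built from a monotone function it is Borel, and it can be
    compared over a whole box. *)
Definition tail_density (R : realType) (W : R -> R) (z : R * R) : R :=
  W (Num.sqrt (z.1 ^+ 2 + z.2 ^+ 2)) / (1 - Num.sqrt (z.1 ^+ 2 + z.2 ^+ 2)).

Lemma disk2_sqrt (R : realType) (x y : R) : disk2 x y <-> Num.sqrt (x ^+ 2 + y ^+ 2) < 1.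
Proof. by rewrite /disk2 -{2}sqrtr1 ltr_sqrt. Qed.

Lemma half_disk_open (R : realType) : open (@half_disk R).
Proof.
rewrite openE => -[x y] [/= xy y0]; rewrite /interior.
have [d d0 H] := disk2_open xy.
apply/nbhs_ballP; exists (Num.min d y) => /=; first by rewrite lt_min d0.
move=> [s t] [/=]; rewrite /ball/= !lt_min => /andP[h1 _] /andP[h2 h3]; split => /=.
  by apply: H; rewrite distrC.
by move: h3; rewrite ltr_norml; clear; lra.
Qed.

Lemma measurable_upper_box (R : realType) (x y d : R) : measurable (upper_box x y d).
Proof.
rewrite (_ : upper_box x y d = `[x - d, x + d] `*` (`[y - d, y + d] `&` `]0, +oo[)).
  by apply: measurableX; [|apply: measurableI]; exact: measurable_itv.
apply/seteqP; split => -[s t]; rewrite /upper_box/= !in_itv/= !andbT -!ler_distl.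
  by case.
by move=> [? []].
Qed.

Lemma measurable_tail_density (R : realType) (W : R -> R) (A : set (R * R)) :
  (forall r s, 0 <= r -> r <= s -> W s <= W r) -> (forall z, A z -> disk2 z.1 z.2) ->
  measurable_fun A (tail_density W).
Proof.
(* [W] is monotone only on nonnegative arguments; truncation makes it monotone, hence measurable, on
   the line. *)
move=> mW AD; pose V r := W (Num.max r 0).
have mV : measurable_fun setT V.
  apply: nonincreasing_measurable => // r s rs; apply: mW; first by rewrite le_max lexx orbT.
  by rewrite ge_max !le_max rs lexx !orbT.
have mr : measurable_fun A (fun z => Num.sqrt (z.1 ^+ 2 + z.2 ^+ 2)).
  apply: (measurableT_comp (continuous_measurable_fun (@sqrt_continuous R))).
  by apply: measurable_funTS; apply: measurable_funD; apply: measurable_funX.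
suff : measurable_fun A (fun z => V (Num.sqrt (z.1 ^+ 2 + z.2 ^+ 2)) *
   (1 - Num.sqrt (z.1 ^+ 2 + z.2 ^+ 2)) `^ (-1)).
  apply: eq_measurable_fun.
  move=> z; rewrite inE => /AD/disk2_sqrt z1; rewrite /tail_density /V max_l ?sqrtr_ge0//.
  by rewrite powR_inv1// subr_ge0 ltW.
apply: measurable_funM; first exact: measurableT_comp.
apply: (measurableT_comp (measurable_powR (-1))); exact: measurable_funB.
Qed.

(** Inserts the weight into the local integral: at a point of the box with modulus [s],
    [1 - s <= 2 * (1 - t)] and [W (sqrt t) <= C2 * W s], so the tail density is at least
    [W (sqrt t) / (2 * C2 * (1 - t))]. *)
Lemma polar_submean (R : realType) (K p k : R) (W : R -> R) : 0 < K -> 0 < p <= 1 -> 0 <= k ->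
  (forall r s, 0 <= r -> r <= s -> W s <= W r) -> (forall r, 0 <= r -> 0 <= W r) ->
  (forall r, 0 <= r < 1 -> 0 < W r) ->
  exists C1 C2 : R, [/\ 0 < C1, 0 < C2 &
  forall a : R -> R -> R, (forall x y, 0 <= a x y) ->
  slowly_varying K (@disk2 R) a ->
  (forall x y, disk2 x y -> {for (x, y), continuous (fun p : R * R => a p.1 p.2)}) ->
  forall t th I : R, 0 < t < 1 -> 0 < th < pi ->
  (\int[(@lebesgue_measure R \x @lebesgue_measure R)%E]_(z in upper_box (t * cos th) (t * sin th) ((1 - t) / 8))
     (a z.1 z.2 `^ p * z.2 `^ k * tail_density W z)%:E)%E = I%:E ->
  exists J : R, [/\ 0 <= J, 0 <= I,
    a (t * cos th) (t * sin th) `^ p * (((1 - t) / 8) ^+ 2 * (t * sin th + (1 - t) / 8) `^ k) <= C1 * J &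
    W (Num.sqrt t) * J <= C2 * (1 - t) * I]].
Proof.
move=> K0 p01 k0 mW W0 Wp.
have [C1 C10 sub] := submean K0 p01 k0.
have W3 : 0 < W 3^-1 by apply: Wp; rewrite invr_ge0 ler0n/= invf_lt1// ltr1n.
have [C2 C20 hW] := nonincreasing_sqrt_bound mW W0 W3.
exists C1, (2 * C2); split => //; first by rewrite mulr_gt0.
move=> a a0 sv ac t th I /andP[t0 t1] /andP[th0 thpi] IE.
set x0 := t * cos th in IE *; set y0 := t * sin th in IE *; set d := (1 - t) / 8 in IE *.
have D0 : 0 < 1 - t by rewrite subr_gt0.
have d0 : 0 < d by rewrite divr_gt0.
have y00 : 0 < y0 by rewrite mulr_gt0// sin_gt0_pi// th0.
have rad x y : `|x - x0| <= d -> `|y - y0| <= d ->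
    `|Num.sqrt (x ^+ 2 + y ^+ 2) - t| <= (1 - t) / 4.
  move=> hx hy; apply: le_trans (polar_box_radius (ltW t0) (ltW d0) hx hy) _.
  by rewrite le_eqVlt; apply/orP; left; apply/eqP; rewrite /d; field.
have inD x y : `|x - x0| <= d -> `|y - y0| <= d -> disk2 x y.
  by move=> hx hy; apply/disk2_sqrt; have := rad _ _ hx hy; rewrite ler_norml; move: t1; clear; lra.
have boxH : upper_box x0 y0 d `<=` @half_disk R.
  by move=> z [hx hy z0]; split => //; exact: inD.
have := sub _ _ a0 sv ac x0 y0 d y00 d0 (fun x y hx hy _ => inD x y hx hy).
set J := (\int[_]_(z in _) _)%E => hJ.
have g0 (z : R * R) : upper_box x0 y0 d z -> 0 <= a z.1 z.2 `^ p * z.2 `^ k * tail_density W z.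
  move=> /boxH[/disk2_sqrt z1 _]; rewrite !mulr_ge0 ?powR_ge0 ?W0 ?sqrtr_ge0//.
  by rewrite invr_ge0 subr_ge0 ltW.
have I0 : 0 <= I.
  by rewrite -lee_fin -IE; apply: integral_ge0 => z /g0; rewrite lee_fin.
have ma : measurable_fun (@half_disk R) (fun z => a z.1 z.2).
  by apply: continuous2_measurable; [exact: half_disk_open|move=> z [/ac]; case: z].
have mg : measurable_fun (@half_disk R) (fun z => a z.1 z.2 `^ p * z.2 `^ k * tail_density W z).
  apply: measurable_funM; last by apply: measurable_tail_density => // z [].
  apply: measurable_funM; first exact: (measurableT_comp (measurable_powR p)).
  by apply: measurable_funTS; apply: (measurableT_comp (measurable_powR k)).
have Wt : 0 < W (Num.sqrt t) by apply: Wp; rewrite sqrtr_ge0 -sqrtr1 ltr_sqrt.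
have hJI : (J <= (2 * C2 * (1 - t) / W (Num.sqrt t))%:E * I%:E)%E.
  rewrite -IE -ge0_integralZl_EFin//; last 3 first.
  - exact: measurable_upper_box.
  - apply/measurable_EFinP; apply: measurable_funS mg => //; apply: open_measurable2.
    exact: half_disk_open.
  - by rewrite divr_ge0 ?mulr_ge0// ltW.
  apply: ge0_le_integral_subset => z zb.
  - by rewrite lee_fin mulr_ge0 ?powR_ge0.
  - by rewrite lee_fin; apply: mulr_ge0; [rewrite divr_ge0 ?mulr_ge0// ltW|exact: g0].
  split => //; rewrite -EFinM lee_fin.
  have [hx hy z0] := zb; have hr := rad _ _ hx hy; rewrite /tail_density.
  set s := Num.sqrt (z.1 ^+ 2 + z.2 ^+ 2) in hr *.
  have s0 : 0 <= s by exact: sqrtr_ge0.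
  have s1 : s < 1 by move: hr t1; rewrite ler_norml; clear; lra.
  have hs : W (Num.sqrt t) <= C2 * W s.
    apply: hW => //; first by rewrite !ltW.
    by move: hr; rewrite ler_norml; clear; lra.
  have hs2 : 1 - s <= 2 * (1 - t) by move: hr t1; rewrite ler_norml; clear; lra.
  rewrite [leRHS]mulrCA -[leLHS]mulr1 ler_wpM2l ?mulr_ge0 ?powR_ge0//.
  rewrite mulrA ler_pdivlMr ?subr_gt0// mul1r mulrAC ler_pdivlMr//.
  have := ler_pM (ltW Wt) (_ : 0 <= 1 - s) hs hs2; rewrite subr_ge0 ltW// => /(_ isT).
  by clear; lra.
have J0 : (0 <= J)%E by apply: integral_ge0 => z _; rewrite lee_fin mulr_ge0 ?powR_ge0.
have JE : J = (fine J)%:E.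
  by rewrite fineK// ge0_fin_numE// (le_lt_trans hJI)// -EFinM ltry.
exists (fine J); split => //.
- exact: fine_ge0.
- by move: hJ; rewrite JE -EFinM lee_fin.
- move: hJI; rewrite JE -EFinM lee_fin mulrAC ler_pdivlMr// mulrC.
  by move=> h; apply: le_trans h _.
Qed.

(** [Y] stands for [|1 - z^2|]; only its comparison with the scale of the box matters. The pointwise
    bound produces the kernel of [polar_box_mass] applied to the density [g], and
    [polar_box_tonelli] sums it. *)
Lemma polar_estimate (R : realType) (K p k alpha : R) (W : R -> R) :
  0 < K -> 0 < p <= 1 -> 0 <= k ->
  (forall r s, 0 <= r -> r <= s -> W s <= W r) -> (forall r, 0 <= r -> 0 <= W r) ->
  (forall r, 0 <= r < 1 -> 0 < W r) ->
  exists2 C : R, 0 < C &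
  forall a : R -> R -> R, (forall x y, 0 <= a x y) ->
  slowly_varying K (@disk2 R) a ->
  (forall x y, disk2 x y -> {for (x, y), continuous (fun p : R * R => a p.1 p.2)}) ->
  forall Y : R * R -> R,
  (forall z, polar_rect z -> 0 <= Y z <= 2 * (1 - z.1) + 2 * (z.1 * sin z.2)) ->
  (\int[(@lebesgue_measure R \x @lebesgue_measure R)%E]_(z in @polar_rect R)
     (a (z.1 * cos z.2) (z.1 * sin z.2) *
      (Y z `^ (k * (1 - p)) / (1 - z.1) `^ ((alpha + 2) * p - 1) * W (Num.sqrt z.1)) `^ p^-1 *
      polar_weight k alpha z)%:E <=
   C%:E * (\int[(@lebesgue_measure R \x @lebesgue_measure R)%E]_(z in @half_disk R)
     (a z.1 z.2 `^ p * z.2 `^ k * tail_density W z)%:E) `^ p^-1)%E.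
Proof.
move=> K0 p01 k0 mW W0 Wp; have [p0 p1] := andP p01.
have [C1 [C2 [C10 C20 sub]]] := polar_submean K0 p01 k0 mW W0 Wp.
pose C := (64 * 16 `^ k * C1 * C2) `^ p^-1 * 2 `^ `|alpha|.
have C0 : 0 < C by rewrite mulr_gt0 ?powR_gt0 ?mulr_gt0 ?powR_gt0.
exists C => // a a0 sv ac Y hY.
set mu := (_ \x _)%E; set g := fun z : R * R => a z.1 z.2 `^ p * z.2 `^ k * tail_density W z.
have mH : measurable (@half_disk R) by apply: open_measurable2; exact: half_disk_open.
have g0 z : half_disk z -> 0 <= g z.
  move=> [/disk2_sqrt z1 _]; rewrite /g !mulr_ge0 ?powR_ge0 ?W0 ?sqrtr_ge0//.
  by rewrite invr_ge0 subr_ge0 ltW.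
have mg : measurable_fun (@half_disk R) g.
  apply: measurable_funM; last by apply: measurable_tail_density => // z [].
  apply: measurable_funM; last by apply: measurable_funTS; apply: (measurableT_comp (measurable_powR k)).
  apply: (measurableT_comp (measurable_powR p)).
  by apply: continuous2_measurable; [exact: half_disk_open|move=> z [/ac]; case: z].
have I0 : (0 <= \int[mu]_(z in @half_disk R) (g z)%:E)%E.
  by apply: integral_ge0 => z /g0; rewrite lee_fin.
have [Ioo|] := eqVneq (\int[mu]_(z in @half_disk R) (g z)%:E)%E +oo%E.
  by rewrite Ioo poweRyr ?invr_eq0 ?gt_eqF// gt0_muley ?lte_fin// leey.
rewrite -ltey => Ify.
have iE : (\int[mu]_(z in @half_disk R) (g z)%:E = (fine (\int[mu]_(z in @half_disk R) (g z)%:E))%:E)%E.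
  by rewrite fineK// ge0_fin_numE.
move: iE; set i := fine _ => iE.
have i0 : 0 <= i by exact: fine_ge0.
(* A local integral [r] satisfies [r <= i], so [r ^ p^-1 <= i ^ (p^-1 - 1) * r]: the first factor is
   put into the constant [c], and what remains is linear in [g]. *)
pose c := C * i `^ (p^-1 - 1).
have c0 : 0 <= c by rewrite mulr_ge0 ?powR_ge0// ltW.
pose h := (fun z => (c * g z)%:E) \_ (@half_disk R).
have h0 z : (0 <= h z)%E.
  by rewrite /h patchE; case: ifPn => // /set_mem/g0 gz; rewrite lee_fin mulr_ge0.
have mh : measurable_fun setT h.
  apply/(measurable_restrictT _ _).1 => //.
  by apply/measurable_EFinP; exact: measurable_funM.
have ip : i `^ (p^-1 - 1) * i = i `^ p^-1.
  have [->|in0] := eqVneq i 0; first by rewrite mulr0 powR0// invr_neq0// gt_eqF.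
  rewrite -[X in _ * X]powRr1// -powRD ?in0 ?implybT//.
  by rewrite subrK.
apply: (@le_trans _ _ (\int[mu]_zeta h zeta)%E); last first.
  rewrite -integral_mkcond; under eq_integral do rewrite EFinM.
  rewrite ge0_integralZl_EFin//; last exact/measurable_EFinP.
  by rewrite iE -EFinM poweR_EFin -EFinM lee_fin /c -mulrA ip.
apply: le_trans (polar_box_tonelli mh h0).
apply: ge0_le_integral_subset => [z zU|z _|z zU].
- by rewrite lee_fin /polar_weight !mulr_ge0 ?powR_ge0.
- apply: integral_ge0 => zeta _; rewrite mule_ge0// lee_fin.
  have [/andP[/ltW z0 _]|_] := boolP (polar_box _ _); last by rewrite mulr0.
  by rewrite !mulr_ge0 ?powR_ge0.
split => //; have [t01 th01] := zU; have [t0 t1] := andP t01; have [th0 th1] := andP th01.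
set x0 := z.1 * cos z.2; set y0 := z.1 * sin z.2; set d := (1 - z.1) / 8.
have D0 : 0 < 1 - z.1 by rewrite subr_gt0.
have y00 : 0 < y0 by rewrite mulr_gt0// sin_gt0_pi// th0.
have boxE zeta : polar_box z zeta = (zeta \in upper_box x0 y0 d).
  rewrite /polar_box t0 t1 th0 th1/=; apply/idP/idP.
    by move=> /and3P[? ? ?]; rewrite inE.
  by rewrite inE => -[? ? ?]; apply/and3P.
have boxH : upper_box x0 y0 d `<=` @half_disk R.
  move=> v vb; split; last by case: vb.
  apply/disk2_sqrt; have [hx hy _] := vb.
  have d0 : 0 <= d by rewrite divr_ge0// ltW.
  have := polar_box_radius (ltW t0) d0 hx hy.
  by rewrite ler_norml /d; move: t1; clear; lra.
have mgb : measurable_fun (upper_box x0 y0 d) g by apply: measurable_funS mg.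
have mb : measurable (upper_box x0 y0 d) by exact: measurable_upper_box.
have Ib : (\int[mu]_(v in upper_box x0 y0 d) (g v)%:E <= i%:E)%E.
  rewrite -iE; apply: ge0_le_integral_subset => [v /boxH/g0|v /g0|v /boxH]; rewrite ?lee_fin//.
have [r rE] : exists r, (\int[mu]_(v in upper_box x0 y0 d) (g v)%:E)%E = r%:E.
  exists (fine (\int[mu]_(v in upper_box x0 y0 d) (g v)%:E)%E); rewrite fineK// ge0_fin_numE.
    by rewrite (le_lt_trans Ib)// ltry.
  by apply: integral_ge0 => v /boxH/g0; rewrite lee_fin.
have [J [J0 r0 hJ1 hJ2]] := sub a a0 sv ac z.1 z.2 r t01 th01 rE.
have ri : r <= i by rewrite -lee_fin -rE.
have -> : (\int[mu]_zeta ((z.1 * (1 - z.1) `^ (-2) * (polar_box z zeta)%:R)%:E * h zeta) =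
   (z.1 * (1 - z.1) `^ (-2) * c * r)%:E)%E.
  rewrite [RHS]EFinM -rE -ge0_integralZl_EFin//; last 3 first.
  - by move=> v /boxH/g0; rewrite lee_fin.
  - exact/measurable_EFinP.
  - by rewrite !mulr_ge0 ?powR_ge0// ltW.
  rewrite [RHS]integral_mkcond; apply: eq_integral => v _.
  rewrite boxE patchE /h patchE; have [vb|_] := boolP (v \in upper_box x0 y0 d); last by rewrite mulr0 mul0e.
  by rewrite mem_set ?mulr1 -?EFinM ?mulrA//; apply: boxH; exact: set_mem.
rewrite lee_fin.
have := @polar_power_bound R p k alpha (a x0 y0) (W (Num.sqrt z.1)) (Y z) (y0 + d) y0 (1 - z.1) z.1 J r C1 C2.
have -> : polar_weight k alpha z = z.1 * y0 `^ k * ((1 - z.1) * (1 + z.1)) `^ alpha.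
  rewrite /polar_weight /y0 gt0_powRD// powRr1 ?ltW// powRM ?(ltW t0)//; last by rewrite sin_ge0_pi// !ltW.
  have -> : 1 - z.1 ^+ 2 = (1 - z.1) * (1 + z.1) by ring.
  ring.
move=> H; apply: le_trans (H _ _ _ _ _ _ _ _ _ _ _ _ _ _ _) _ => //.
- exact: W0.
(* Origin of the [16]: it makes the term [2 * (1 - z.1)] fit under [16 * (y0 + (1 - z.1) / 8)]. *)
- have /andP[-> /= hh] := hY _ zU; apply: le_trans hh _; rewrite -/y0 /d; move: D0 y00; clear; lra.
- by rewrite ltW//= lerDl divr_ge0// ltW.
- by rewrite addr_gt0// divr_gt0.
- by rewrite !ltW.
rewrite -/C /c.
have rp : r `^ p^-1 <= i `^ (p^-1 - 1) * r.
  have [->|rn0] := eqVneq r 0; first by rewrite mulr0 powR0// invr_neq0// gt_eqF.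
  rewrite -[p^-1](subrK 1) powRD; last by rewrite rn0 implybT.
  rewrite powRr1// ler_wpM2r// subrK; apply: ler_powR_base => //.
  by rewrite subr_ge0 invf_ge1.
have -> : z.1 * (1 - z.1) `^ (-2) * (C * i `^ (p^-1 - 1)) * r =
  C * (z.1 * (1 - z.1) ^- 2 * (i `^ (p^-1 - 1) * r)).
  by rewrite powRN powR_mulrn ?ltW//; ring.
by rewrite ler_pM2l// ler_wpM2l// divr_ge0 ?exprn_ge0// ltW.
Qed.

(** * The Gamma function *)

Lemma FTC_derive (R : realType) (F f : R -> R) (a b : R) : a < b ->
  (forall x, a <= x <= b -> is_derive x 1 F (f x)) ->
  (forall x, a <= x <= b -> {for x, continuous f}) ->
  (\int[@lebesgue_measure R]_(x in `[a, b]) (f x)%:E = (F b - F a)%:E)%E.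
Proof.
move=> ab dF cf; rewrite (@continuous_FTC2 _ f F)//.
- apply: continuous_in_subspaceT => x; rewrite inE/= in_itv/= => /andP[? ?].
  by apply: cf; apply/andP.
- split.
  + by move=> x; rewrite in_itv/= => /andP[/ltW ax /ltW xb]; have [] := dF x; rewrite ?ax.
  + apply: cvg_at_right_filter; apply: is_derive1_continuous (dF a _).
    by rewrite lexx ltW.
  + apply: cvg_at_left_filter; apply: is_derive1_continuous (dF b _).
    by rewrite lexx ltW.
- move=> x; rewrite in_itv/= => /andP[/ltW ax /ltW xb].
  by rewrite derive1E; have := dF x; rewrite ax xb => /(_ isT)[_ ->].
Qed.

(** A single term of the exponential series at [t / 2], of degree above [s], dominates the power. *)
Lemma powR_le_expR (R : realType) (s : R) : exists2 C : R, 0 < C &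
  forall t, 1 <= t -> t `^ s * expR (- t) <= C * expR (- (t / 2)).
Proof.
pose n := Num.bound `|s|.
have sn : s <= n%:R by apply: le_trans (ler_norm _) _; apply/ltW/archi_boundP.
exists ((n.+1)`!%:R * 2 ^+ n.+1); first by rewrite mulr_gt0// ?exprn_gt0// ltr0n fact_gt0.
move=> t t1; have t0 : 0 <= t by apply: le_trans t1.
have -> : expR (- t) = expR (- (t / 2)) * expR (- (t / 2)).
  by rewrite -expRD; congr expR; field.
rewrite mulrA ler_wpM2r ?expR_ge0// expRN ler_pdivrMr ?expR_gt0//.
apply: (@le_trans _ _ (t ^+ n.+1)).
  rewrite -powR_mulrn//; apply: ler_powR => //.
  by apply: le_trans sn _; rewrite ler_nat.
have t20 : 0 <= t / 2 by rewrite divr_ge0.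
have := expR_ge1Dxn n t20; have := expR_ge0 (t / 2).
set E := expR _ => E0 h.
have f0 : 0 < ((n.+1)`!%:R : R) by rewrite ltr0n fact_gt0.
have {}h : (t / 2) ^+ n.+1 / (n.+1)`!%:R <= E by apply: le_trans h; rewrite lerDr.
move: h; rewrite ler_pdivrMr// expr_div_n ler_pdivrMr ?exprn_gt0//.
by move=> h; apply: le_trans h _; rewrite le_eqVlt; apply/orP; left; apply/eqP; ring.
Qed.

Section gamma.
Variable R : realType.
Implicit Types a t : R.

Let g a t : R := t `^ (a - 1) * expR (- t).
Let mu := @lebesgue_measure R.
(** A compact exhaustion, since the Gamma integral is improper at both ends. *)
Let J n : set R := `[n.+1%:R^-1, n.+1%:R]%classic.

Let g_ge0 a t : 0 <= g a t.
Proof. by rewrite mulr_ge0 ?powR_ge0 ?expR_ge0. Qed.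

Let bigcupJ : \bigcup_n J n = `]0, +oo[%classic.
Proof.
apply/seteqP; split => t /=.
  by move=> [n _]; rewrite /J/= !in_itv/= andbT => /andP[h _]; apply: lt_le_trans h.
rewrite in_itv/= andbT => t0.
exists (Num.bound (Num.max t t^-1)) => //; rewrite /J/= in_itv/=.
have h : Num.max t t^-1 < (Num.bound (Num.max t t^-1))%:R.
  by apply: archi_boundP; rewrite le_max ltW.
move: h; rewrite gt_max => /andP[h1 h2].
rewrite (le_trans (ltW h1)) ?ler_nat// andbT.
rewrite invf_ple ?posrE//.
by rewrite (le_trans (ltW h2))// ler_nat.
Qed.

Let J_nd : nondecreasing_seq J.
Proof.
move=> m n mn; apply/subsetPset => t; rewrite /J/= !in_itv/= => /andP[h1 h2].
rewrite (le_trans h2) ?ler_nat// andbT; apply: le_trans h1.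
by rewrite lef_pV2 ?posrE// ler_nat.
Qed.

Let dg a t : 0 < t -> is_derive t 1 (g (a + 1)) (a * g a t - g (a + 1) t).
Proof.
move=> t0.
have d1 : is_derive t 1 (fun t => expR (- t)) (- expR (- t)).
  apply: (is_derive1_ext (is_derive1_affine (a := 0) (e := -1) (is_derive_expR _))) => [s|].
    by rewrite add0r mulN1r.
  by rewrite add0r !mulN1r.
have d2 : is_derive t 1 (fun t => t `^ a) (a * t `^ (a - 1)) by exact: is_derive1_powR.
apply: (is_derive1_ext (is_deriveM d2 d1)) => [s|]; first by rewrite /g addrK.
by rewrite /g addrK /GRing.scale/=; ring.
Qed.

Let mg a : measurable_fun setT (g a).
Proof.
apply: measurable_funM; first exact: measurable_powR.
by apply: (measurableT_comp (@measurable_expR R)).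
Qed.

Let cvgJ a : (\int[mu]_(t in J n) (g a t)%:E @[n --> \oo] --> \int[mu]_(t in `]0%R, +oo[) (g a t)%:E)%E.
Proof.
rewrite -bigcupJ; apply: ge0_nondecreasing_set_cvg_integral => //.
- by move=> n; exact: measurable_itv.
- by move=> n; apply/measurable_EFinP; apply: measurable_funTS; exact: mg.
- by move=> n t _; rewrite lee_fin.
Qed.

Let g_continuous a t : 0 < t -> {for t, continuous (g a)}.
Proof. by rewrite -[a](subrK 1) => /dg d; exact: is_derive1_continuous (d (a - 1)). Qed.

Let integrable_J a n : mu.-integrable (J n) (EFin \o g a).
Proof.
apply: continuous_compact_integrable; first exact: segment_compact.
apply: continuous_in_subspaceT => x; rewrite inE/= /J/= in_itv/= => /andP[h _].
by apply: g_continuous; apply: lt_le_trans h.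
Qed.

Let rec_J a n : (\int[mu]_(t in J n) (g (a + 1) t)%:E + (g (a + 1) n.+1%:R)%:E =
  a%:E * \int[mu]_(t in J n) (g a t)%:E + (g (a + 1) n.+1%:R^-1)%:E)%E.
Proof.
have fin b : exists r : R, (\int[mu]_(t in J n) (g b t)%:E)%E = r%:E.
  exists (fine (\int[mu]_(t in J n) (g b t)%:E)%E).
  by rewrite fineK//; apply: integrable_fin_num (integrable_J b n) => //; exact: measurable_itv.
(* [J 0] is the single point [1], where both integrals vanish and the boundary terms coincide; the
   fundamental theorem is applied to proper intervals. *)
have [->|n0] := eqVneq n 0.
  rewrite /J invr1 set_itv1 !integral_set1 mule0//.
have uv : n.+1%:R^-1 < n.+1%:R :> R.
  rewrite -[ltLHS]div1r ltr_pdivrMr ?ltr0n// -natrM ltr1n.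
  by rewrite mulnS addSn ltnS addn_gt0 lt0n n0.
have := @FTC_derive R (g (a + 1)) (fun t => a * g a t - g (a + 1) t) _ _ uv.
have pos (x : R) : n.+1%:R^-1 <= x -> 0 < x by apply: lt_le_trans.
have [r rE] := fin a; have [s sE] := fin (a + 1).
have Jn : J n = `[n.+1%:R^-1, n.+1%:R]%classic by [].
rewrite -Jn -/mu; have -> : (\int[mu]_(x in J n) (a * g a x - g (a + 1) x)%:E = (a * r - s)%:E)%E.
  under eq_integral do rewrite EFinB EFinM.
  rewrite integralB//=; last 3 first.
  - exact: measurable_itv.
  - by apply: integrableZl; [exact: measurable_itv|exact: integrable_J].
  - exact: integrable_J.
  rewrite integralZl//; [|exact: measurable_itv|exact: integrable_J].
  by rewrite rE sE -EFinM -EFinB.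
move=> H; rewrite rE sE -EFinM -!EFinD; congr EFin.
have {}H : a * r - s = g (a + 1) n.+1%:R - g (a + 1) n.+1%:R^-1; last by move: H; lra.
apply: EFin_inj; apply: H.
- by move=> x /andP[/pos x0 _]; exact: dg.
- move=> x /andP[/pos x0 _]; apply: continuousB; last exact: g_continuous.
  by apply: continuousM; [exact: cst_continuous|exact: g_continuous].
Qed.

(** The limit of [rec_J], whose boundary terms tend to [0] at both ends. It is an identity in
    [\bar R], available before finiteness is known. *)
Lemma ge0_gamma_rec a : 0 < a ->
  (\int[mu]_(t in `]0%R, +oo[) (g (a + 1) t)%:E = a%:E * \int[mu]_(t in `]0%R, +oo[) (g a t)%:E)%E.
Proof.
move=> a0.
have l1 : (\int[mu]_(t in J n) (g (a + 1) t)%:E + (g (a + 1) n.+1%:R)%:E @[n --> \oo] -->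
    \int[mu]_(t in `]0%R, +oo[) (g (a + 1) t)%:E)%E.
  rewrite -[X in _ --> X]adde0; apply: cvgeD; [by rewrite fin_num_adde_defl|exact: cvgJ|].
  apply: cvg_EFin; first by near=> n.
  have [C C0 H] := powR_le_expR a.
  apply: (@squeeze_cvgr _ _ _ _ (fun=> 0) (fun n => (2 * C) * n.+1%:R^-1)); last 2 first.
  - exact: cvg_cst.
  - by rewrite -[X in _ --> X](mulr0 (2 * C)); apply: cvgMr; exact: cvg_harmonic.
  near=> n; rewrite /= g_ge0/= /g addrK; apply: le_trans (H _ _) _; first by rewrite ler1n.
  have := expR_ge1Dx (n.+1%:R / 2 : R); rewrite expRN; set E := expR _ => hE.
  have n0 : 0 < n.+1%:R :> R by rewrite ltr0n.
  have E0 : 0 < E by exact: expR_gt0.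
  rewrite ler_pdivrMr// mulrAC ler_pdivlMr//.
  rewrite [2 * C]mulrC -mulrA ler_wpM2l ?(ltW C0)//.
  by move: hE; lra.
have l2 : (a%:E * \int[mu]_(t in J n) (g a t)%:E + (g (a + 1) n.+1%:R^-1)%:E @[n --> \oo] -->
    a%:E * \int[mu]_(t in `]0%R, +oo[) (g a t)%:E)%E.
  rewrite -[X in _ --> X]adde0; apply: cvgeD; [by rewrite fin_num_adde_defl| |].
    by apply: cvgeZl => //; exact: cvgJ.
  apply: cvg_EFin; first by near=> n.
  have ua : (n.+1%:R^-1 : R) `^ a @[n --> \oo] --> (0 : R).
    have /cvg_at_rightP := powR_cvg0 a0; apply; split; last exact: cvg_harmonic.
    by move=> n; rewrite invr_gt0.
  apply: (@squeeze_cvgr _ _ _ _ (fun=> 0) (fun n => n.+1%:R^-1 `^ a)); last 2 first.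
  - exact: cvg_cst.
  - exact: ua.
  near=> n; rewrite /= g_ge0/= /g addrK -[leRHS]mulr1 ler_wpM2l ?powR_ge0//.
apply: (cvg_unique _ l1); first exact: ereal_hausdorff.
by apply: cvg_trans l2; apply: near_eq_cvg; near=> n; rewrite rec_J.
Unshelve. all: by end_near.
Qed.

Let gamma_lty1 a : 1 <= a -> (\int[mu]_(t in `]0%R, +oo[) (g a t)%:E < +oo)%E.
Proof.
move=> a1; have [C C0 H] := powR_le_expR (a - 1).
have e0 : (\int[mu]_(t in `[0%R, +oo[) (expR (- (t / 2)))%:E = 2%:E)%E.
  have E s : 0 + - 2^-1 * s = - (s / 2) :> R by rewrite add0r mulNr mulrC.
  have dE t : is_derive t 1 (fun t => expR (- (t / 2))) (- 2^-1 * expR (- (t / 2))).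
    have d := is_derive1_affine (a := 0) (e := - (2^-1)) (s := t) (is_derive_expR _).
    by apply: (is_derive1_ext d) => [s|]; rewrite E.
  have dF t : is_derive t 1 (fun t => - 2 * expR (- (t / 2))) (expR (- (t / 2))).
    apply: (is_derive1_ext (is_deriveZ (- 2) (dE t))) => [//|]; rewrite /GRing.scale/=.
    by move: (expR _) => e; field.
  rewrite (@ge0_continuous_FTC2y _ _ (fun t => - 2 * expR (- (t / 2))) _ 0).
  - by rewrite mul0r oppr0 expR0 mulr1 -EFinB sub0r opprK.
  - by move=> x _; exact: expR_ge0.
  - by apply: continuous_in_subspaceT => x _; exact: is_derive1_continuous (dE x).
  - rewrite -[X in _ --> X](mulr0 (- 2)); apply: cvgMr.
    apply: (cvg_comp _ _ _ (@cvgr_expR R)).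
    by apply: gt0_cvgMly.
  - by move=> x _; have [] := dF x.
  - by apply: cvg_at_right_filter; exact: is_derive1_continuous (dF 0).
  - by move=> x _; rewrite derive1E; have [_ ->] := dF x.
apply: (@le_lt_trans _ _ (\int[mu]_(t in `[0%R, +oo[) ((C + expR 1)%:E * (expR (- (t / 2)))%:E)))%E.
  apply: ge0_le_integral_subset => t /=; rewrite !in_itv/= !andbT => t0.
  - by rewrite lee_fin g_ge0.
  - by rewrite -EFinM lee_fin mulr_ge0 ?expR_ge0// addr_ge0 ?expR_ge0// ltW.
  rewrite (ltW t0); split => //; rewrite -EFinM lee_fin mulrDl.
  have [t1|/ltW t1] := leP 1 t.
    by apply: le_trans (H _ t1) _; rewrite lerDl mulr_ge0 ?expR_ge0.
  rewrite ler_wpDl ?mulr_ge0 ?expR_ge0 ?(ltW C0)//.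
  rewrite -expRD; apply: (@le_trans _ _ 1).
    rewrite mulr_ile1 ?powR_ge0 ?expR_ge0//; last by rewrite -expR0 ler_expR oppr_le0 ltW.
    have := @ler_powR_base R t 1 (a - 1); rewrite powR1; apply; rewrite ?subr_ge0//.
    exact: ltW.
  by rewrite -[leLHS]expR0 ler_expR; move: t1; lra.
rewrite ge0_integralZl_EFin//.
- by rewrite e0 -EFinM ltry.
- apply/measurable_EFinP; apply: measurable_funTS; apply: (measurableT_comp (@measurable_expR R)).
  by apply: measurableT_comp => //; apply: measurable_funM.
- by rewrite addr_ge0 ?expR_ge0// ltW.
Qed.

(** The singularity at [0] for [a < 1] is not estimated: an infinite value at [a] would be infinite
    at [a + 1] by the recursion, where comparison with an exponential excludes it. *)
Lemma gamma_lty a : 0 < a -> (\int[mu]_(t in `]0%R, +oo[) (g a t)%:E < +oo)%E.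
Proof.
move=> a0; rewrite ltNge leye_eq; apply/negP => /eqP h.
have := @gamma_lty1 (a + 1); rewrite lerDr ltW// => /(_ isT).
by rewrite ge0_gamma_rec// h gt0_muley ?lte_fin// ltxx.
Qed.

Lemma Gamma_EFin a : 0 < a ->
  (\int[mu]_(t in `]0%R, +oo[) (t `^ (a - 1) * expR (- t))%:E = (Gamma a)%:E)%E.
Proof.
move=> a0; rewrite /Gamma /Rintegral fineK// ge0_fin_numE; first exact: gamma_lty.
by apply: integral_ge0 => t _; rewrite lee_fin g_ge0.
Qed.

Lemma Gamma_rec a : 0 < a -> Gamma (a + 1) = a * Gamma a.
Proof.
move=> a0; apply: EFin_inj; rewrite EFinM -!Gamma_EFin ?addr_gt0//.
exact: ge0_gamma_rec.
Qed.

Lemma Gamma_gt0 a : 0 < a -> 0 < Gamma a.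
Proof.
move=> a0; rewrite -lte_fin -Gamma_EFin//.
pose c : R := 2 `^ (- `|a - 1|) * expR (- 2).
apply: (@lt_le_trans _ _ (\int[mu]_(t in `[1%R, 2%R]) (cst c%:E t)))%E.
  rewrite integral_cst//= lebesgue_measure_itv/= lte_fin ltr1n -EFinB -EFinM lte_fin.
  by rewrite !mulr_gt0 ?powR_gt0 ?expR_gt0.
apply: ge0_le_integral_subset => t /=; rewrite in_itv/=.
- by move=> _; rewrite lee_fin mulr_ge0 ?powR_ge0 ?expR_ge0.
- by move=> _; rewrite lee_fin g_ge0.
move=> /andP[t1 t2]; split; first by rewrite in_itv/= andbT (lt_le_trans _ t1).
rewrite lee_fin ler_pM ?powR_ge0 ?expR_ge0//; last by rewrite ler_expR lerN2.
apply: (@le_trans _ _ (t `^ (- `|a - 1|))).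
  rewrite !powRN lef_pV2 ?posrE ?powR_gt0 ?(lt_le_trans _ t1)//.
  by apply: ler_powR_base => //; apply: le_trans t1.
by rewrite ler_powR// lerNl -normrN ler_norm.
Qed.

End gamma.

(** * The Bergman norm *)

Lemma disk2_set_open (R : realType) : open [set z : R * R | disk2 z.1 z.2].
Proof.
rewrite openE => -[x y] /= xy; rewrite /interior.
have [d d0 H] := disk2_open xy.
apply/nbhs_ballP; exists d => //= -[s t] [/=]; rewrite /ball/= => h1 h2.
by apply: H; rewrite distrC.
Qed.

Lemma disk_xyE (R : realType) : @disk_xy R = [set z | disk2 z.1 z.2].
Proof. by apply/seteqP; split => -[x y]; rewrite /disk_xy/= unit_diskE. Qed.

Lemma lambda_analytic_continuous (R : realType) (lam : R) (f : R[i] -> R[i]) :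
  lambda_analytic lam f -> forall v, disk2 v.1 v.2 ->
  {for v, continuous (Re_xy f)} /\ {for v, continuous (Im_xy f)}.
Proof.
move=> [[]]; rewrite disk_xyE => cR cI _ [x y] /= xy.
have [_ _ _ _ h1] := C2_on_partials (@disk2_open R) cR xy.
have [_ _ _ _ h2] := C2_on_partials (@disk2_open R) cI xy.
have e (G : R * R -> R) : (fun p => G (p.1, p.2)) = G by apply/funext => -[].
by move: h1 h2; rewrite !e.
Qed.

Lemma rnorm_sqrt (R : realType) (z : R[i]) : rnorm z = Num.sqrt (complex.Re z ^+ 2 + complex.Im z ^+ 2).
Proof. by case: z => a b; rewrite rnormE. Qed.

Lemma measurable_rnorm_xy (R : realType) (lam : R) (f : R[i] -> R[i]) :
  lambda_analytic lam f ->
  measurable_fun [set z : R * R | disk2 z.1 z.2] (fun z => rnorm (f (z.1 +i* z.2))).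
Proof.
move=> fan; have c := lambda_analytic_continuous fan.
have m1 : measurable_fun [set z : R * R | disk2 z.1 z.2] (Re_xy f).
  by apply: continuous2_measurable => [|z /c[]//]; exact: disk2_set_open.
have m2 : measurable_fun [set z : R * R | disk2 z.1 z.2] (Im_xy f).
  by apply: continuous2_measurable => [|z /c[]//]; exact: disk2_set_open.
rewrite (_ : (fun _ => _) = (fun z => Num.sqrt (Re_xy f z ^+ 2 + Im_xy f z ^+ 2))); last first.
  by apply/funext => z; rewrite rnorm_sqrt.
apply: (measurableT_comp (continuous_measurable_fun (@sqrt_continuous R))).
by apply: measurable_funD; apply: measurable_funX.
Qed.

Lemma c_lambda_gt0 (R : realType) (lam : R) : 0 <= lam -> 0 < c_lambda lam.
Proof.
by move=> l0; rewrite /c_lambda divr_gt0 ?mulr_gt0// Gamma_gt0// ?ltr_wpDl.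
Qed.

(** The amplitude is at most twice the sum of [|f|] at a point and at its conjugate, so its [p]-th
    power splits into two terms. Reflection turns both into integrals over the whole disk, which
    gives [C1 = 2 * 2 ^ p]. *)
Lemma half_disk_le_bergman (R : realType) (p lam : R) (w : R -> R) (c : R) :
  0 < p <= 1 -> 0 <= lam -> weight w -> 0 < c ->
  (forall r, 0 < r < 1 -> weight_tail w r <= c * ((1 - r) * w r)) ->
  exists2 C : R, 0 < C & forall f, lambda_analytic lam f ->
  (\int[(@lebesgue_measure R \x @lebesgue_measure R)%E]_(z in @half_disk R)
     (amp f z.1 z.2 `^ p * z.2 `^ (2 * lam) * tail_density (weight_tail w) z)%:E <=
   C%:E * \int[(@lebesgue_measure R \x @lebesgue_measure R)%E]_(v in @disk_xy R)
      (rnorm (f (v.1 +i* v.2)) `^ p * w (rnorm (v.1 +i* v.2))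
         * (c_lambda lam * `|v.2| `^ (2 * lam)))%:E)%E.
Proof.
move=> p01 l0 ww c0 tw; have [p0 p1] := andP p01.
have W0 := weight_tail_ge0 ww; have mW := weight_tail_nonincreasing ww.
have cl := c_lambda_gt0 l0.
pose C1 := 2 * 2 `^ p; have C10 : 0 < C1 by rewrite mulr_gt0 ?powR_gt0.
pose b := c_lambda lam / c; have b0 : 0 < b by rewrite divr_gt0.
exists (C1 / b) => [|f fan]; first by rewrite divr_gt0.
set mu := (_ \x _)%E.
pose D : set (R * R) := [set z | disk2 z.1 z.2].
(* Off the real axis the radius is positive, as the tail hypothesis, stated for [0 < r], demands. *)
pose P : set (R * R) := D `&` [set z | 0 < z.2 \/ z.2 < 0].
pose G z := rnorm (f (z.1 +i* z.2)) `^ p * `|z.2| `^ (2 * lam) * tail_density (weight_tail w) z.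
have G0 z : D z -> 0 <= G z.
  move=> /disk2_sqrt z1; rewrite /G !mulr_ge0 ?powR_ge0 ?W0 ?sqrtr_ge0//.
  by rewrite invr_ge0 subr_ge0 ltW.
have mD : measurable D by apply: open_measurable2; exact: disk2_set_open.
have mP : measurable P.
  apply: measurableI => //; rewrite [X in measurable X](_ : _ = [set z | 0 < z.2] `|` [set z | z.2 < 0]) //.
  have m2 : measurable_fun [set: R * R] (fun z => z.2) by exact: measurable_snd.
  apply: measurableU.
    rewrite [X in measurable X](_ : _ = (fun z : R * R => z.2) @^-1` `]0, +oo[); last first.
      by apply/seteqP; split => z /=; rewrite in_itv/= andbT.
    by rewrite -[X in measurable X]setTI; apply: m2 => //; exact: measurable_itv.
  rewrite [X in measurable X](_ : _ = (fun z : R * R => z.2) @^-1` `]-oo, 0[); last first.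
    by apply/seteqP; split => z /=; rewrite in_itv.
  by rewrite -[X in measurable X]setTI; apply: m2 => //; exact: measurable_itv.
have mG : measurable_fun D G.
  apply: measurable_funM; last by apply: measurable_tail_density.
  apply: measurable_funM.
    by apply: (measurableT_comp (measurable_powR p)); exact: measurable_rnorm_xy fan.
  apply: measurable_funTS; apply: (measurableT_comp (measurable_powR (2 * lam))).
  by apply: measurableT_comp.
pose h := (EFin \o G) \_ P.
have h0 z : (0 <= h z)%E.
  by rewrite /h patchE; case: ifPn => // /set_mem[/G0 Dz _]; rewrite lee_fin.
have mh : measurable_fun setT h.
  apply/(measurable_restrictT _ _).1 => //.
  by apply/measurable_EFinP; apply: measurable_funS mG => // z [].
(* The weight [w] appears only in this comparison; the reflection argument is carried out with the
   Borel function [h]. *)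
have hint : (b%:E * \int[mu]_z h z <= \int[mu]_(v in @disk_xy R)
      (rnorm (f (v.1 +i* v.2)) `^ p * w (rnorm (v.1 +i* v.2))
         * (c_lambda lam * `|v.2| `^ (2 * lam)))%:E)%E.
  rewrite -ge0_integralZl_EFin//; last by rewrite ltW.
  apply: (@le_trans _ _ (\int[mu]_(z in P) (b * G z)%:E)%E).
    rewrite [leRHS]integral_mkcond le_eqVlt; apply/orP; left; apply/eqP; apply: eq_integral => z _.
    by rewrite /h !patchE; case: ifPn => _; rewrite ?mule0// EFinM.
  have rE (z : R * R) : rnorm (z.1 +i* z.2) = Num.sqrt (z.1 ^+ 2 + z.2 ^+ 2) by exact: rnormE.
  have wp (z : R * R) : D z -> 0 < w (rnorm (z.1 +i* z.2)).
    by move=> /disk2_sqrt z1; apply: (proj1 ww); rewrite rnorm_ge0 rE.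
  rewrite disk_xyE; apply: ge0_le_integral_subset => z.
  - by move=> [/G0 Dz _]; rewrite lee_fin mulr_ge0// ltW.
  - move=> Dz; rewrite lee_fin; have := wp _ Dz => w0.
    by do 2 apply: mulr_ge0; rewrite ?powR_ge0 ?(ltW w0) ?(ltW cl)//; apply: mulr_ge0; rewrite ?powR_ge0 ?(ltW w0) ?(ltW cl).
  move=> [Dz z2]; split => //; rewrite lee_fin /G.
  have s1 := (disk2_sqrt _ _).1 Dz; set s := Num.sqrt _ in s1.
  have s0 : 0 < s.
    rewrite sqrtr_gt0 ltr_wpDl ?sqr_ge0// exprn_even_gt0//=.
    by case: z2 => /= [/gt_eqF->|/lt_eqF->].
  have hw := tw s; rewrite s0 s1 in hw; have {}hw := hw isT.
  rewrite rE -/s /tail_density -/s.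
  have ts : weight_tail w s / (1 - s) <= c * w s.
    by rewrite ler_pdivrMr ?subr_gt0// -mulrA [w s * _]mulrC.
  have q0 : 0 <= rnorm (f (z.1 +i* z.2)) `^ p * `|z.2| `^ (2 * lam) * b.
    by apply: mulr_ge0; [rewrite mulr_ge0 ?powR_ge0|exact: ltW].
  have := ler_wpM2l q0 ts; rewrite /b => H; apply: le_trans (le_trans H _).
    by rewrite le_eqVlt; apply/orP; left; apply/eqP; ring.
  by rewrite le_eqVlt; apply/orP; left; apply/eqP; field; rewrite gt_eqF.
apply: (@le_trans _ _ ((C1)%:E * \int[mu]_z h z)%E); last first.
  rewrite [(C1 / b)%:E]EFinM -muleA; apply: lee_wpmul2l; first by rewrite lee_fin ltW.
  by rewrite lee_pdivlMl.
have -> : (C1%:E * \int[mu]_z h z = \int[mu]_z ((2 `^ p)%:E * (h z + h (z.1, (- z.2)%R))))%E.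
  have mh' : measurable_fun setT (fun z : R * R => h (z.1, (- z.2)%R)).
    apply: (measurableT_comp mh); apply: measurable_fun_pair => //.
    by apply: measurableT_comp.
  rewrite ge0_integralZl_EFin ?powR_ge0//; last 2 first.
  - by move=> z _; rewrite adde_ge0.
  - exact: emeasurable_funD.
  rewrite ge0_integralD// (integral2_oppr mh h0) /C1 EFinM.
  by rewrite muleAC muleC; congr (_ * _)%E; rewrite -mule2n mule_natl.
apply: ge0_le_integral_subset => [z [/disk2_sqrt z1 _]|z _|z].
- rewrite lee_fin !mulr_ge0 ?powR_ge0 ?W0 ?sqrtr_ge0//.
  by rewrite invr_ge0 subr_ge0 ltW.
- by rewrite mule_ge0 ?lee_fin ?powR_ge0// adde_ge0.
move=> [Dz z2]; split => //.
have -> : h z = (G z)%:E by rewrite /h patchE mem_set//; split => //; left.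
have -> : h (z.1, - z.2) = (G (z.1, - z.2))%:E.
  rewrite /h patchE mem_set//; split; first exact: (disk2N Dz).
  by right => /=; rewrite oppr_lt0.
rewrite -EFinD -EFinM lee_fin /G /= normrN gtr0_norm//.
have -> : tail_density (weight_tail w) (z.1, - z.2) = tail_density (weight_tail w) z.
  by rewrite /tail_density /= sqrrN.
have T0 : 0 <= tail_density (weight_tail w) z.
  have /disk2_sqrt z1 := Dz.
  by rewrite /tail_density divr_ge0 ?W0 ?sqrtr_ge0// subr_ge0 ltW.
move: (tail_density _ z) T0 => T T0.
rewrite -!mulrDl !mulrA ler_wpM2r// ler_wpM2r ?powR_ge0//.
apply: (@le_trans _ _ ((2 * (rnorm (f (z.1 +i* z.2)) + rnorm (f (z.1 -i* z.2)))) `^ p)).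
  by apply: ler_powR_base; [exact: ltW|exact: amp_ge0|exact: amp_le_rnorm].
rewrite powRM ?addr_ge0 ?rnorm_ge0// ler_wpM2l ?powR_ge0//.
by apply: powR_subadd; rewrite ?rnorm_ge0.
Qed.

Lemma bergman_polar_estimate (R : realType) (p lam alpha c : R) (w : R -> R) :
  0 < p <= 1 -> 0 <= lam -> weight w -> 0 < c ->
  (forall r, 0 < r < 1 -> weight_tail w r <= c * ((1 - r) * w r)) ->
  exists2 C : R, 0 < C & forall f, lambda_analytic lam f -> forall Y : R * R -> R,
  (forall z, polar_rect z -> 0 <= Y z <= 2 * (1 - z.1) + 2 * (z.1 * sin z.2)) ->
  (\int[(@lebesgue_measure R \x @lebesgue_measure R)%E]_(z in @polar_rect R)
     (amp f (z.1 * cos z.2) (z.1 * sin z.2) *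
      (Y z `^ (2 * lam * (1 - p)) / (1 - z.1) `^ ((alpha + 2) * p - 1)
        * weight_tail w (Num.sqrt z.1)) `^ p^-1 *
      polar_weight (2 * lam) alpha z)%:E <= C%:E * bergman_norm p lam w f)%E.
Proof.
move=> p01 l0 ww c0 tw; have [p0 p1] := andP p01.
have K0 : 0 < 16 * (3 + 10 * lam) by rewrite mulr_gt0// ltr_pwDl// mulr_ge0.
have k0 : 0 <= 2 * lam by rewrite mulr_ge0.
have [C1 C10 H1] := polar_estimate alpha K0 p01 k0 (weight_tail_nonincreasing ww)
  (weight_tail_ge0 ww) (weight_tail_gt0 ww).
have [C2 C20 H2] := half_disk_le_bergman p01 l0 ww c0 tw.
exists (C1 * C2 `^ p^-1) => [|f fan Y hY]; first by rewrite mulr_gt0// powR_gt0.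
have := H1 _ (amp_ge0 f) (amp_slowly_varying fan l0) (@amp_continuous _ _ _ fan) Y hY.
move=> /le_trans; apply; rewrite EFinM -muleA; apply: lee_wpmul2l; first by rewrite lee_fin ltW.
rewrite -poweR_EFin /bergman_norm.
set B := (X in (_ <= _ * X `^ _)%E); have B0 : (0 <= B)%E.
  apply: integral_ge0 => z; rewrite disk_xyE => /disk2_sqrt z1.
  rewrite lee_fin; apply: mulr_ge0; apply: mulr_ge0; rewrite ?powR_ge0//.
    by apply: ltW; apply: (proj1 ww); rewrite rnorm_ge0 rnormE.
  exact/ltW/c_lambda_gt0.
rewrite -poweRM ?lee_fin ?(ltW C20)//.
apply: gt0_ler_poweR; rewrite ?invr_ge0 ?(ltW p0) ?in_itv/= ?leey ?andbT//.
- apply: integral_ge0 => z [/disk2_sqrt z1 _]; rewrite lee_fin.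
  rewrite !mulr_ge0 ?powR_ge0 ?(weight_tail_ge0 ww) ?sqrtr_ge0//.
  by rewrite invr_ge0 subr_ge0 ltW.
- by rewrite mule_ge0// lee_fin ltW.
- exact: H2.
Qed.

(** * The functions phi_n in polar form *)

Lemma pochhammer0 (R : realType) (a : R) : pochhammer a 0 = 1.
Proof. by rewrite /pochhammer big_ord0. Qed.

Lemma pochhammerS (R : realType) (a : R) n : pochhammer a n.+1 = pochhammer a n * (a + n%:R).
Proof. by rewrite /pochhammer big_ord_recr. Qed.

Lemma pochhammerSl (R : realType) (a : R) n : pochhammer a n.+1 = a * pochhammer (a + 1) n.
Proof.
rewrite /pochhammer big_ord_recl addr0; congr (_ * _); apply: eq_bigr => i _.
by rewrite lift0 -natr1 addrAC addrA.
Qed.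

Lemma pochhammer_gt0 (R : realType) (a : R) n : 0 < a -> 0 < pochhammer a n.
Proof. by move=> a0; apply: prodr_gt0 => i _; rewrite ltr_wpDr. Qed.

Section phi_recursion.
Variables (R : realType) (lam : R).
Implicit Types z : R[i].

(** The value [0] for [j > n] lets the recursion in [n] cover the new index [j = n + 1]. *)
Definition phi_coef (n j : nat) : R :=
  if (j <= n)%N then pochhammer lam j * pochhammer (lam + 1) (n - j) / (j`!%:R * (n - j)`!%:R)
  else 0.

Definition phi_poly (n : nat) z : R[i] :=
  \sum_(j < n.+1) (phi_coef n j)%:C * (z^*)%C ^+ j * z ^+ (n - j).

Definition phi_norm (n : nat) : R := Num.sqrt (n`!%:R / pochhammer (2 * lam + 1) n).

Lemma phiE n z : phi lam n z = (phi_norm n)%:C * phi_poly n z.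
Proof.
rewrite /phi /phi_norm /phi_poly; congr (_ * _); apply: eq_bigr => j _.
by rewrite /phi_coef -ltnS ltn_ord.
Qed.

Lemma phi_coef_rec n j : 0 <= lam -> (j <= n.+1)%N ->
  n.+1%:R * phi_coef n.+1 j = (n.+1%:R + lam) * phi_coef n j
    + lam * (if j is j'.+1 then phi_coef n (n - j') else 0).
Proof.
move=> l0; rewrite leq_eqVlt => /orP[/eqP->|].
  rewrite /phi_coef leqnn ltnn subnn leq_subr subKn// !pochhammer0 !fact0.
  rewrite pochhammerSl mulr1 mulr0 add0r factS natrM subnn.
  rewrite pochhammer0 fact0.
  by field; rewrite !nat1r !pnatr_eq0 -!lt0n fact_gt0.
rewrite ltnS => jn; rewrite /phi_coef jn leqW// subSn// pochhammerS factS natrM.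
have f0 m : (m`!%:R : R) != 0 by rewrite pnatr_eq0 -lt0n fact_gt0.
have s0 m : 1 + (m%:R : R) != 0 by rewrite nat1r pnatr_eq0.
case: j jn => [|j] jn.
  rewrite mulr0 addr0 !subn0 pochhammer0 fact0 -[(n.+1)%:R]natr1.
  by field; rewrite f0 addrC s0.
rewrite leq_subr subKn 1?ltnW//.
have [m mE] : exists m, (n - j = m.+1)%N by exists (n - j.+1)%N; rewrite -subSn.
have -> : (n - j.+1 = m)%N by rewrite -[m]/(m.+1.-1) -mE subnS.
have -> : n = (j + m.+1)%N by rewrite -mE subnKC// ltnW.
rewrite addKn !pochhammerSl !factS !natrM -!natr1 natrD -natr1.
by field; rewrite !f0 ![_%:R + 1]addrC !s0.
Qed.

Lemma phi_poly0 z : phi_poly 0 z = 1.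
Proof.
rewrite /phi_poly big_ord1 /phi_coef leqnn subnn !pochhammer0 !fact0 !mulr1 divr1.
by [].
Qed.

(** The second product is the conjugate of [z * phi_poly n z]. So a step multiplies the real part of
    [z * phi_poly n z] by [(n + 1 + 2 * lam) / (n + 1)] and keeps its imaginary part. The polar form
    and the growth bound both follow by induction. *)
Lemma phi_polyS n z : 0 <= lam ->
  (n.+1%:R)%:C * phi_poly n.+1 z = (n.+1%:R + lam)%:C * (z * phi_poly n z)
    + lam%:C * ((z^*)%C * ((phi_poly n z)^*)%C).
Proof.
move=> l0.
have E1 : z * phi_poly n z = \sum_(j < n.+2) (phi_coef n j)%:C * (z^*)%C ^+ j * z ^+ (n.+1 - j).
  rewrite big_ord_recr/= {2}/phi_coef ltnn !mul0r addr0 mulr_sumr; apply: eq_bigr => j _.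
  by rewrite mulrCA -exprS -subSn// -ltnS.
have E2 : (z^*)%C * ((phi_poly n z)^*)%C = \sum_(j < n.+2)
    (if nat_of_ord j is j'.+1 then phi_coef n (n - j') else 0)%:C * (z^*)%C ^+ j * z ^+ (n.+1 - j).
  rewrite big_ord_recl/= !mul0r add0r rmorph_sum mulr_sumr.
  rewrite (reindex_inj rev_ord_inj)/=; apply: eq_bigr => j _.
  have jn : (j <= n)%N by rewrite -ltnS.
  rewrite !rmorphM/= !rmorphXn/= subSS subKn// conjcK.
  have -> : phi_coef n (n - j) -i* 0 = (phi_coef n (n - j))%:C by rewrite oppr0.
  by rewrite /bump/= add0n add1n exprS; ring.
rewrite E1 E2 /phi_poly !mulr_sumr -big_split; apply: eq_bigr => j _ /=.
have jn : (j <= n.+1)%N by rewrite -ltnS.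
move: (phi_coef_rec l0 jn); move: (phi_coef n.+1 j) (phi_coef n j) => a b.
move: (match nat_of_ord j with 0%N => 0 | _ => _ end) => c h.
have hc : (n.+1%:R)%:C * a%:C = (n.+1%:R + lam)%:C * b%:C + lam%:C * c%:C :> R[i].
  by rewrite -!(rmorphM (real_complex R)) -(rmorphD (real_complex R)) h.
by rewrite !mulrA hc !mulrDl.
Qed.

End phi_recursion.

Lemma phi_polyJ (R : realType) (lam : R) n (z : R[i]) :
  phi_poly lam n (z^*)%C = ((phi_poly lam n z)^*)%C.
Proof.
rewrite /phi_poly rmorph_sum; apply: eq_bigr => j _.
by rewrite !rmorphM/= !rmorphXn/= oppr0.
Qed.

Lemma phi_norm_gt0 (R : realType) (lam : R) n : 0 <= lam -> 0 < phi_norm lam n.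
Proof.
move=> l0; rewrite sqrtr_gt0 divr_gt0 ?ltr0n ?fact_gt0// pochhammer_gt0//.
by rewrite ltr_wpDl// mulr_ge0.
Qed.

Lemma phi_norm_sqrS (R : realType) (lam : R) n : 0 <= lam ->
  phi_norm lam n.+1 ^+ 2 * (2 * lam + n.+1%:R) = phi_norm lam n ^+ 2 * n.+1%:R.
Proof.
move=> l0; have a0 : 0 < 2 * lam + 1 by rewrite ltr_wpDl// mulr_ge0.
have p0 m := pochhammer_gt0 m a0.
rewrite /phi_norm !sqr_sqrtr; try by rewrite divr_ge0// ltW.
rewrite pochhammerS factS natrM -natr1 -addrA [1 + _]addrC.
by field; rewrite gt_eqF ?p0//= gt_eqF// ltr_wpDl ?mulr_ge0// ltr_wpDl.
Qed.

(* On the circle |z| = t, phi_poly n is t^n (U_n + i V_n), with U_n and V_n the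
   following trigonometric polynomials in the angle. *)
Fixpoint phi_cos (R : realType) (lam : R) (n : nat) (th : R) : R :=
  if n is m.+1 then (2 * lam + n%:R) / n%:R * (cos th * phi_cos lam m th - sin th * phi_sin lam m th)
  else 1
with phi_sin (R : realType) (lam : R) (n : nat) (th : R) : R :=
  if n is m.+1 then sin th * phi_cos lam m th + cos th * phi_sin lam m th else 0.

Lemma phi_poly_polar (R : realType) (lam : R) n (t th : R) : 0 <= lam ->
  phi_poly lam n ((t * cos th) +i* (t * sin th)) =
  (t ^+ n * phi_cos lam n th) +i* (t ^+ n * phi_sin lam n th).
Proof.
move=> l0; elim: n => [|n IH]; first by rewrite phi_poly0 /= !expr0 !mulr1 mulr0.
have n0 : (n.+1%:R)%:C != 0 :> R[i] by rewrite eq_complex/= pnatr_eq0.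
apply: (mulfI n0); rewrite phi_polyS// IH; apply/eqP; rewrite eq_complex /=.
have n1 : 1 + n%:R != 0 :> R by rewrite nat1r pnatr_eq0.
by apply/andP; split; apply/eqP; rewrite exprS; field.
Qed.

Lemma rnormZ (R : realType) (X : normedModType R[i]) (a : R[i]) (x : X) :
  rnorm (a *: x) = rnorm a * rnorm x.
Proof. by apply: (@complexI R); rewrite rmorphM/= !rnormK normrZ. Qed.

Lemma rnormM (R : realType) (x y : R[i]) : rnorm (x * y) = rnorm x * rnorm y.
Proof. by apply: (@complexI R); rewrite rmorphM/= !rnormK normrM. Qed.

Lemma rnorm_real (R : realType) (a : R) : 0 <= a -> rnorm (a%:C) = a.
Proof. by move=> a0; rewrite rnormE expr0n addr0 sqrtr_sqr ger0_norm. Qed.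

Lemma rnormJ (R : realType) (z : R[i]) : rnorm (z^*)%C = rnorm z.
Proof. by case: z => a b; rewrite !rnormE sqrrN. Qed.

(** Each step of the recursion multiplies the modulus by at most
    [|z| * (2 * lam + n + 1) / (n + 1)], and the second factor is the quotient of consecutive values
    of [phi_norm ^+ 2]. *)
Lemma rnorm_phi_poly_le (R : realType) (lam : R) n (z : R[i]) : 0 <= lam ->
  rnorm (phi_poly lam n z) * phi_norm lam n ^+ 2 <= rnorm z ^+ n.
Proof.
move=> l0; elim: n => [|n IH].
  rewrite phi_poly0 expr0 /phi_norm pochhammer0 fact0 divr1 sqrtr1 expr1n mulr1.
  by rewrite -[1]/(1%:C) rnorm_real.
have n1 : 0 < n.+1%:R :> R by rewrite ltr0n.
have a0 : 0 < 2 * lam + n.+1%:R by rewrite ltr_wpDl// mulr_ge0.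
rewrite -(ler_pM2r a0) -mulrA phi_norm_sqrS// mulrA [_ * n.+1%:R]mulrC mulrA.
have -> : n.+1%:R * rnorm (phi_poly lam n.+1 z) = rnorm ((n.+1%:R)%:C * phi_poly lam n.+1 z).
  by rewrite rnormM rnorm_real.
rewrite phi_polyS// exprS.
have h : rnorm ((n.+1%:R + lam)%:C * (z * phi_poly lam n z) + lam%:C * ((z^*)%C * ((phi_poly lam n z)^*)%C))
    <= (2 * lam + n.+1%:R) * (rnorm z * rnorm (phi_poly lam n z)).
  apply: le_trans (rnormD _ _) _; rewrite !rnormM !rnormJ !rnorm_real ?addr_ge0//.
  by rewrite le_eqVlt; apply/orP; left; apply/eqP; ring.
apply: le_trans (ler_wpM2r (sqr_ge0 _) h) _.
have := ler_wpM2l (ltW a0) (ler_wpM2l (rnorm_ge0 z) IH); rewrite -exprS [leRHS]mulrC.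
by move/(le_trans _); apply; rewrite le_eqVlt; apply/orP; left; apply/eqP; ring.
Qed.

Lemma rnorm_phi_le (R : realType) (lam : R) n (z : R[i]) : 0 <= lam ->
  rnorm (phi lam n z) <= rnorm z ^+ n / phi_norm lam n.
Proof.
move=> l0; have e0 := phi_norm_gt0 n l0.
rewrite phiE rnormM rnorm_real ?(ltW e0)// ler_pdivlMr//.
by apply: le_trans (rnorm_phi_poly_le n z l0); rewrite mulrAC [leRHS]mulrC expr2.
Qed.

(** * Orthogonality on circles *)

Lemma bounded_integrable d (T : measurableType d) (R : realType)
    (mu : {measure set T -> \bar R}) (A : set T) (f : T -> R) (M : R) :
  measurable A -> (mu A < +oo)%E -> measurable_fun A f -> (forall x, A x -> `|f x| <= M) ->
  mu.-integrable A (EFin \o f).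
Proof.
move=> mA Afin mf fM; apply: measurable_bounded_integrable => //.
exists M; split; first exact: num_real.
by move=> N MN x Ax; apply: le_trans (fM _ Ax) (ltW MN).
Qed.

(** Powers such as [sin th ^ (2 * lam)] need not be differentiable at the end points, so only
    one-sided limits of [F] are assumed there. [F] minus the indefinite integral of [f] has zero
    derivative inside, hence is constant, and the limits at both ends are compared. *)
Lemma FTC_open (R : realType) (F f : R -> R) (a b A B : R) : a < b ->
  (@lebesgue_measure R).-integrable `[a, b] (EFin \o f) ->
  (forall x, a < x < b -> is_derive x 1 F (f x)) ->
  (forall x, a < x < b -> {for x, continuous f}) ->
  F x @[x --> a^'+] --> A -> F x @[x --> b^'-] --> B ->
  \int[@lebesgue_measure R]_(x in `[a, b]) f x = B - A.
Proof.
move=> ab fi dF cf FA FB.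
pose G x := \int[@lebesgue_measure R]_(t in `[a, x]) f t.
have cG : {within `[a, b], continuous G}.
  by apply: (@parameterized_integral_continuous R a b f) => //; exact: ltW.
have Ga : G x @[x --> a^'+] --> (0 : R).
  have [_ h _] := (continuous_within_itvP _ ab).1 cG.
  by move: h; rewrite {2}/G set_itv1 Rintegral_set1.
have Gb : G x @[x --> b^'-] --> G b by have [] := (continuous_within_itvP _ ab).1 cG.
have dG x : a < x < b -> is_derive x 1 G (f x).
  move=> /andP[ax xb].
  have [d <-] := @continuous_FTC1_closed R f a x b xb fi ax (cf x (introT andP (conj ax xb))).
  by rewrite derive1E; exact: derivableP.
pose c0 := (a + b) / 2.
have c0ab : a < c0 < b by rewrite /c0; move: ab; clear; lra.
have const x : a < x < b -> F x - G x = F c0 - G c0.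
  move=> /andP[ax xb]; apply/eqP; rewrite -subr_eq0 -normr_le0.
  have := @MVT_norm_le R (fun x => F x - G x) (fun=> 0) c0 x 0; rewrite mul0r; apply.
  move=> y yx; rewrite normr0; split => //.
  have yab : a < y < b by move: c0ab yx ax xb; clear; lra.
  by apply: (is_derive1_ext (is_deriveB (dF y yab) (dG y yab))) => [//|]; rewrite subrr.
have l1 : F c0 - G c0 = A - 0.
  have h : (F x - G x) @[x --> a^'+] --> A - 0 by exact: cvgB.
  apply: (cvg_unique _ _ h) => //.
  apply: cvg_near_cst; near=> x.
  rewrite const//; apply/andP; split; near: x; [exact: nbhs_right_gt|exact: nbhs_right_lt].
have l2 : F c0 - G c0 = B - G b.
  have h : (F x - G x) @[x --> b^'-] --> B - G b by exact: cvgB.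
  apply: (cvg_unique _ _ h) => //.
  apply: cvg_near_cst; near=> x.
  rewrite const//; apply/andP; split; near: x; [exact: nbhs_left_gt|exact: nbhs_left_lt].
by move: l1 l2; rewrite /G; clear; lra.
Unshelve. all: by end_near. Qed.

Lemma sin_powR_le1 (R : realType) (k th : R) : 0 <= k -> sin th `^ k <= 1.
Proof.
move=> k0; have [s0|s0] := leP 0 (sin th).
  by have := @ler_powR_base R (sin th) 1 k; rewrite powR1; apply => //; exact: sin_le1.
have [->|k1] := eqVneq k 0; first by rewrite powRr0.
(* For a negative base [ln] takes the default value [0], so the power is [1]. *)
by rewrite /powR (lt_eqF s0) (ln0 (ltW s0)) mulr0 expR0.
Qed.

Section circle.
Variables (R : realType) (lam : R).
Hypothesis lam_ge0 : 0 <= lam.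
Let U := @phi_cos R lam.
Let V := @phi_sin R lam.
Let w (th : R) : R := sin th `^ (2 * lam).
Let mu := @lebesgue_measure R.

Lemma phi_cos_sin_continuous n :
  continuous (phi_cos lam n) /\ continuous (phi_sin lam n).
Proof.
elim: n => [|n [cU cV]]; first by split; exact: cst_continuous.
have cc := @continuous_cos R; have cs := @continuous_sin R.
split => x; rewrite /=.
  apply: cvgM; first exact: cvg_cst.
  by apply: cvgB; apply: cvgM; (exact: cc || exact: cs || exact: cU || exact: cV).
by apply: cvgD; apply: cvgM; (exact: cc || exact: cs || exact: cU || exact: cV).
Qed.

Let UV_bounded n : exists M, forall th, `|U n th| <= M /\ `|V n th| <= M.
Proof.
elim: n => [|n [M IH]]; first by exists 1 => th; rewrite normr1 normr0.
pose g := (2 * lam + n.+1%:R) / n.+1%:R.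
have g1 : 1 <= g by rewrite /g ler_pdivlMr ?ltr0n// mul1r lerDr mulr_ge0.
have M0 : 0 <= M by have [/(le_trans (normr_ge0 _))] := IH 0.
exists (g * (2 * M)) => th; have [h1 h2] := IH th.
have [c1 s1] := (cos_max th, sin_max th).
have e (x y u v : R) : `|x| <= 1 -> `|y| <= 1 -> `|u| <= M -> `|v| <= M -> `|x * u + y * v| <= 2 * M.
  move=> x1 y1 uM vM; apply: le_trans (ler_normD _ _) _; rewrite !normrM mulr_natl mulr2n.
  by apply: lerD; rewrite -[M]mul1r; apply: ler_pM.
split; rewrite /U /V/=.
  rewrite normrM ger0_norm -/g; last by apply: le_trans g1.
  rewrite ler_wpM2l ?(le_trans _ g1)// -mulNr; apply: e => //; by rewrite normrN.
apply: le_trans (e _ _ _ _ s1 c1 h1 h2) _.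
by rewrite -[leLHS]mul1r ler_wpM2r// mulr_ge0.
Qed.

(** The Cauchy-Riemann system of [t ^+ n * (U n + i V n)] in polar form. *)
Let UV_derive n th : sin th != 0 ->
  is_derive th 1 (U n) (- (n%:R + 2 * lam) * V n th) /\
  is_derive th 1 (V n) (n%:R * U n th - 2 * lam * (cos th / sin th) * V n th).
Proof.
move=> s0; have dc := is_derive_cos th; have ds := is_derive_sin th.
have cs := cos2Dsin2 th.
elim: n => [|n [dU dV]].
  split; [apply: (is_derive1_ext (is_derive_cst (1 : R) th 1)) => //|
          apply: (is_derive1_ext (is_derive_cst (0 : R) th 1)) => //]; rewrite /U /V/=; ring.
have n1 : 1 + n%:R != 0 :> R by rewrite nat1r pnatr_eq0.
split.
  apply: (is_derive1_ext (is_deriveZ ((2 * lam + n.+1%:R) / n.+1%:R)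
    (is_deriveB (is_deriveM dc dU) (is_deriveM ds dV)))) => //.
  rewrite /U /V /GRing.scale/= -/(U n th) -/(V n th).
  by field; rewrite n1 s0.
apply: (is_derive1_ext (is_deriveD (is_deriveM ds dU) (is_deriveM dc dV))) => //.
rewrite /U /V /GRing.scale/= -/(U n th) -/(V n th).
by field; rewrite s0.
Qed.

Let w_bounded th : `|w th| <= 1.
Proof. by rewrite ger0_norm ?powR_ge0// sin_powR_le1// mulr_ge0. Qed.

Let w_measurable : measurable_fun setT w.
Proof.
apply: (measurableT_comp (measurable_powR _)).
by apply: continuous_measurable_fun; exact: continuous_sin.
Qed.

Let circle_integrable (g : R -> R) : continuous g -> (exists M, forall th, `|g th| <= M) ->
  mu.-integrable `[0, pi] (EFin \o (fun th => g th * w th)).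
Proof.
move=> cg [M gM]; apply: (@bounded_integrable _ _ _ _ _ _ M).
- exact: measurable_itv.
- by rewrite [X in (X < _)%E]lebesgue_measure_itv/= lte_fin pi_gt0 -EFinB ltry.
- apply: measurable_funM; last exact: measurable_funTS.
  by apply: measurable_funTS; exact: continuous_measurable_fun.
- move=> th _; rewrite normrM -[M]mulr1; apply: ler_pM => //; exact: w_bounded.
Qed.

Let prodc (f g : R -> R) : continuous f -> continuous g -> continuous (fun th => f th * g th).
Proof. by move=> cf cg x; apply: cvgM; [exact: cf|exact: cg]. Qed.

Let prodb (f g : R -> R) : (exists M, forall th, `|f th| <= M) -> (exists M, forall th, `|g th| <= M) ->
  exists M, forall th, `|f th * g th| <= M.
Proof.
move=> [M fM] [N gN]; exists (M * N) => th; rewrite normrM; exact: ler_pM.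
Qed.

Let Ub n : exists M, forall th, `|U n th| <= M.
Proof. by have [M h] := UV_bounded n; exists M => th; have [] := h th. Qed.

Let Vb n : exists M, forall th, `|V n th| <= M.
Proof. by have [M h] := UV_bounded n; exists M => th; have [] := h th. Qed.

Let cU n := (phi_cos_sin_continuous n).1.
Let cV n := (phi_cos_sin_continuous n).2.

Let iUU m n : mu.-integrable `[0, pi] (EFin \o (fun th => U m th * U n th * w th)).
Proof. by apply: circle_integrable; [exact: prodc|exact: prodb]. Qed.

Let iVV m n : mu.-integrable `[0, pi] (EFin \o (fun th => V m th * V n th * w th)).
Proof. by apply: circle_integrable; [exact: prodc|exact: prodb]. Qed.

Let a m n : R := \int[mu]_(th in `[0, pi]) (U m th * U n th * w th).
Let b m n : R := \int[mu]_(th in `[0, pi]) (V m th * V n th * w th).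

Let iZ (c : R) (f : R -> R) : mu.-integrable `[0, pi] (EFin \o f) ->
  mu.-integrable `[0, pi] (EFin \o (fun th => c * f th)).
Proof.
move=> h; change (mu.-integrable `[0, pi] (fun th => (c%:E * (EFin \o f) th)%E)).
by apply: integrableZl => //; exact: measurable_itv.
Qed.

Let iB (f g : R -> R) : mu.-integrable `[0, pi] (EFin \o f) -> mu.-integrable `[0, pi] (EFin \o g) ->
  mu.-integrable `[0, pi] (EFin \o (fun th => f th - g th)).
Proof.
move=> hf hg; change (mu.-integrable `[0, pi] (fun th => ((EFin \o f) th - (EFin \o g) th)%E)).
by apply: integrableB => //; exact: measurable_itv.
Qed.

Let w_derive x : 0 < x < pi -> is_derive x 1 w (2 * lam * (cos x / sin x) * w x).
Proof.
move=> x0; have s0 : 0 < sin x by rewrite sin_gt0_pi.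
apply: (is_derive1_ext (is_derive1_comp (is_derive1_powR (2 * lam) s0) (is_derive_sin x))) => //.
have -> : w x = sin x `^ (2 * lam - 1) * sin x.
  by rewrite -[X in _ = _ * X]powRr1 ?ltW// -gt0_powRD// subrK.
by rewrite /GRing.scale/=; move: (_ `^ _) => q; field; rewrite gt_eqF.
Qed.

Let V_ends n : V n 0 = 0 /\ V n pi = 0.
Proof.
elim: n => [//|n [h1 h2]]; rewrite /V/= sin0 sinpi cospi !mul0r !add0r.
by rewrite -/(V n 0) -/(V n pi) h1 h2 !mulr0.
Qed.

(* Integrate the derivative of [V m * U n * w], which vanishes at both ends. *)
Let ab_rel m n : m%:R * a m n = (n%:R + 2 * lam) * b m n.
Proof.
have p0 := pi_gt0 R.
have F0 (c : R) (Fl : set_system R) : Filter Fl -> V m c = 0 -> Fl --> c ->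
    (V m x * U n x * w x) @[x --> Fl] --> (0 : R).
  move=> FF Vc Flc; have [M UM] := Ub n.
  have M0 : 0 <= M by apply: le_trans (UM 0).
  apply: norm_cvg0; apply: (@squeeze_cvgr _ _ _ _ (fun=> 0) (fun x => `|V m x| * M)).
  - near=> x; rewrite normr_ge0/= normrM -[leRHS]mulr1 normrM.
    by rewrite ler_pM ?mulr_ge0 ?w_bounded ?ler_wpM2l.
  - exact: cvg_cst.
  - rewrite -[X in _ --> X](mul0r M); apply: cvgM; last exact: cvg_cst.
    rewrite -(normr0 R) -Vc; apply: cvg_norm; apply: (cvg_comp _ _ Flc); exact: cV.
have [V0 Vpi] := V_ends m.
have := @FTC_open R (fun th => V m th * U n th * w th)
  (fun th => m%:R * (U m th * U n th * w th) - (n%:R + 2 * lam) * (V m th * V n th * w th)) 0 pi 0 0 p0.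
rewrite subrr RintegralB; first last.
- exact: iZ.
- exact: iZ.
- exact: measurable_itv.
rewrite !RintegralZl//; try exact: measurable_itv.
rewrite -/(a m n) -/(b m n) => H; apply/eqP; rewrite -subr_eq0; apply/eqP; apply: H.
- by apply: iB; exact: iZ.
- move=> x /andP[x0 xp].
  have s0 : 0 < sin x by rewrite sin_gt0_pi// x0.
  have [dU _] := UV_derive n (lt0r_neq0 s0); have [_ dV] := UV_derive m (lt0r_neq0 s0).
  have dw := w_derive (introT andP (conj x0 xp)).
  apply: (is_derive1_ext (is_deriveM (is_deriveM dV dU) dw)) => [//|].
  rewrite /GRing.scale/= -[(V m * U n) x]/(V m x * U n x).
  by field; rewrite gt_eqF.
- move=> x xp; have cw := is_derive1_continuous (w_derive xp).
  by apply: cvgB; apply: cvgM; try exact: cvg_cst; apply: cvgM => //; apply: cvgM;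
    (exact: cU || exact: cV).
- by apply: (F0 0 _ _ V0); exact: cvg_within.
- by apply: (F0 pi _ _ Vpi); exact: cvg_within.
Unshelve. all: by end_near. Qed.

(** The real part of [phi_poly m] times the conjugate of [phi_poly n] on the upper unit half circle.
    Conjugate points contribute opposite imaginary parts, so nothing else is needed for the full
    circle. *)
Definition angular (m n : nat) : R :=
  \int[@lebesgue_measure R]_(th in `[0, pi])
    ((phi_cos lam m th * phi_cos lam n th + phi_sin lam m th * phi_sin lam n th) * sin th `^ (2 * lam)).

Lemma angular_integrable m n : mu.-integrable `[0, pi] (EFin \o (fun th =>
  (phi_cos lam m th * phi_cos lam n th + phi_sin lam m th * phi_sin lam n th) * sin th `^ (2 * lam))).
Proof.
have h : mu.-integrable `[0, pi] (fun th => ((EFin \o (fun th => (U m th * U n th * w th)%R)) th +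
    (EFin \o (fun th => (V m th * V n th * w th)%R)) th)%E).
  by apply: integrableD; [exact: measurable_itv|exact: iUU|exact: iVV].
by apply: eq_integrable h => [|th _]; [exact: measurable_itv|rewrite /= mulrDl EFinD].
Qed.

Let angularE m n : angular m n = a m n + b m n.
Proof.
rewrite /angular; under eq_Rintegral do rewrite mulrDl.
rewrite RintegralD//; exact: measurable_itv.
Qed.

Let aC m n : a m n = a n m.
Proof. by apply: eq_Rintegral => th _; rewrite [U m th * _]mulrC. Qed.

Let bC m n : b m n = b n m.
Proof. by apply: eq_Rintegral => th _; rewrite [V m th * _]mulrC. Qed.

(** The relation [ab_rel] for [(m, n)] and for [(n, m)] is a linear system in the cosine and sine
    integrals, with determinant [(m - n) * (m + n + 2 * lam)] up to sign. *)
Lemma angular_orth m n : m != n -> angular m n = 0.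
Proof.
move=> mn; have := ab_rel m n; have := ab_rel n m; rewrite aC bC angularE.
move: (a m n) (b m n) => x y h1 h2.
have d0 : (m%:R - n%:R) * (m%:R + n%:R + 2 * lam) != 0.
  rewrite mulf_neq0// ?subr_eq0 ?eqr_nat// gt_eqF// ltr_wpDr ?mulr_ge0//.
  by rewrite -natrD ltr0n lt0n addn_eq0; apply: contraNN mn => /andP[/eqP-> /eqP->].
have x0 : x = 0.
  apply: (mulfI d0); rewrite mulr0.
  have -> : (m%:R - n%:R) * (m%:R + n%:R + 2 * lam) * x =
    (m%:R + 2 * lam) * (m%:R * x) - (n%:R + 2 * lam) * (n%:R * x) by ring.
  by rewrite h1 h2; ring.
have y0 : y = 0.
  apply: (mulfI d0); rewrite mulr0.
  have -> : (m%:R - n%:R) * (m%:R + n%:R + 2 * lam) * y =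
    m%:R * ((m%:R + 2 * lam) * y) - n%:R * ((n%:R + 2 * lam) * y) by ring.
  by rewrite -h1 -h2 x0; ring.
by rewrite x0 y0 addr0.
Qed.

(** With the factor [g] removed from the cosine part, a step of the recursion is a rotation and
    preserves the sum of squares. Together with [ab_rel], which says that the cosine integral is [g]
    times the sine integral, this gives the ratio [(1 + g) / (1 + 1 / g) = g]. *)
Lemma angular_rec n : n.+1%:R * angular n.+1 n.+1 = (2 * lam + n.+1%:R) * angular n n.
Proof.
have g0 : 0 < 2 * lam + n.+1%:R by rewrite ltr_wpDl// mulr_ge0.
have n0 : 0 < n.+1%:R :> R by [].
pose g := (2 * lam + n.+1%:R) / n.+1%:R.
have h : g ^- 2 * a n.+1 n.+1 + b n.+1 n.+1 = angular n n.
  rewrite /a /b -RintegralZl//.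
  rewrite -RintegralD//; try exact: iZ.
    apply: eq_Rintegral => th _; rewrite /U /V /= -/g -/(U n th) -/(V n th) /w.
    have cs := cos2Dsin2 th.
    rewrite -[X in _ = X * _]mul1r -cs; field.
    by rewrite /g mulf_neq0// ?invr_neq0// gt_eqF.
have := ab_rel n.+1 n.+1; rewrite -h angularE.
move: (a n.+1 n.+1) (b n.+1 n.+1) => x y e.
have -> : x = g * y.
  by apply: (mulfI (lt0r_neq0 n0)); rewrite e /g addrC; field; rewrite nat1r pnatr_eq0.
rewrite /g; field.
by rewrite nat1r pnatr_eq0/= gt_eqF.
Qed.

Lemma angular_norm n : phi_norm lam n ^+ 2 * angular n n = angular 0 0.
Proof.
elim: n => [|n IH]; first by rewrite /phi_norm pochhammer0 fact0 divr1 sqrtr1 expr1n mul1r.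
have g0 : 2 * lam + n.+1%:R != 0 by rewrite gt_eqF// ltr_wpDl// mulr_ge0.
have n0 : n.+1%:R != 0 :> R by rewrite pnatr_eq0.
apply: (mulfI g0); rewrite -IH mulrA [_ * phi_norm _ _ ^+ 2]mulrC phi_norm_sqrS//.
by rewrite -mulrA angular_rec; ring.
Qed.

Lemma angular0_gt0 : 0 < angular 0 0.
Proof.
have p0 := pi_gt0 R; rewrite -lte_fin /angular /= /Rintegral.
have E th : (1 * 1 + 0 * 0) * sin th `^ (2 * lam) = w th by rewrite mulr0 addr0 !mul1r.
under eq_integral do rewrite E.
have iw : mu.-integrable `[0, pi] (EFin \o w).
  have : mu.-integrable `[0, pi] (EFin \o (fun th => U 0 th * U 0 th * w th)) by [].
  by apply: eq_integrable; [exact: measurable_itv|move=> th _ /=; rewrite mulr1 mul1r].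
rewrite fineK; last by apply: integrable_fin_num iw; exact: measurable_itv.
pose c : R := (pi / 8) `^ (2 * lam).
have c0 : 0 < c by rewrite powR_gt0// divr_gt0.
apply: (@lt_le_trans _ _ (\int[mu]_(th in `[(pi / 4)%R, (pi / 2)%R]) (cst c%:E th)))%E.
  rewrite integral_cst//= [X in (_ * X)%E]lebesgue_measure_itv/= lte_fin.
  rewrite ifT; last by lra.
  by rewrite -EFinB -EFinM lte_fin mulr_gt0//; lra.
apply: ge0_le_integral_subset => th /=; rewrite in_itv/=.
- by move=> _; rewrite lee_fin ltW.
- by move=> _; rewrite lee_fin powR_ge0.
move=> /andP[h1 h2]; split; first by rewrite in_itv/=; lra.
rewrite lee_fin; apply: ler_powR_base; rewrite ?mulr_ge0//.
  exact: ltW.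
apply: le_trans (half_le_sin _); last by rewrite h2 andbT; lra.
by lra.
Qed.

End circle.

(** * Radial moments *)

Section radial.
Variables (R : realType) (lam al : R).
Hypotheses (lam_ge0 : 0 <= lam) (al_gtN1 : -1 < al).
Let mu := @lebesgue_measure R.

Definition radial_weight (t : R) : R := t `^ (2 * lam + 1) * (1 - t ^+ 2) `^ al.

(** The moments are truncated at [r < 1], because the weight is unbounded near [1] when [al < 0]. *)
Definition radial (j : nat) (r : R) : R :=
  \int[@lebesgue_measure R]_(t in `[0, r]) (t ^+ j * radial_weight t).

Let k0 : 0 <= 2 * lam. Proof. exact: mulr_ge0. Qed.

Lemma radial_weight_ge0 t : 0 <= radial_weight t.
Proof. by rewrite mulr_ge0 ?powR_ge0. Qed.

Let sqr_lt1 (t : R) : 0 <= t < 1 -> 0 < 1 - t ^+ 2.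
Proof. by move=> /andP[t0 t1]; rewrite subr_gt0 exprn_ilt1. Qed.

Let powR_le1 (x s : R) : 0 <= s -> 0 <= x <= 1 -> x `^ s <= 1.
Proof.
move=> s0 /andP[x0 x1]; have := @ler_powR_base R x 1 s; rewrite powR1; exact.
Qed.

Lemma measurable_radial_weight : measurable_fun setT radial_weight.
Proof.
apply: measurable_funM; first exact: measurable_powR.
by apply: (measurableT_comp (measurable_powR al)); apply: measurable_funB.
Qed.

Lemma radial_weight_bounded (r : R) : 0 <= r < 1 ->
  forall t, 0 <= t <= r -> radial_weight t <= 1 + (1 - r ^+ 2) `^ al.
Proof.
move=> /andP[r0 r1] t /andP[t0 tr].
have t1 : t < 1 by apply: le_lt_trans r1.
have a0 := @sqr_lt1 t; rewrite t0 t1 in a0; have {}a0 := a0 isT.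
have h1 : t `^ (2 * lam + 1) <= 1 by apply: powR_le1; rewrite ?addr_ge0// t0 ltW.
have h2 : (1 - t ^+ 2) `^ al <= 1 + (1 - r ^+ 2) `^ al.
  have [al0|/ltW al0] := leP 0 al.
    by rewrite ler_wpDr ?powR_ge0//; apply: powR_le1 => //; rewrite ltW//= gerBl sqr_ge0.
  have b0 : 0 < 1 - r ^+ 2 by apply: sqr_lt1; rewrite r0.
  have E x : x `^ al = (x `^ (- al))^-1 by rewrite -powRN opprK.
  rewrite ler_wpDl// !E lef_pV2 ?posrE ?powR_gt0//.
  apply: ler_powR_base; rewrite ?oppr_ge0//; first exact: ltW.
  by rewrite lerD2l lerN2 ler_pXn2r ?nnegrE.
by rewrite /radial_weight -[leRHS]mul1r ler_pM ?powR_ge0.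
Qed.

Lemma radial_integrable j (r : R) : r < 1 ->
  mu.-integrable `[0, r] (EFin \o (fun t => t ^+ j * radial_weight t)).
Proof.
move=> r1; have [r0|r0] := leP 0 r; last first.
  by rewrite set_itv_ge ?bnd_simp -?ltNge//; exact: integrable_set0.
apply: (@bounded_integrable _ _ _ _ _ _ (1 + (1 - r ^+ 2) `^ al)).
- exact: measurable_itv.
- by rewrite [X in (X < _)%E]lebesgue_measure_itv/=; case: ifP => _; rewrite -?EFinB ltry.
- apply: measurable_funTS; apply: measurable_funM; last exact: measurable_radial_weight.
  exact: measurable_funX.
- move=> t /=; rewrite in_itv/= => tr; have /andP[t0 t1] := tr.
  rewrite normrM !ger0_norm ?exprn_ge0 ?radial_weight_ge0//.
  have h : t ^+ j <= 1 by rewrite exprn_ile1// (le_trans t1)// ltW.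
  apply: le_trans (ler_wpM2r (radial_weight_ge0 t) h) _.
  by rewrite mul1r; apply: radial_weight_bounded; rewrite ?r0.
Qed.

Lemma radial_nondecreasing j r s : r <= s -> s < 1 -> radial j r <= radial j s.
Proof.
move=> rs s1; rewrite /radial /Rintegral fine_le//.
- by apply: integrable_fin_num; [exact: measurable_itv|apply: radial_integrable; exact: le_lt_trans s1].
- by apply: integrable_fin_num; [exact: measurable_itv|exact: radial_integrable].
apply: ge0_le_integral_subset => t /=; rewrite in_itv/= => /andP[t0 tr].
- by rewrite lee_fin mulr_ge0 ?exprn_ge0 ?radial_weight_ge0.
- by rewrite lee_fin mulr_ge0 ?exprn_ge0 ?radial_weight_ge0.
- by split => //; rewrite in_itv/= t0 (le_trans tr).
Qed.

Let d_weight (s t : R) : 0 <= t < 1 ->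
  is_derive t 1 (fun t : R => (1 - t ^+ 2) `^ s) (- (2 * s * t * (1 - t ^+ 2) `^ (s - 1))).
Proof.
move=> /sqr_lt1 a0.
have d : is_derive t 1 (fun t : R => 1 - t ^+ 2) (- (2 * t)).
  apply: (is_derive1_ext (is_deriveB (is_derive_cst (1 : R) t 1)
    (is_deriveM (is_derive_id t 1) (is_derive_id t 1)))) => [//|].
  by rewrite /GRing.scale/=; ring.
have dc := @is_derive1_comp R (fun x => powR x s) (fun t => 1 - t ^+ 2) t _ _ (is_derive1_powR s a0) d.
apply: (is_derive1_ext dc) => [//|].
by rewrite /GRing.scale/=; ring.
Qed.

(** The power of [t] in the integrand is at most [t], and [t * (1 - t ^+ 2) ^ al] has an explicit
    primitive; [al > -1] makes the bound uniform in [r]. *)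
Lemma radial_le j r : 0 <= r < 1 -> radial j r <= (2 * (al + 1))^-1.
Proof.
move=> r01; have /andP[r0 r1] := r01.
have a1 : 0 < al + 1 by rewrite -ltrBlDr sub0r.
move: r0; rewrite le_eqVlt => /orP[/eqP<-|r0].
  by rewrite /radial set_itv1 Rintegral_set1 invr_ge0 mulr_ge0// ltW.
have sub t : 0 <= t <= r -> 0 <= t < 1 by move=> /andP[-> /le_lt_trans->].
have H : (\int[mu]_(t in `[0%R, r]) (t * (1 - t ^+ 2) `^ al)%:E =
    (- (1 - r ^+ 2) `^ (al + 1) / (2 * (al + 1)) - - (1 - 0 ^+ 2) `^ (al + 1) / (2 * (al + 1)))%:E)%E.
  apply: (@FTC_derive R (fun t => - (1 - t ^+ 2) `^ (al + 1) / (2 * (al + 1)))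
    (fun t => t * (1 - t ^+ 2) `^ al) 0 r r0) => t tr; have t01 := sub _ tr.
    apply: (is_derive1_ext (is_deriveZ (- (2 * (al + 1))^-1) (d_weight (al + 1) t01))) => [s|].
      by rewrite -[LHS]/(- (2 * (al + 1))^-1 * (1 - s ^+ 2) `^ (al + 1)) !mulNr mulrC.
    by rewrite /GRing.scale/= addrK; field; rewrite gt_eqF.
  by apply: cvgM; [exact: cvg_id|exact: is_derive1_continuous (d_weight al t01)].
rewrite -lee_fin.
apply: (@le_trans _ _ (\int[mu]_(t in `[0%R, r]) (t * (1 - t ^+ 2) `^ al)%:E)%E).
  rewrite /radial /Rintegral fineK.
    apply: ge0_le_integral_subset => t /=; rewrite in_itv/= => tr; have /andP[t0 _] := sub _ tr.
    - by rewrite lee_fin mulr_ge0 ?exprn_ge0 ?radial_weight_ge0.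
    - by rewrite lee_fin mulr_ge0 ?powR_ge0.
    split; first exact: tr.
    have /andP[_ t1] := sub _ tr.
    rewrite lee_fin /radial_weight mulrA ler_wpM2r ?powR_ge0// -[leRHS]mul1r.
    apply: ler_pM; rewrite ?exprn_ge0 ?powR_ge0 ?exprn_ile1// ?(ltW t1)//.
    have [->|tn0] := eqVneq t 0; first by rewrite powR0// gt_eqF// ltr_wpDl.
    rewrite gt0_powRD ?lt0r ?tn0// powRr1// -[leRHS]mul1r ler_wpM2r//.
    by apply: powR_le1 => //; rewrite t0 ltW.
  by apply: integrable_fin_num; [exact: measurable_itv|exact: radial_integrable].
rewrite H lee_fin expr0n subr0 powR1 !mulNr opprK addrC -mulrBl -[leRHS]mul1r.
rewrite ler_wpM2r ?invr_ge0 ?mulr_ge0// ?(ltW a1)//.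
by rewrite gerBl powR_ge0.
Qed.

(* Integrate the derivative of the boundary term. *)
Lemma radial_rec j r : 0 < r < 1 ->
  (j.+2%:R + 2 * lam) * radial j r =
  (j.+2%:R + 2 * lam + 2 * al + 2) * radial j.+2 r +
    r ^+ j.+2 * (r `^ (2 * lam) * (1 - r ^+ 2) `^ (al + 1)).
Proof.
move=> /andP[r0 r1].
pose F (t : R) := t ^+ j.+2 * (t `^ (2 * lam) * (1 - t ^+ 2) `^ (al + 1)).
pose f (t : R) := (j.+2%:R + 2 * lam) * (t ^+ j * radial_weight t)
  - (j.+2%:R + 2 * lam + 2 * al + 2) * (t ^+ j.+2 * radial_weight t).
have i1 := radial_integrable j r1; have i2 := radial_integrable j.+2 r1.
have iZ (c : R) (g : R -> R) : mu.-integrable `[0, r] (EFin \o g) ->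
    mu.-integrable `[0, r] (EFin \o (fun th => c * g th)).
  move=> h; change (mu.-integrable `[0, r] (fun th => (c%:E * (EFin \o g) th)%E)).
  by apply: integrableZl => //; exact: measurable_itv.
have dF (t : R) : 0 < t < 1 -> is_derive t 1 F (f t).
  move=> /andP[t0 t1]; have t01 : 0 <= t < 1 by rewrite ltW.
  have d1 : is_derive t 1 (fun t : R => t ^+ j.+2) (j.+2%:R * t ^+ j.+1).
    apply: (is_derive1_ext (is_deriveX j.+2 (is_derive_id t 1))) => [s|]; first by rewrite exprfctE.
    by rewrite /GRing.scale/= mulr1.
  have d2 := is_derive1_powR (2 * lam) t0; have d3 := d_weight (al + 1) t01.
  apply: (is_derive1_ext (is_deriveM d1 (is_deriveM d2 d3))) => [//|].
  rewrite /GRing.scale/= /f /radial_weight addrK.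
  rewrite -[X in _ + X * (j.+2%:R * _)]/(t `^ (2 * lam) * (1 - t ^+ 2) `^ (al + 1)).
  have -> : (1 - t ^+ 2) `^ (al + 1) = (1 - t ^+ 2) `^ al * (1 - t ^+ 2).
    by rewrite gt0_powRD ?sqr_lt1// powRr1// ltW// sqr_lt1.
  have -> : t `^ (2 * lam + 1) = t `^ (2 * lam - 1) * t ^+ 2.
    by rewrite -powR_mulrn ?ltW// -gt0_powRD//; congr (_ `^ _); ring.
  have -> : t `^ (2 * lam) = t `^ (2 * lam - 1) * t.
    by rewrite -[X in _ = _ * X]powRr1 ?ltW// -gt0_powRD// subrK.
  rewrite !exprS.
  by move: (t `^ _) (_ `^ al) (t ^+ j) => x y z; ring.
have := @FTC_open R F f 0 r 0 (F r) r0.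
rewrite subr0 /f RintegralB; [|exact: measurable_itv|exact: iZ|exact: iZ].
rewrite !RintegralZl//; try exact: measurable_itv.
rewrite -/(radial j r) -/(radial j.+2 r) /F => H.
have {}H : (j.+2%:R + 2 * lam) * radial j r - (j.+2%:R + 2 * lam + 2 * al + 2) * radial j.+2 r =
   r ^+ j.+2 * (r `^ (2 * lam) * (1 - r ^+ 2) `^ (al + 1)).
  apply: H.
  - change (mu.-integrable `[0, r] (fun t => ((EFin \o (fun t : R => (j.+2%:R + 2 * lam) * (t ^+ j * radial_weight t))%R) t -
      (EFin \o (fun t : R => (j.+2%:R + 2 * lam + 2 * al + 2) * (t ^+ j.+2 * radial_weight t))%R) t)%E)).
    by apply: integrableB; [exact: measurable_itv|exact: iZ|exact: iZ].
  - by move=> t /andP[t0 tr]; apply: dF; rewrite t0 (lt_trans tr).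
  - move=> t /andP[t0 tr]; have t01 : 0 <= t < 1 by rewrite ltW//= (lt_trans tr).
    have cw : {for t, continuous radial_weight}.
      apply: cvgM; first exact: is_derive1_continuous (is_derive1_powR (2 * lam + 1) t0).
      exact: is_derive1_continuous (d_weight al t01).
    by apply: cvgB; apply: cvgM; try exact: cvg_cst; apply: cvgM => //; exact: exprn_continuous.
  - apply: norm_cvg0; apply: (@squeeze_cvgr _ _ _ _ (fun=> 0) (fun t => t)).
    + near=> t; have t0 : 0 < t by near: t; exact: nbhs_right_gt.
      have t1 : t < 1 by near: t; exact: nbhs_right_lt.
      rewrite normr_ge0/= ger0_norm; last by rewrite mulr_ge0 ?exprn_ge0 ?mulr_ge0 ?powR_ge0 ?(ltW t0).
      rewrite -[leRHS]mulr1; apply: ler_pM; rewrite ?exprn_ge0 ?mulr_ge0 ?powR_ge0 ?(ltW t0)//.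
        by rewrite exprS -[leRHS]mulr1 ler_wpM2l ?(ltW t0)// exprn_ile1 ?(ltW t0) ?(ltW t1).
      apply: mulr_ile1; rewrite ?powR_ge0//; apply: powR_le1; rewrite ?(ltW t0) ?(ltW t1)//.
        by rewrite -lerBlDr sub0r ltW.
      by rewrite ltW ?sqr_lt1 ?(ltW t0)//= gerBl sqr_ge0.
    + exact: cvg_cst.
    + exact: cvg_within.
  - apply: cvg_at_left_filter; apply: is_derive1_continuous (dF r _).
    by rewrite r0.
by move: H; move: (radial _ _) (radial _ _) (r ^+ _ * _) => x y z; lra.
Unshelve. all: by end_near. Qed.

Lemma radial_gt0 : 0 < radial 0 2^-1.
Proof.
have h1 : 2^-1 < 1 :> R by rewrite invf_lt1// ltr1n.
rewrite -lte_fin /radial /Rintegral fineK; last first.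
  by apply: integrable_fin_num; [exact: measurable_itv|exact: radial_integrable].
pose c : R := 4^-1 `^ (2 * lam + 1) * (2^-1) `^ `|al|.
have c0 : 0 < c by rewrite mulr_gt0 ?powR_gt0.
apply: (@lt_le_trans _ _ (\int[mu]_(th in `[(4^-1)%R, (2^-1)%R]) (cst c%:E th)))%E.
  rewrite integral_cst//= [X in (_ * X)%E]lebesgue_measure_itv/= lte_fin.
  rewrite ifT; last by lra.
  by rewrite -EFinB -EFinM lte_fin mulr_gt0//; lra.
apply: ge0_le_integral_subset => t /=; rewrite in_itv/=.
- by move=> _; rewrite lee_fin ltW.
- by move=> _; rewrite lee_fin expr0 mul1r radial_weight_ge0.
move=> /andP[t1 t2]; split; first by rewrite in_itv/= t2 andbT; lra.
rewrite lee_fin expr0 mul1r; apply: ler_pM; rewrite ?powR_ge0//.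
  by apply: ler_powR_base; rewrite ?addr_ge0 ?invr_ge0.
have t20 : 2^-1 <= 1 - t ^+ 2 by nra.
have t21 : 1 - t ^+ 2 <= 1 by rewrite gerBl sqr_ge0.
apply: (@le_trans _ _ ((1 - t ^+ 2) `^ `|al|)).
  by apply: ler_powR_base; rewrite ?normr_ge0.
have b0 : 0 < 1 - t ^+ 2 by apply: lt_le_trans t20.
rewrite /powR gt_eqF// ler_expR ler_wnM2r ?ler_norm//.
by rewrite ln_le0.
Qed.

End radial.

(** * Complete radial moments *)

Section radial_limit.
Variables (R : realType) (lam al : R).
Hypotheses (lam_ge0 : 0 <= lam) (al_gtN1 : -1 < al).

(** The shift by [2] keeps every radius at least [1/2]. *)
Definition exhaustion (j : nat) : R := 1 - j.+2%:R^-1.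

Lemma exhaustion_bounds j : 2^-1 <= exhaustion j < 1.
Proof.
rewrite /exhaustion gtrBl invr_gt0 ltr0n andbT.
have h : j.+2%:R^-1 <= 2^-1 :> R by rewrite lef_pV2 ?posrE// ler_nat.
by rewrite lerBrDr -lerBrDl; apply: le_trans h _; lra.
Qed.

Lemma exhaustion_gt0_lt1 j : 0 < exhaustion j < 1.
Proof. by have /andP[h ->] := exhaustion_bounds j; rewrite andbT (lt_le_trans _ h). Qed.

Lemma exhaustion_nondecreasing : {homo exhaustion : i j / (i <= j)%N >-> i <= j}.
Proof. by move=> i j ij; rewrite lerD2l lerN2 lef_pV2 ?posrE// ler_nat. Qed.

Lemma exhaustion_cvg : exhaustion j @[j --> \oo] --> (1 : R).
Proof.
rewrite -[X in _ --> X]subr0; apply: cvgB; first exact: cvg_cst.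
by have := @cvg_harmonic R; rewrite -cvg_shiftS.
Qed.

(** Only even exponents occur: the product of two functions of degree [n] is [t ^+ (2 * n)] times a
    function of the angle. *)
Definition radial_total (n : nat) : R := limn (fun j => radial lam al (2 * n) (exhaustion j)).

Let radial_nd n : nondecreasing_seq (fun j => radial lam al n (exhaustion j)).
Proof.
move=> i j ij; apply: radial_nondecreasing => //; first exact: exhaustion_nondecreasing.
by have /andP[] := exhaustion_bounds j.
Qed.

Let radial_is_cvg n : cvgn (fun j => radial lam al n (exhaustion j)).
Proof.
apply: nondecreasing_is_cvgn; first exact: radial_nd.
exists (2 * (al + 1))^-1 => _ [j _ <-]; apply: radial_le => //.
by have /andP[/ltW-> ->] := exhaustion_gt0_lt1 j.
Qed.

Lemma radial_total_cvg n : radial lam al (2 * n) (exhaustion j) @[j --> \oo] --> radial_total n.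
Proof. exact: radial_is_cvg. Qed.

Lemma radial_total0_gt0 : 0 < radial_total 0.
Proof.
apply: (@lt_le_trans _ _ (radial lam al 0 (exhaustion 0))).
  apply: (@lt_le_trans _ _ (radial lam al 0 2^-1)); first exact: radial_gt0.
  by apply: radial_nondecreasing => //; have /andP[] := exhaustion_bounds 0.
exact: (nondecreasing_cvgn_le (radial_nd 0) (@radial_is_cvg 0)).
Qed.

(** Half of [radial_rec] at the even index [2 * n], in the limit: the boundary term carries
    [(1 - r ^+ 2) ^ (al + 1)] and tends to [0]. *)
Lemma radial_total_rec n :
  (n.+1%:R + lam) * radial_total n = (n.+2%:R + lam + al) * radial_total n.+1.
Proof.
pose b j := exhaustion j ^+ (2 * n).+2 * (exhaustion j `^ (2 * lam) * (1 - exhaustion j ^+ 2) `^ (al + 1)).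
have b0 : b j @[j --> \oo] --> (0 : R).
  apply: norm_cvg0.
  apply: (@squeeze_cvgr _ _ _ _ (fun=> 0) (fun j => (1 - exhaustion j ^+ 2) `^ (al + 1))).
  - apply: nearW => j; have /andP[j0 j1] := exhaustion_gt0_lt1 j.
    rewrite normr_ge0/= ger0_norm; last by rewrite mulr_ge0 ?exprn_ge0 ?mulr_ge0 ?powR_ge0 ?ltW.
    rewrite -[leRHS]mul1r; apply: ler_pM; rewrite ?exprn_ge0 ?mulr_ge0 ?powR_ge0 ?(ltW j0)//.
      by rewrite exprn_ile1 ?(ltW j0) ?(ltW j1).
    rewrite -[leRHS]mul1r ler_wpM2r ?powR_ge0//.
    have := @ler_powR_base R (exhaustion j) 1 (2 * lam); rewrite powR1; apply.
    + by rewrite mulr_ge0.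
    + exact: ltW.
    + exact: ltW.
  - exact: cvg_cst.
  - have a1 : 0 < al + 1 by rewrite -ltrBlDr sub0r.
    have := (@cvg_at_rightP R (fun x : R => x `^ (al + 1)) 0 0).1 (powR_cvg0 a1) (fun j => 1 - exhaustion j ^+ 2).
    apply; split => [j|].
      by have /andP[j0 j1] := exhaustion_gt0_lt1 j; rewrite subr_gt0 exprn_ilt1 ?(ltW j0).
    rewrite -[X in _ --> X](subrr 1) -[X in _ --> _ - X](expr1n R 2).
    apply: cvgB; first exact: cvg_cst.
    by rewrite !expr2; apply: cvgM; exact: exhaustion_cvg.
have l1 : (((2 * n).+2%:R + 2 * lam) * radial lam al (2 * n) (exhaustion j)) @[j --> \oo] -->
    ((2 * n).+2%:R + 2 * lam) * radial_total n.
  by apply: cvgM; [exact: cvg_cst|exact: radial_total_cvg].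
have l2 : (((2 * n).+2%:R + 2 * lam) * radial lam al (2 * n) (exhaustion j)) @[j --> \oo] -->
    ((2 * n).+2%:R + 2 * lam + 2 * al + 2) * radial_total n.+1 + 0.
  under eq_fun do rewrite radial_rec ?exhaustion_gt0_lt1//.
  apply: cvgD; last exact: b0.
  apply: cvgM; first exact: cvg_cst.
  have -> : (2 * n).+2 = (2 * n.+1)%N by rewrite mulnS.
  exact: radial_total_cvg.
have := cvg_unique _ l1 l2; rewrite -[(2 * n).+2]addn2 natrD natrM -(natr1 n.+1) -(natr1 n) => h.
have {}h := h (@norm_hausdorff _ _).
move: h; move: (radial_total n) (radial_total n.+1) n%:R => x y z h.
apply: (@mulfI _ 2); rewrite ?pnatr_eq0//.
transitivity ((2 * z + 2 + 2 * lam) * x); first by ring.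
by rewrite h addr0; ring.
Qed.

(** By induction: [radial_total_rec] and [Gamma_rec] multiply the two factors by inverse ratios. *)
Lemma radial_total_Gamma n :
  radial_total n * (Gamma (lam + 1) * Gamma (n%:R + lam + al + 2)
     / (Gamma (lam + al + 2) * Gamma (n%:R + lam + 1))) = radial_total 0.
Proof.
have e0 : 0 < lam + al + 2 by rewrite -addrA ltr_wpDl// -[2]/(1 + 1) addrA ltr_wpDr// -ltrBlDr sub0r.
have G1 : Gamma (lam + 1) != 0 by rewrite gt_eqF// Gamma_gt0// ltr_wpDl.
have G2 : Gamma (lam + al + 2) != 0 by rewrite gt_eqF// Gamma_gt0.
have key (t t1 a g b c d e : R) : b != 0 -> c != 0 -> d != 0 -> d * t = e * t1 ->
    t1 * (a * (e * g) / (b * (d * c))) = t * (a * g / (b * c)).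
  move=> b0 c0 d0 h; have -> : t = e * t1 / d by rewrite -h mulrAC divff ?mul1r.
  by field; rewrite b0 c0 d0.
elim: n => [|n IH].
  by rewrite !add0r [X in _ / X]mulrC divff ?mulr1// mulf_neq0.
have n0 := ler0n R n.
have h1 : 0 < n%:R + lam + 1 by rewrite ltr_wpDl// addr_ge0.
have h2 : 0 < n%:R + lam + al + 2 by rewrite -!addrA ltr_wpDl// addrA.
have G3 : Gamma (n%:R + lam + 1) != 0 by rewrite gt_eqF// Gamma_gt0.
have := radial_total_rec n; rewrite -IH.
have -> : n.+1%:R + lam + al + 2 = (n%:R + lam + al + 2) + 1 :> R by rewrite -natr1; ring.
have -> : n.+1%:R + lam + 1 = (n%:R + lam + 1) + 1 :> R by rewrite -natr1; ring.
rewrite (Gamma_rec h1) (Gamma_rec h2) -(natr1 n.+1) -(natr1 n).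
have -> : n%:R + 1 + lam = n%:R + lam + 1 by ring.
have -> : n%:R + 1 + 1 + lam + al = n%:R + lam + al + 2 by ring.
move=> h; apply: key => //; first by rewrite gt_eqF.
Qed.

End radial_limit.

(** * Minkowski inequality for finite sums *)

Section fine_partition.
Context d (T : measurableType d) (R : realType) (B : set T) (eta : R) (Q : set T -> Prop).
Hypotheses (mB : measurable B) (eta_gt0 : 0 < eta).
Hypothesis Q_split : forall D S, measurable D -> measurable S -> D `<=` B ->
  Q (D `&` S) -> Q (D `\` S) -> Q D.
Implicit Types (D : set T) (g : T -> R).

Let osc g D := forall u v, D u -> D v -> `|g u - g v| <= eta.

(** A sublevel set cuts the range of [g] at its midpoint; after [n] cuts the range has length at
    most [eta]. *)
Let bisection g n a D : measurable_fun B g -> measurable D -> D `<=` B ->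
  (forall v, D v -> a <= g v <= a + 2 ^+ n * eta) ->
  (forall D', measurable D' -> D' `<=` D -> osc g D' -> Q D') -> Q D.
Proof.
move=> mg; elim: n a D => [|n IH] a D mD DB gD QD.
  apply: (QD D) => // u v /gD /andP[u1 u2] /gD /andP[v1 v2].
  move: u2 v2; rewrite expr0 mul1r => u2 v2; rewrite ler_distl lerBlDr; apply/andP.
  by split; [apply: le_trans v2 _|apply: le_trans u2 _]; rewrite lerD2r.
pose c := a + 2 ^+ n * eta; pose S := B `&` g @^-1` `]-oo, c[.
have mS : measurable S by apply: mg => //; exact: measurable_itv.
apply: (Q_split mD mS DB).
  apply: (IH a); [exact: measurableI|by move=> v [/DB]| |] => [v [Dv]|D' mD' D'D].
    by rewrite /S/= in_itv/= => -[_ /ltW ->]; have /andP[->] := gD _ Dv.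
  by apply: QD => // v /D'D[].
apply: (IH c); [exact: measurableD|by move=> v [/DB]| |] => [v [Dv]|D' mD' D'D].
  move=> nS; have /andP[_ h] := gD _ Dv; rewrite leNgt; apply/andP; split.
    by apply/negP => gc; apply: nS; split; [exact: DB|rewrite /= in_itv].
  by apply: le_trans h _; rewrite /c exprS mulrDl mulrDl mul1r addrA.
by apply: QD => // v /D'D[].
Qed.

(** An induction principle that stands for a finite partition: a property that passes from two
    complementary pieces to their union need only be checked where the first [m] functions oscillate
    little. Boundedness of each function limits the number of cuts. *)
Lemma fine_partition (g : nat -> T -> R) (m : nat) :
  (forall i, measurable_fun B (g i)) ->
  (forall i, exists M, forall v, B v -> `|g i v| <= M) ->
  (forall D, measurable D -> D `<=` B ->
     (forall i, (i < m)%N -> forall u v, D u -> D v -> `|g i u - g i v| <= eta) -> Q D) ->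
  Q B.
Proof.
move=> mg bg; suff : forall D, measurable D -> D `<=` B ->
    (forall D', measurable D' -> D' `<=` D -> (forall i, (i < m)%N -> osc (g i) D') -> Q D') -> Q D.
  by move=> h H; apply: (h B) => // D mD DB; exact: H.
elim: m => [|m IH] D mD DB QD; first exact: QD.
apply: IH => // D' mD' D'D oscD'.
have [M gM] := bg m.
pose n := Num.bound `|2 * M / eta|.
have D'B : D' `<=` B by move=> v /D'D /DB.
apply: (@bisection (g m) n (- M) D') => // [v /D'B /gM|D2 mD2 D2D' oscD2].
  rewrite ler_norml => /andP[-> h]/=; apply: le_trans h _.
  rewrite -lerBlDl opprK (_ : M + M = 2 * M); last by ring.
  rewrite -ler_pdivrMr//; apply: le_trans (ler_norm _) _.
  apply: le_trans (ltW (archi_boundP (normr_ge0 _))) _.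
  by rewrite -natrX ler_nat ltnW// ltn_expl.
apply: QD => // [v /D2D'/D'D//|i]; rewrite ltnS leq_eqVlt => /orP[/eqP->//|im].
by move=> u v /D2D' ? /D2D' ?; exact: oscD'.
Qed.

End fine_partition.

(** * Integrals of bounded complex functions *)

Section complex_integral.
Context d (T : measurableType d) (R : realType) (mu : {measure set T -> \bar R}).
Implicit Types (A : set T) (g : T -> R[i]).

Definition cintegral A g : R[i] :=
  (\int[mu]_(v in A) complex.Re (g v)) +i* (\int[mu]_(v in A) complex.Im (g v)).

(** Stable under sums and products, and sufficient for integrability on sets of finite measure. *)
Definition tame A g : Prop :=
  [/\ measurable_fun A (fun v => complex.Re (g v)),
      measurable_fun A (fun v => complex.Im (g v)) &
      exists M, forall v, A v -> rnorm (g v) <= M].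

Lemma tame_sub A B g : measurable A -> measurable B -> B `<=` A -> tame A g -> tame B g.
Proof.
move=> mA mB BA [m1 m2 [M h]]; split; [exact: measurable_funS m1|exact: measurable_funS m2|].
by exists M => v /BA /h.
Qed.

Lemma tame_integrable A g : measurable A -> (mu A < +oo)%E -> tame A g ->
  mu.-integrable A (EFin \o (fun v => complex.Re (g v))) /\
  mu.-integrable A (EFin \o (fun v => complex.Im (g v))).
Proof.
move=> mA fA [m1 m2 [M h]]; split; apply: (bounded_integrable (M := M)) => // v /h;
  by apply: le_trans; have [] := ReIm_le_rnorm (g v).
Qed.

Lemma tameD A (f g : T -> R[i]) : tame A f -> tame A g -> tame A (fun v => f v + g v).
Proof.
move=> [f1 f2 [M fM]] [g1 g2 [N gN]]; split.
- apply: eq_measurable_fun (measurable_funD f1 g1) => v _ /=.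
  by case: (f v) (g v) => [? ?] [? ?].
- apply: eq_measurable_fun (measurable_funD f2 g2) => v _ /=.
  by case: (f v) (g v) => [? ?] [? ?].
- by exists (M + N) => v Av; apply: le_trans (rnormD _ _) _; rewrite lerD ?fM ?gN.
Qed.

Lemma tameM A (f g : T -> R[i]) : tame A f -> tame A g -> tame A (fun v => f v * g v).
Proof.
move=> [f1 f2 [M fM]] [g1 g2 [N gN]]; split.
- apply: eq_measurable_fun (measurable_funB (measurable_funM f1 g1) (measurable_funM f2 g2)) => v _ /=.
  by case: (f v) (g v) => [? ?] [? ?].
- apply: eq_measurable_fun (measurable_funD (measurable_funM f1 g2) (measurable_funM f2 g1)) => v _ /=.
  by case: (f v) (g v) => [a b] [c e] /=; rewrite [b * c]mulrC.
- by exists (M * N) => v Av; rewrite rnormM ler_pM ?rnorm_ge0 ?fM ?gN.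
Qed.

Lemma tame_cst A (a : R[i]) : tame A (fun=> a).
Proof. by split; [exact: measurable_cst|exact: measurable_cst|exists (rnorm a)]. Qed.

Lemma cintegral_linear A (a : R[i]) f g : measurable A -> (mu A < +oo)%E ->
  tame A f -> tame A g ->
  cintegral A (fun v => a * f v + g v) = a * cintegral A f + cintegral A g.
Proof.
move=> mA fA tf tg.
have [if1 if2] := tame_integrable mA fA tf; have [ig1 ig2] := tame_integrable mA fA tg.
have taf : tame A (fun v => a * f v) by apply: tameM => //; exact: tame_cst.
have [ia1 ia2] := tame_integrable mA fA taf.
have iZ (c : R) (h : T -> R) : mu.-integrable A (EFin \o h) ->
    mu.-integrable A (EFin \o (fun th => c * h th)).
  move=> ih; change (mu.-integrable A (fun th => (c%:E * (EFin \o h) th)%E)).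
  exact: integrableZl.
case: a taf ia1 ia2 => a b taf ia1 ia2.
rewrite /cintegral; apply/eqP; rewrite eq_complex/=; apply/andP; split; apply/eqP.
- transitivity (\int[mu]_(v in A) (complex.Re ((a +i* b) * f v) + complex.Re (g v))).
    by apply: eq_Rintegral => v _ /=; case: (f v) (g v) => [? ?] [? ?].
  rewrite RintegralD//; congr (_ + _).
  rewrite -!RintegralZl// -RintegralB//; [|exact: iZ|exact: iZ].
  by apply: eq_Rintegral => v _; case: (f v).
- transitivity (\int[mu]_(v in A) (complex.Im ((a +i* b) * f v) + complex.Im (g v))).
    by apply: eq_Rintegral => v _ /=; case: (f v) (g v) => [? ?] [? ?].
  rewrite RintegralD//; congr (_ + _).
  rewrite -!RintegralZl// -RintegralD//; [|exact: iZ|exact: iZ].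
  by apply: eq_Rintegral => v _; case: (f v).
Qed.

Lemma cintegral_setU A B g : measurable A -> measurable B -> (mu (A `|` B) < +oo)%E ->
  tame (A `|` B) g -> [disjoint A & B] ->
  cintegral (A `|` B) g = cintegral A g + cintegral B g.
Proof.
move=> mA mB fAB tg dAB; have [i1 i2] := tame_integrable (measurableU _ _ mA mB) fAB tg.
by rewrite /cintegral !Rintegral_setU.
Qed.

Lemma cintegral_set0 g : cintegral set0 g = 0.
Proof. by rewrite /cintegral !Rintegral_set0. Qed.

Lemma cintegral_dist A g (c : R[i]) (eta : R) : measurable A -> (mu A < +oo)%E -> tame A g ->
  (forall v, A v -> `|complex.Re (g v) - complex.Re c| <= eta) ->
  (forall v, A v -> `|complex.Im (g v) - complex.Im c| <= eta) ->
  rnorm (cintegral A g - (fine (mu A))%:C * c) <= 2 * eta * fine (mu A).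
Proof.
move=> mA fA tg h1 h2; have [i1 i2] := tame_integrable mA fA tg.
have ic r : mu.-integrable A (EFin \o (cst r : T -> R)).
  apply: (bounded_integrable (M := `|r|)) => //; exact: measurable_cst.
have H (h : T -> R) r : mu.-integrable A (EFin \o h) -> (forall v, A v -> `|h v - r| <= eta) ->
    `|\int[mu]_(v in A) h v - fine (mu A) * r| <= eta * fine (mu A).
  move=> ih hr.
  have -> : fine (mu A) * r = \int[mu]_(v in A) cst r v by rewrite Rintegral_cst// mulrC.
  have ihr : mu.-integrable A (EFin \o (fun v => h v - cst r v)).
    change (mu.-integrable A (fun v => ((EFin \o h) v - (EFin \o cst r) v)%E)).
    by apply: integrableB.
  rewrite -RintegralB// -(Rintegral_cst mu mA).
  apply: le_trans (le_normr_Rintegral mA ihr) _.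
  by apply: le_Rintegral => //; [exact: (integrable_norm ihr)|exact: ic].
apply: le_trans (rnorm_le_ReIm _) _; rewrite -mulrA mulr_natl mulr2n.
case: c h1 h2 => a b /= h1 h2; rewrite /cintegral/= !mul0r subr0 addr0.
by apply: lerD; exact: H.
Qed.

(* Both sides being additive in [A], it suffices to prove the estimate, up to an
   error [O(eta) mu A], on pieces where all the [g n] oscillate by at most
   [eta]. *)
Lemma minkowski_finite (X : normedModType R[i]) A (N : nat) (g : nat -> T -> R[i])
    (x : nat -> X) (h : T -> R) :
  measurable A -> (mu A < +oo)%E -> (forall n, tame A (g n)) ->
  measurable_fun A h -> (forall v, A v -> 0 <= h v) ->
  (forall v, A v -> rnorm (\sum_(n < N) g n v *: x n) <= h v) ->
  ((rnorm (\sum_(n < N) cintegral A (g n) *: x n))%:E <= \int[mu]_(v in A) (h v)%:E)%E.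
Proof.
move=> mA fA tg mh h0 gh.
pose K := \sum_(n < N) rnorm (x n).
have K0 : 0 <= K by apply: sumr_ge0 => n _; exact: rnorm_ge0.
have subfin D : measurable D -> D `<=` A -> (mu D < +oo)%E.
  by move=> mD DA; apply: le_lt_trans fA; apply: le_measure; rewrite ?inE.
have h0' D : D `<=` A -> forall v, D v -> (0 <= (h v)%:E)%E.
  by move=> DA v /DA /h0; rewrite lee_fin.
have mh' D : measurable D -> D `<=` A -> measurable_fun D (EFin \o h).
  by move=> mD DA; apply/measurable_EFinP; exact: measurable_funS mh.
apply/lee_addgt0Pr => e e0.
(* The [1] keeps [M] positive; with [eta = e / M] the accumulated error [4 * eta * K * mu A] is at
   most [e]. *)
pose M := 4 * K * fine (mu A) + 1.
have M0 : 0 < M by rewrite ltr_wpDl// !mulr_ge0// fine_ge0.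
pose eta := e / M; have eta0 : 0 < eta by rewrite divr_gt0.
pose Q D := ((rnorm (\sum_(n < N) cintegral D (g n) *: x n))%:E <=
  \int[mu]_(v in D) (h v)%:E + (4 * eta * K * fine (mu D))%:E)%E.
suff : Q A.
  move=> /le_trans; apply; rewrite leeD2l// lee_fin.
  rewrite /eta (_ : _ * _ = e * (4 * K * fine (mu A) / M)); last by ring.
  rewrite -[leRHS]mulr1 ler_wpM2l ?(ltW e0)// ler_pdivrMr// mul1r /M lerDl.
  exact: ler01.
(* Real and imaginary parts are interleaved into one sequence of real functions; hence the count
   [N.*2]. *)
pose gr i := if odd i then (fun v => complex.Im (g i./2 v)) else (fun v => complex.Re (g i./2 v)).
apply: (@fine_partition _ _ _ A eta Q mA eta0 _ gr N.*2) => [D S mD mS DA| i|i|D mD DA osc].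
- have mDS := measurableI _ _ mD mS; have mDS' := measurableD mD mS.
  have sI : D `&` S `<=` A by move=> v [/DA].
  have sD : D `\` S `<=` A by move=> v [/DA].
  have dIS : [disjoint D `&` S & D `\` S].
    by apply/disj_set2P; rewrite setDE setIACA setICr setI0.
  have DE : D = (D `&` S) `|` (D `\` S) by rewrite setUIDK.
  rewrite /Q => q1 q2.
  have -> : \sum_(n < N) cintegral D (g n) *: x n =
      \sum_(n < N) cintegral (D `&` S) (g n) *: x n + \sum_(n < N) cintegral (D `\` S) (g n) *: x n.
    rewrite -big_split/=; apply: eq_bigr => n _; rewrite -scalerDl {1}DE cintegral_setU//.
      by rewrite -DE; exact: subfin.
    by rewrite -DE; apply: tame_sub (tg n).
  have -> : fine (mu D) = fine (mu (D `&` S)) + fine (mu (D `\` S)).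
    by rewrite {1}DE measureU// ?fineD// ?ge0_fin_numE ?subfin//; apply/disj_set2P.
  have -> : (\int[mu]_(v in D) (h v)%:E = \int[mu]_(v in D `&` S) (h v)%:E + \int[mu]_(v in D `\` S) (h v)%:E)%E.
    rewrite {1}DE ge0_integral_setU//; rewrite -DE; [exact: mh'|exact: h0'].
  apply: (@le_trans _ _ ((rnorm (\sum_(n < N) cintegral (D `&` S) (g n) *: x n))%:E +
    (rnorm (\sum_(n < N) cintegral (D `\` S) (g n) *: x n))%:E)%E).
    by rewrite -EFinD lee_fin rnormD.
  by apply: le_trans (leeD q1 q2) _; rewrite mulrDr EFinD addeACA.
- by rewrite /gr; have [m1 m2 _] := tg i./2; case: ifP.
- rewrite /gr; have [_ _ [L hL]] := tg i./2; exists L => v /hL; case: ifP => _; apply: le_trans;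
  by have [] := ReIm_le_rnorm (g i./2 v).
- have oscR n v w : (n < N)%N -> D v -> D w -> `|complex.Re (g n v) - complex.Re (g n w)| <= eta.
    move=> nN Dv Dw; have := osc n.*2; rewrite /gr odd_double doubleK ltn_double; exact.
  have oscI n v w : (n < N)%N -> D v -> D w -> `|complex.Im (g n v) - complex.Im (g n w)| <= eta.
    move=> nN Dv Dw; have := osc n.*2.+1; rewrite /gr/= odd_double/= uphalf_double.
    by rewrite -ltn_double in nN; rewrite -doubleS leq_double -ltn_double; apply.
  rewrite /Q; have [->|/set0P[v0 Dv0]] := eqVneq D set0.
    rewrite integral_set0 measure0 mulr0 adde0 big1 ?rnorm0// => n _.
    by rewrite cintegral_set0 scale0r.
  have fD := subfin _ mD DA; have mu0 : 0 <= fine (mu D) by rewrite fine_ge0.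
  have muE : ((fine (mu D))%:E = mu D)%E by rewrite fineK// ge0_fin_numE.
  pose c := rnorm (\sum_(n < N) g n v0 *: x n).
  have ch v : D v -> c <= h v + 2 * eta * K.
    move=> Dv; rewrite /c (_ : \sum_(n < N) _ = \sum_(n < N) g n v *: x n + \sum_(n < N) (g n v0 - g n v) *: x n).
      apply: le_trans (rnormD _ _) _; apply: lerD; first by apply: gh; exact: DA.
      apply: le_trans (rnorm_sum _ _ _) _; rewrite /K mulr_sumr; apply: ler_sum => n _.
      rewrite rnormZ ler_wpM2r ?rnorm_ge0//.
      apply: le_trans (rnorm_le_ReIm _) _; rewrite mulr_natl mulr2n.
      have := oscI n v0 v (ltn_ord n) Dv0 Dv; have := oscR n v0 v (ltn_ord n) Dv0 Dv.
      by case: (g n v0) (g n v) => [? ?] [? ?] /=; exact: lerD.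
    by rewrite -big_split; apply: eq_bigr => n _ /=; rewrite -scalerDl addrC subrK.
  have cmu : ((c * fine (mu D))%:E <= \int[mu]_(v in D) (h v)%:E + (2 * eta * K * fine (mu D))%:E)%E.
    have q0 : 0 <= 2 * eta * K by rewrite mulr_ge0// mulr_ge0// ltW.
    move: (2 * eta * K) ch q0 => q ch q0.
    rewrite !EFinM muE -!integral_cst// -ge0_integralD//.
    + apply: ge0_le_integral => //.
      * by move=> v _; rewrite lee_fin rnorm_ge0.
      * by apply: emeasurable_funD; [exact: mh'|exact: measurable_cst].
    + exact: h0'.
    + exact: mh'.
  apply: (@le_trans _ _ ((c * fine (mu D))%:E + (2 * eta * K * fine (mu D))%:E)%E).
    rewrite -EFinD lee_fin.
    rewrite (_ : \sum_(n < N) cintegral D (g n) *: x n = (fine (mu D))%:C *: (\sum_(n < N) g n v0 *: x n) +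
        \sum_(n < N) (cintegral D (g n) - (fine (mu D))%:C * g n v0) *: x n).
      apply: le_trans (rnormD _ _) _; rewrite rnormZ rnorm_real// -/c mulrC lerD2l.
      apply: le_trans (rnorm_sum _ _ _) _; rewrite [2 * eta * K * _]mulrAC /K mulr_sumr; apply: ler_sum => n _.
      rewrite rnormZ ler_wpM2r ?rnorm_ge0//.
      apply: cintegral_dist => // [|v Dv|v Dv].
      * exact: tame_sub (tg n).
      * exact: (oscR n).
      * exact: (oscI n).
    rewrite scaler_sumr -big_split; apply: eq_bigr => n _ /=.
    by rewrite scalerA -scalerDl addrC subrK.
  apply: le_trans (leeD2r _ cmu) _; rewrite -addeA -EFinD leeD2l// lee_fin.
  by rewrite le_eqVlt; apply/orP; left; apply/eqP; ring.
Qed.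

End complex_integral.

(** * The pairing with F *)

Lemma Rintegral_prod d1 d2 (T1 : measurableType d1) (T2 : measurableType d2) (R : realType)
    (m1 : {sigma_finite_measure set T1 -> \bar R}) (m2 : {sigma_finite_measure set T2 -> \bar R})
    (A : set T1) (B : set T2) (p : T1 -> R) (q : T2 -> R) :
  measurable A -> measurable B ->
  m1.-integrable A (EFin \o p) -> m2.-integrable B (EFin \o q) ->
  \int[(m1 \x m2)%E]_(v in A `*` B) (p v.1 * q v.2) =
  \int[m1]_(x in A) p x * \int[m2]_(y in B) q y.
Proof.
move=> mA mB ip iq; rewrite !(Rintegral_mkcond _ A) (Rintegral_mkcond _ B) (Rintegral_mkcond _ (A `*` B)).
set P := p \_ A; set Q := q \_ B.
have iP : m1.-integrable setT (EFin \o P) by rewrite /P -restrict_EFin -integrable_mkcond.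
have iQ : m2.-integrable setT (EFin \o Q) by rewrite /Q -restrict_EFin -integrable_mkcond.
have -> : (fun v => p v.1 * q v.2) \_ (A `*` B) = (fun v => P v.1 * Q v.2).
  apply/funext => -[x y]; rewrite /P /Q /patch/= in_setX/=.
  by case: (x \in A) (y \in B) => [] []; rewrite /= ?mul0r ?mulr0.
have mP : measurable_fun setT P by apply/measurable_EFinP; exact: measurable_int iP.
have mQ : measurable_fun setT Q by apply/measurable_EFinP; exact: measurable_int iQ.
have mPQ : measurable_fun [set: T1 * T2] (fun v => (P v.1 * Q v.2)%:E).
  apply/measurable_EFinP; apply: measurable_funM; first exact: (measurableT_comp mP).
  exact: (measurableT_comp mQ).
have fP := integrable_fin_num measurableT iP; have fQ := integrable_fin_num measurableT iQ.
have iPQ : (m1 \x m2)%E.-integrable setT (fun v => (P v.1 * Q v.2)%:E).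
  apply/(integrable12ltyP _ _ mPQ).
  have nQ := integrable_fin_num measurableT (integrable_abse iQ).
  rewrite (eq_integral (fun x => ((fine (\int[m2]_y `|(Q y)%:E|)%E)%:E * `|(P x)%:E|)%E)).
    rewrite integralZl//; last exact: integrable_abse iP.
    have nP := integrable_fin_num measurableT (integrable_abse iP).
    rewrite -(fineK nP) -EFinM; exact: ltry.
  move=> x _; rewrite fineK// muleC -integralZl//; last exact: integrable_abse iQ.
  by apply: eq_integral => y _; rewrite /= -EFinM normrM.
rewrite {1}/Rintegral -(integral12_prod_meas1 iPQ) /fubini_F/=.
rewrite (eq_integral (fun x => ((fine (\int[m2]_y (Q y)%:E)%E)%:E * (P x)%:E)%E)).
  by rewrite integralZl// -(fineK fP) -EFinM/= mulrC.
move=> x _; by rewrite fineK// muleC -integralZl.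
Qed.

Section pairing.
Variables (R : realType) (lam al : R).
Hypotheses (lam_ge0 : 0 <= lam) (al_gtN1 : -1 < al).
Let mu2 := (@lebesgue_measure R \x @lebesgue_measure R)%E.

Definition polar_point (v : R * R) : R[i] := (v.1 * cos v.2) +i* (v.1 * sin v.2).

(** Polar coordinates of the open upper half plane within radius [r]. *)
Definition sector (r : R) : set (R * R) := `]0, r] `*` `]0, pi[.

(* The two terms are the contributions of a point and of its conjugate, so that
   only the upper half disk is used. *)
Definition pairing_density (n : nat) (f : R[i] -> R[i]) (v : R * R) : R[i] :=
  (f (polar_point v) * phi lam n ((polar_point v)^*)%C +
   f ((polar_point v)^*)%C * phi lam n (polar_point v)) * (polar_weight (2 * lam) al v)%:C.

Definition pairing (n : nat) (D : set (R * R)) (f : R[i] -> R[i]) : R[i] :=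
  cintegral (@lebesgue_measure R \x @lebesgue_measure R)%E D (pairing_density n f).

Definition polar_tame (f : R[i] -> R[i]) : Prop := forall r, 0 < r < 1 ->
  tame (sector r) (fun v => f (polar_point v)) /\
  tame (sector r) (fun v => f ((polar_point v)^*)%C).

Lemma measurable_sector r : measurable (sector r).
Proof. by apply: measurableX; exact: measurable_itv. Qed.

Lemma sector_finite r : (mu2 (sector r) < +oo)%E.
Proof.
rewrite /mu2 /sector product_measure1E; [|exact: measurable_itv|exact: measurable_itv].
have p0 := pi_gt0 R.
rewrite [X in (X * _)%E]lebesgue_measure_itv [X in (_ * X)%E]lebesgue_measure_itv/=.
by case: ifP => _; rewrite ?mul0e ?lte_fin ?p0 -?EFinB -?EFinM ltry.
Qed.

Lemma rnorm_polar_point v : 0 <= v.1 -> rnorm (polar_point v) = v.1.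
Proof.
by move=> v0; rewrite rnormE !exprMn -mulrDr cos2Dsin2 mulr1 sqrtr_sqr ger0_norm.
Qed.

Lemma polar_tame_phi n : polar_tame (phi lam n).
Proof.
move=> r /andP[r0 r1].
have [cU cV] := phi_cos_sin_continuous lam n.
have m1 : measurable_fun (sector r) (fun v : R * R => v.1).
  by apply: measurable_funTS; exact: measurable_fst.
have m2 (u : R -> R) : continuous u -> measurable_fun (sector r) (fun v : R * R => u v.2).
  move=> cu; apply: measurable_funTS; apply: (measurableT_comp (continuous_measurable_fun cu)).
  exact: measurable_snd.
have E v : phi lam n (polar_point v) = (phi_norm lam n * (v.1 ^+ n * phi_cos lam n v.2)) +i*
    (phi_norm lam n * (v.1 ^+ n * phi_sin lam n v.2)).
  rewrite phiE phi_poly_polar//; apply/eqP; rewrite eq_complex/=.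
  by rewrite !mul0r subr0 addr0 !eqxx.
have EJ v : phi lam n ((polar_point v)^*)%C = (phi_norm lam n * (v.1 ^+ n * phi_cos lam n v.2)) -i*
    (phi_norm lam n * (v.1 ^+ n * phi_sin lam n v.2)).
  rewrite phiE phi_polyJ phi_poly_polar//; apply/eqP; rewrite eq_complex/=.
  by rewrite !mul0r subr0 addr0 mulrN !eqxx.
have B v : sector r v -> rnorm (polar_point v) ^+ n / phi_norm lam n <= (phi_norm lam n)^-1.
  move=> [/=]; rewrite in_itv/= => /andP[v0 v1] _.
  rewrite -[leRHS]mul1r ler_wpM2r ?invr_ge0 ?(ltW (phi_norm_gt0 n lam_ge0))//.
  by rewrite rnorm_polar_point ?(ltW v0)// exprn_ile1 ?(ltW v0)// (le_trans v1)// ltW.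
split; split.
- apply: (eq_measurable_fun (fun v : R * R => phi_norm lam n * (v.1 ^+ n * phi_cos lam n v.2))).
    by move=> v _; rewrite E.
  by apply: measurable_funM => //; apply: measurable_funM; [exact: measurable_funX|exact: m2].
- apply: (eq_measurable_fun (fun v : R * R => phi_norm lam n * (v.1 ^+ n * phi_sin lam n v.2))).
    by move=> v _; rewrite E.
  by apply: measurable_funM => //; apply: measurable_funM; [exact: measurable_funX|exact: m2].
- by exists (phi_norm lam n)^-1 => v /B; apply: le_trans; exact: rnorm_phi_le.
- apply: (eq_measurable_fun (fun v : R * R => phi_norm lam n * (v.1 ^+ n * phi_cos lam n v.2))).
    by move=> v _; rewrite EJ.
  by apply: measurable_funM => //; apply: measurable_funM; [exact: measurable_funX|exact: m2].
- apply: (eq_measurable_fun (fun v : R * R => - phi_norm lam n * (v.1 ^+ n * phi_sin lam n v.2))).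
    by move=> v _; rewrite EJ mulNr.
  by apply: measurable_funM => //; apply: measurable_funM; [exact: measurable_funX|exact: m2].
- exists (phi_norm lam n)^-1 => v /B; apply: le_trans; rewrite -(rnormJ (polar_point v)).
  exact: rnorm_phi_le.
Qed.

Lemma polar_tame_linear (a : R[i]) f g : polar_tame f -> polar_tame g ->
  polar_tame (fun z => a * f z + g z).
Proof.
move=> tf tg r r01; have [f1 f2] := tf r r01; have [g1 g2] := tg r r01.
by split; apply: tameD => //; apply: tameM => //; exact: tame_cst.
Qed.

Lemma polar_weight_radial v :
  polar_weight (2 * lam) al v = radial_weight lam al v.1 * sin v.2 `^ (2 * lam).
Proof. by []. Qed.

Lemma polar_weight_ge0 v : 0 <= polar_weight (2 * lam) al v.
Proof. by rewrite /polar_weight !mulr_ge0 ?powR_ge0. Qed.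

Lemma tame_polar_weight r : 0 < r < 1 ->
  tame (sector r) (fun v => (polar_weight (2 * lam) al v)%:C).
Proof.
move=> /andP[r0 r1]; split; [|exact: measurable_cst|].
  apply: measurable_funTS; apply: measurable_funM.
    exact: (measurableT_comp (measurable_radial_weight lam al)).
  apply: (measurableT_comp (measurable_powR _)).
  apply: (measurableT_comp (continuous_measurable_fun (@continuous_sin R))).
  exact: measurable_snd.
exists (1 + (1 - r ^+ 2) `^ al) => v [/=]; rewrite in_itv/= => /andP[v0 v1] _.
rewrite rnorm_real ?polar_weight_ge0// polar_weight_radial -[leRHS]mulr1.
apply: ler_pM; rewrite ?radial_weight_ge0 ?powR_ge0 ?sin_powR_le1 ?mulr_ge0//.
by apply: radial_weight_bounded; rewrite ?(ltW r0) ?(ltW v0).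
Qed.

Lemma tame_pairing_density n f r : 0 < r < 1 -> polar_tame f ->
  tame (sector r) (pairing_density n f).
Proof.
move=> r01 tf; have [f1 f2] := tf r r01; have [p1 p2] := polar_tame_phi n r01.
by apply: tameM; [apply: tameD; exact: tameM|exact: tame_polar_weight].
Qed.

Lemma sector_sub_finite r D : measurable D -> D `<=` sector r -> (mu2 D < +oo)%E.
Proof.
move=> mD Dr; apply: le_lt_trans (sector_finite r).
by apply: le_measure => //; rewrite inE//; exact: measurable_sector.
Qed.

Lemma pairing_linear n r D (a : R[i]) f g : 0 < r < 1 -> measurable D -> D `<=` sector r ->
  polar_tame f -> polar_tame g ->
  pairing n D (fun z => a * f z + g z) = a * pairing n D f + pairing n D g.
Proof.
move=> r01 mD Dr tf tg; rewrite /pairing.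
have tD h : polar_tame h -> tame D (pairing_density n h).
  by move=> th; apply: tame_sub (tame_pairing_density n r01 th) => //; exact: measurable_sector.
rewrite -cintegral_linear//; [|exact: sector_sub_finite Dr|exact: tD|exact: tD].
have key (f1 f2 g1 g2 p1 p2 u : R[i]) : ((a * f1 + g1) * p1 + (a * f2 + g2) * p2) * u =
    a * ((f1 * p1 + f2 * p2) * u) + (g1 * p1 + g2 * p2) * u by ring.
by congr cintegral; apply/funext => v; exact: key.
Qed.

(** As [phi] commutes with conjugation, the two terms of the density are conjugate and add up to
    twice a real part, which separates into a radial and an angular factor. By [angular_norm] the
    angular constant does not depend on [n]. *)
Lemma pairing_phi m n r : 0 < r < 1 ->
  pairing n (sector r) (phi lam m) =
  if m == n then (2 * angular lam 0 0 * radial lam al (2 * n) r)%:C else 0.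
Proof.
move=> /andP[r0 r1].
pose c := 2 * phi_norm lam m * phi_norm lam n.
pose q th := (phi_cos lam m th * phi_cos lam n th + phi_sin lam m th * phi_sin lam n th) * sin th `^ (2 * lam).
have E v : pairing_density n (phi lam m) v =
    (c * (v.1 ^+ (m + n) * radial_weight lam al v.1 * q v.2))%:C.
  rewrite /pairing_density polar_weight_radial !phiE !phi_polyJ !phi_poly_polar//.
  rewrite exprD /c /q; apply/eqP; rewrite eq_complex/=; apply/andP; split; apply/eqP; ring.
pose p t := t ^+ (m + n) * radial_weight lam al t.
have i1 : (@lebesgue_measure R).-integrable `]0, r] (EFin \o p).
  have h : (@lebesgue_measure R).-integrable `[0, r] (EFin \o p) by exact: radial_integrable.
  apply: integrableS h; try exact: measurable_itv.
  by move=> t /=; rewrite !in_itv/= => /andP[/ltW-> ->].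
have i2' := angular_integrable lam_ge0 m n.
have i2 : (@lebesgue_measure R).-integrable `]0, pi[ (EFin \o q).
  apply: integrableS i2'; try exact: measurable_itv.
  by move=> t /=; rewrite !in_itv/= => /andP[/ltW-> /ltW->].
have i3 : (@lebesgue_measure R).-integrable `[0, pi[ (EFin \o q).
  apply: integrableS i2'; try exact: measurable_itv.
  by move=> t /=; rewrite !in_itv/= => /andP[-> /ltW->].
have -> : pairing n (sector r) (phi lam m) = (c * (radial lam al (m + n) r * angular lam m n))%:C.
  rewrite /pairing /cintegral; apply/eqP; rewrite eq_complex/=; apply/andP; split; apply/eqP.
    under eq_Rintegral do rewrite E/=.
    have <- : \int[@lebesgue_measure R]_(t in `]0, r]) p t =
        radial lam al (m + n) r by rewrite (Rintegral_itv_obnd_cbnd i1).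
    have <- : \int[@lebesgue_measure R]_(th in `]0, pi[) q th = angular lam m n.
      by rewrite (Rintegral_itv_obnd_cbnd i2) (Rintegral_itv_bndo_bndc i3).
    have icp : (@lebesgue_measure R).-integrable `]0, r] (EFin \o (fun t => c * p t)).
      change ((@lebesgue_measure R).-integrable `]0, r] (fun t => (c%:E * (EFin \o p) t)%E)).
      by apply: integrableZl; [exact: measurable_itv|exact: i1].
    transitivity (\int[(@lebesgue_measure R \x @lebesgue_measure R)%E]_(v in sector r) ((c * p v.1) * q v.2)).
      by apply: eq_Rintegral => v _; rewrite -!mulrA.
    have H := @Rintegral_prod _ _ _ _ R (@lebesgue_measure R) (@lebesgue_measure R) `]0, r] `]0, pi[
      _ _ (measurable_itv _) (measurable_itv _) icp i2.
    apply: etrans H _.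
    rewrite RintegralZl; [|exact: measurable_itv|exact: i1].
    by rewrite -mulrA.
  under eq_Rintegral do rewrite E/=.
  by rewrite Rintegral_cst ?mul0r//; exact: measurable_sector.
case: eqVneq => [mn|mn]; last by rewrite angular_orth// !mulr0.
subst m.
rewrite addnn -mul2n /c -(angular_norm lam_ge0 n); congr (_%:C); ring.
Qed.

End pairing.

(** * Limits in [X] through real norms *)

Section rnorm_limits.
Variables (R : realType) (X : completeNormedModType R[i]).
Implicit Types (u : nat -> X) (l : X).

Let complex_gt0 (e : R[i]) : 0 < e -> exists2 d : R, 0 < d & e = d%:C.
Proof.
case: e => a b; rewrite ltcE/= => /andP[/eqP b0 a0]; exists a => //.
by rewrite b0.
Qed.

Lemma cvg_rnormP u l :
  u @ \oo --> l <-> forall e, 0 < e -> \forall n \near \oo, rnorm (l - u n) <= e.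
Proof.
rewrite (@pseudometric_normed_Zmodule.cvgrPdist_le _ X); split => h e e0.
  have := h e%:C; rewrite ltcR => /(_ e0); apply: filterS => n.
  by rewrite -rnormK lecR.
have [d d0 ->] := complex_gt0 e0; have := h d d0; apply: filterS => n.
by rewrite -rnormK lecR.
Qed.

Lemma rnorm_cauchy_cvg u :
  (forall e, 0 < e -> exists N, \forall n \near \oo, rnorm (u N - u n) <= e) -> cvgn u.
Proof.
move=> h; apply: cauchy_cvg; apply: cauchy_exP => e e0.
have [d d0 eE] := complex_gt0 e0.
have [|N hN] := h (d / 2); first by rewrite divr_gt0.
exists (u N); rewrite nbhs_simpl/=; move: hN; apply: filterS => n hn.
rewrite -ball_normE/= -rnormK eE ltcR; apply: le_lt_trans hn _.
by rewrite ltr_pdivrMr// ltr_pMr// ltr1n.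
Qed.

Lemma rnorm_lim_le u l (B : R) : u @ \oo --> l -> (forall n, rnorm (u n) <= B) -> rnorm l <= B.
Proof.
move=> /cvg_rnormP ul uB; apply/ler_addgt0Pr => e e0.
have [N _ hN] := ul e e0; have := hN N (leqnn N) => h.
rewrite -(subrK (u N) l) addrC; apply: le_trans (rnormD _ _) _.
by apply: lerD.
Qed.

(** [G] is nondecreasing and bounded, hence Cauchy, and dominates the increments of [u]. It is meant
    for integrals over growing sectors. *)
Lemma rnorm_increment_cvg u (G : nat -> R) (B : R) :
  (forall i j, (i <= j)%N -> rnorm (u j - u i) <= G j - G i) -> (forall n, G n <= B) ->
  cvgn u.
Proof.
move=> uG GB; have Gnd : nondecreasing_seq G.
  by move=> i j ij; rewrite -subr_ge0; apply: le_trans (uG i j ij); exact: rnorm_ge0.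
have Gc : cvgn G.
  by apply: nondecreasing_is_cvgn => //; exists B => _ [n _ <-].
apply: rnorm_cauchy_cvg => e e0.
have /cvgrPdist_le/(_ e e0) [N _ hN] := Gc.
exists N; exists N => // n Nn; rewrite rnorm_distC; apply: le_trans (uG _ _ Nn) _.
have := hN N (leqnn N); rewrite /= => /(le_trans (ler_norm _)); apply: le_trans.
by rewrite lerD2r; exact: nondecreasing_cvgn_le.
Qed.

End rnorm_limits.

Lemma continuous_rnorm (R : realType) (P : R * R -> R[i]) v :
  {for v, continuous (fun v => complex.Re (P v))} ->
  {for v, continuous (fun v => complex.Im (P v))} ->
  {for v, continuous (fun v => rnorm (P v))}.
Proof.
move=> c1 c2.
rewrite (_ : (fun v => rnorm (P v)) =
  Num.sqrt \o (fun v => complex.Re (P v) ^+ 2 + complex.Im (P v) ^+ 2)); last first.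
  by apply/funext => z; rewrite rnorm_sqrt.
apply: continuous_comp; last exact: sqrt_continuous.
by rewrite /=; apply: cvgD; apply: cvgM.
Qed.

Section X_sum_uniform.
Variables (R : realType) (X : completeNormedModType R[i]) (lam : R) (x : nat -> X).
Hypothesis x_an : X_lambda_analytic lam x.

(** Locally uniform convergence on the disk becomes uniform along [P] by compactness of the
    parameter set [K]: the points of [K] near a given [v] are sent into the neighbourhood supplied
    for [P v]. *)
Lemma X_sum_uniform (P : R * R -> R[i]) (K : set (R * R)) : compact K ->
  (forall v, K v -> {for v, continuous (fun v => complex.Re (P v))}) ->
  (forall v, K v -> {for v, continuous (fun v => complex.Im (P v))}) ->
  (forall v, K v -> unit_disk (P v)) ->
  forall e, 0 < e -> \forall N \near \oo, forall v, K v ->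
    rnorm (X_sum lam x (P v) - X_partial_sum lam x N (P v)) <= e.
Proof.
move=> /compact_near_coveringP cK cR cI dP e e0.
apply: (cK nat \oo (fun N v => rnorm (X_sum lam x (P v) - X_partial_sum lam x N (P v)) <= e)) => v Kv.
have [r r0 u] := x_an (dP v Kv).
have /u : nbhs (X_sum lam x : {uniform` [set u | unit_disk u /\ rnorm (u - P v) < r] -> X})
    [set g | forall y, unit_disk y /\ rnorm (y - P v) < r -> rnorm (X_sum lam x y - g y) <= e].
  apply/uniform_nbhs; exists [set xy | ball xy.1 e%:C xy.2]; split.
    by rewrite -entourage_ballE; exists e%:C; rewrite //= ltcR.
  move=> g /= h y /h; rewrite -ball_normE/= -rnormK ltcR; exact: ltW.
move=> [N _ hN].
have c1 := continuous_rnorm (cR v Kv) (cI v Kv).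
have c2 : {for v, continuous (fun v' => rnorm (P v' - P v))}.
  apply: (@continuous_rnorm _ (fun v' => P v' - P v)) => /=.
    rewrite (_ : (fun _ => _) = (fun v' => complex.Re (P v') - complex.Re (P v))); last first.
      by apply/funext => v'; case: (P v') (P v) => [? ?] [? ?].
    by apply: cvgB; [exact: cR|exact: cvg_cst].
  rewrite (_ : (fun _ => _) = (fun v' => complex.Im (P v') - complex.Im (P v))); last first.
    by apply/funext => v'; case: (P v') (P v) => [? ?] [? ?].
  by apply: cvgB; [exact: cI|exact: cvg_cst].
have n1 : \forall v' \near v, rnorm (P v') < 1.
  by apply: cvgr_lt c1 _ _; exact: dP.
have n2 : \forall v' \near v, rnorm (P v' - P v) < r.
  by apply: cvgr_lt c2 _ _; rewrite subrr rnorm0.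
exists ([set v' | rnorm (P v') < 1 /\ rnorm (P v' - P v) < r], [set n | (N <= n)%N]).
  by split; [exact: filterI|exists N].
by move=> [v' n] [/= [h1 h2] Nn]; exact: hN.
Qed.

End X_sum_uniform.

Lemma tame_rnorm d (T : measurableType d) (R : realType) (A : set T) (g : T -> R[i]) :
  tame A g -> measurable_fun A (fun v => rnorm (g v)).
Proof.
move=> [m1 m2 _].
rewrite (_ : (fun _ => _) = (fun v => Num.sqrt (complex.Re (g v) ^+ 2 + complex.Im (g v) ^+ 2))); last first.
  by apply/funext => z; rewrite rnorm_sqrt.
apply: (measurableT_comp (continuous_measurable_fun (@sqrt_continuous R))).
by apply: measurable_funD; apply: measurable_funX.
Qed.

Lemma polar_point_continuous (R : realType) (v : R * R) :
  {for v, continuous (fun v : R * R => v.1 * cos v.2)} /\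
  {for v, continuous (fun v : R * R => v.1 * sin v.2)}.
Proof.
split; apply: cvgM; try exact: cvg_fst.
  by apply: (@continuous_comp _ _ _ (fun v : R * R => v.2)); [exact: cvg_snd|exact: continuous_cos].
by apply: (@continuous_comp _ _ _ (fun v : R * R => v.2)); [exact: cvg_snd|exact: continuous_sin].
Qed.

(** * Integration against the series of F *)

Section integral_operator.
Variables (R : realType) (X : completeNormedModType R[i]) (lam al : R) (x : nat -> X).
Hypotheses (lam_ge0 : 0 <= lam) (x_an : X_lambda_analytic lam x).
Let mu2 := (@lebesgue_measure R \x @lebesgue_measure R)%E.
Let F N z := X_partial_sum lam x N z.
Let wt := @polar_weight R (2 * lam) al.
Implicit Types (D : set (R * R)) (f : R[i] -> R[i]) (r : R).

Definition pair_amp f (v : R * R) : R :=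
  rnorm (f (polar_point v)) + rnorm (f ((polar_point v)^*)%C).

Definition pairing_sum (N : nat) D f : X := \sum_(n < N) pairing lam al n D f *: x n.

Definition pairing_op D f : X := limn (fun N => pairing_sum N D f).

Let pairing_density_sum N f v : \sum_(n < N) pairing_density lam al n f v *: x n =
  (wt v)%:C *: (f (polar_point v) *: F N ((polar_point v)^*)%C +
                f ((polar_point v)^*)%C *: F N (polar_point v)).
Proof.
rewrite /F /X_partial_sum !scaler_sumr -big_split/= scaler_sumr; apply: eq_bigr => n _.
by rewrite !scalerA -scalerDl scalerA mulrC.
Qed.

Let pair_amp_ge0 f v : 0 <= pair_amp f v.
Proof. by rewrite addr_ge0 ?rnorm_ge0. Qed.

Let wt_ge0 v : 0 <= wt v. Proof. exact: polar_weight_ge0. Qed.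

Let measurable_pair_amp f r D : 0 < r < 1 -> measurable D -> D `<=` sector r -> polar_tame f ->
  measurable_fun D (pair_amp f).
Proof.
move=> r01 mD Dr tf; have [f1 f2] := tf r r01.
by apply: measurable_funS (measurable_sector r) Dr _; apply: measurable_funD; exact: tame_rnorm.
Qed.

Let measurable_wt r D : 0 < r < 1 -> measurable D -> D `<=` sector r -> measurable_fun D wt.
Proof.
move=> r01 mD Dr; have [m _ _] := tame_polar_weight al lam_ge0 r01.
exact: measurable_funS (measurable_sector r) Dr m.
Qed.

Let combine_le (u psi : R) (a b : R[i]) (p p' q q' : X) : 0 <= u ->
  rnorm (p - p') <= psi -> rnorm (q - q') <= psi ->
  rnorm (u%:C *: (a *: p + b *: q) - u%:C *: (a *: p' + b *: q')) <= (rnorm a + rnorm b) * psi * u.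
Proof.
move=> u0 hp hq; rewrite -scalerBr rnormZ rnorm_real// mulrC ler_wpM2r//.
rewrite opprD addrACA -!scalerBr.
apply: le_trans (rnormD _ _) _; rewrite !rnormZ mulrDl.
by apply: lerD; rewrite ler_wpM2l ?rnorm_ge0.
Qed.

(** It serves twice: with a constant [Psi] for the Cauchy property of the partial sums, and with
    [N = 0] for the norm of one of them. *)
Let pairing_sum_bound N M D r (Psi : R * R -> R) f :
  0 < r < 1 -> measurable D -> D `<=` sector r -> polar_tame f -> (N <= M)%N ->
  measurable_fun D Psi -> (forall v, D v -> 0 <= Psi v) ->
  (forall v, D v -> rnorm (F M (polar_point v) - F N (polar_point v)) <= Psi v) ->
  (forall v, D v -> rnorm (F M ((polar_point v)^*)%C - F N ((polar_point v)^*)%C) <= Psi v) ->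
  ((rnorm (pairing_sum M D f - pairing_sum N D f))%:E <=
   \int[mu2]_(v in D) (pair_amp f v * Psi v * wt v)%:E)%E.
Proof.
move=> r01 mD Dr tf NM mPsi Psi0 h1 h2.
(* Replacing the first [N] vectors by zero turns a difference of partial sums into one finite
   combination, to which [minkowski_finite] applies. *)
pose y n := if (N <= n)%N then x n else 0.
have sumE (c : nat -> R[i]) :
    \sum_(n < M) c n *: y n = \sum_(n < M) c n *: x n - \sum_(n < N) c n *: x n.
  rewrite -!(big_mkord xpredT (fun n => c n *: _ n)) (big_cat_nat (leq0n N) NM)/=.
  rewrite [in RHS](big_cat_nat (leq0n N) NM)/= addrC addrAC subrr add0r.
  rewrite [X in _ + X = _]big1_seq ?addr0 => [|n /andP[_]]; last first.
    by rewrite mem_index_iota => /andP[_ nN]; rewrite /y leqNgt nN scaler0.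
  by apply: eq_big_nat => n /andP[Nn _]; rewrite /y Nn.
have := sumE (fun n => pairing lam al n D f); rewrite /pairing_sum => <-.
have := @minkowski_finite _ _ R (@lebesgue_measure R \x @lebesgue_measure R)%E X D M
  (fun n => pairing_density lam al n f) y (fun v => pair_amp f v * Psi v * wt v).
apply => //.
- exact: sector_sub_finite Dr.
- move=> n; apply: (tame_sub _ _ _ (tame_pairing_density al lam_ge0 n r01 tf)) => //.
  exact: measurable_sector.
- apply: measurable_funM; last exact: measurable_wt Dr.
  by apply: measurable_funM => //; exact: measurable_pair_amp Dr tf.
- by move=> v Dv; rewrite mulr_ge0 ?wt_ge0// mulr_ge0 ?pair_amp_ge0 ?Psi0.
move=> v Dv; have := sumE (fun n => pairing_density lam al n f v) => /= ->.
rewrite !pairing_density_sum; exact: combine_le (wt_ge0 v) (h2 v Dv) (h1 v Dv).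
Qed.

Let mass_integrable D r f : 0 < r < 1 -> measurable D -> D `<=` sector r -> polar_tame f ->
  mu2.-integrable D (EFin \o (fun v => pair_amp f v * wt v)).
Proof.
move=> r01 mD Dr tf.
have [[_ _ [A hA]] [_ _ [B hB]]] := tf r r01.
have [_ _ [W hW]] := tame_polar_weight al lam_ge0 r01.
apply: (bounded_integrable (M := (A + B) * W)) => //.
- exact: sector_sub_finite Dr.
- by apply: measurable_funM; [exact: measurable_pair_amp Dr tf|exact: measurable_wt Dr].
move=> v /Dr sv; rewrite ger0_norm; last by apply: mulr_ge0; [exact: pair_amp_ge0|exact: wt_ge0].
apply: ler_pM; rewrite ?pair_amp_ge0 ?wt_ge0//.
  by apply: lerD; [exact: hA|exact: hB].
by have := hW _ sv; rewrite rnorm_real ?polar_weight_ge0.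
Qed.

Let mass D f : R := \int[mu2]_(v in D) (pair_amp f v * wt v).

Let mass_ge0 D f : 0 <= mass D f.
Proof. by apply: Rintegral_ge0 => v _; rewrite mulr_ge0 ?pair_amp_ge0 ?wt_ge0. Qed.

Let mass_scale D r f (delta : R) : 0 < r < 1 -> measurable D -> D `<=` sector r -> polar_tame f ->
  (\int[mu2]_(v in D) (pair_amp f v * delta * wt v)%:E = (delta * mass D f)%:E)%E.
Proof.
move=> r01 mD Dr tf; have im := mass_integrable r01 mD Dr tf.
rewrite /mass EFinM fineK; last exact: integrable_fin_num.
rewrite -integralZl//; apply: eq_integral => v _ /=.
by rewrite -EFinM mulrAC mulrC.
Qed.

Let share_le (m e : R) : 0 <= m -> 0 <= e -> 2 * (e / (2 * (m + 1))) * m <= e.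
Proof.
move=> m0 e0; have m1 : 0 < m + 1 by rewrite ltr_wpDl.
rewrite (_ : _ * m = e * (m / (m + 1))); last by field; rewrite gt_eqF.
by rewrite -[leRHS]mulr1 ler_wpM2l// ler_pdivrMr// mul1r lerDl.
Qed.

(** The sector is enlarged to the compact rectangle [[0, r]] times [[0, pi]], whose image still lies
    inside the open disk. *)
Lemma sector_X_sum_uniform r e : 0 < r < 1 -> 0 < e -> \forall N \near \oo, forall v, sector r v ->
  rnorm (X_sum lam x (polar_point v) - F N (polar_point v)) <= e /\
  rnorm (X_sum lam x ((polar_point v)^*)%C - F N ((polar_point v)^*)%C) <= e.
Proof.
move=> /andP[r0 r1] e0; pose K : set (R * R) := `[0, r] `*` `[0, pi].
have cK : compact K by apply: compact_setX; exact: segment_compact.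
have KD v : K v -> unit_disk (polar_point v).
  move=> [/=]; rewrite !in_itv/= => /andP[v0 v1] _.
  by rewrite /unit_disk/= rnorm_polar_point// (le_lt_trans v1).
have sK v : sector r v -> K v.
  by move=> [/=]; rewrite !in_itv/= => /andP[/ltW ? ?] /andP[/ltW ? /ltW ?]; split; rewrite /= in_itv/=; apply/andP.
have u1 : \forall N \near \oo, forall v, K v ->
    rnorm (X_sum lam x (polar_point v) - F N (polar_point v)) <= e.
  apply: (@X_sum_uniform _ _ _ _ x_an (@polar_point R)) => // v Kv.
  - exact: (polar_point_continuous v).1.
  - exact: (polar_point_continuous v).2.
have u2 : \forall N \near \oo, forall v, K v ->
    rnorm (X_sum lam x ((polar_point v)^*)%C - F N ((polar_point v)^*)%C) <= e.
  apply: (@X_sum_uniform _ _ _ _ x_an (fun v => ((polar_point v)^*)%C)); [exact: cK| | | |exact: e0] => v Kv.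
  - exact: (polar_point_continuous v).1.
  - by apply: cvgN; exact: (polar_point_continuous v).2.
  - by change (is_true (rnorm ((polar_point v)^*)%C < 1)); rewrite rnormJ; exact: KD.
by apply: filterS2 u1 u2 => N h1 h2 v /sK Kv; split; [exact: h1|exact: h2].
Qed.

Lemma pairing_sum_cvg D r f : 0 < r < 1 -> measurable D -> D `<=` sector r -> polar_tame f ->
  pairing_sum N D f @[N --> \oo] --> pairing_op D f.
Proof.
move=> r01 mD Dr tf; apply: rnorm_cauchy_cvg => e e0.
pose delta := e / (2 * (mass D f + 1)).
have m1 : 0 < 2 * (mass D f + 1) by rewrite mulr_gt0// ltr_wpDl// mass_ge0.
have d0 : 0 < delta by rewrite divr_gt0.
have [N _ hN] := sector_X_sum_uniform r01 d0.
exists N; exists N => // n Nn; rewrite rnorm_distC.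
rewrite -lee_fin.
have tri (a b c : X) : rnorm (a - b) <= delta -> rnorm (a - c) <= delta -> rnorm (b - c) <= 2 * delta.
  move=> ab ac; rewrite -(subrK a b) -addrA mulr_natl mulr2n.
  by apply: le_trans (rnormD _ _) _; apply: lerD => //; rewrite rnorm_distC.
apply: le_trans (@pairing_sum_bound N n D r (fun=> 2 * delta) f r01 mD Dr tf Nn _ _ _ _) _.
- exact: measurable_cst.
- by move=> v _; rewrite mulr_ge0// ltW.
- move=> v Dv; have [h _] := hN n Nn v (Dr v Dv); have [h' _] := hN N (leqnn N) v (Dr v Dv).
  exact: tri h h'.
- move=> v Dv; have [_ h] := hN n Nn v (Dr v Dv); have [_ h'] := hN N (leqnn N) v (Dr v Dv).
  exact: tri h h'.
rewrite (mass_scale _ r01 mD Dr tf) lee_fin.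
exact: share_le (mass_ge0 D f) (ltW e0).
Qed.

(** For large [N] the partial sums of the series are bounded by [Psi + delta], uniformly on [D].
    Half of [e] pays for [delta], the other half for the distance from the partial pairing to its
    limit. *)
Lemma pairing_op_bound D r f (Psi : R * R -> R) :
  0 < r < 1 -> measurable D -> D `<=` sector r -> polar_tame f ->
  measurable_fun D Psi ->
  (forall v, D v -> rnorm (X_sum lam x (polar_point v)) <= Psi v) ->
  (forall v, D v -> rnorm (X_sum lam x ((polar_point v)^*)%C) <= Psi v) ->
  ((rnorm (pairing_op D f))%:E <= \int[mu2]_(v in D) (pair_amp f v * Psi v * wt v)%:E)%E.
Proof.
move=> r01 mD Dr tf mPsi h1 h2; apply/lee_addgt0Pr => e e0.
have Psi0 v : D v -> 0 <= Psi v by move=> /h1; apply: le_trans; exact: rnorm_ge0.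
pose delta := e / (2 * (mass D f + 1)).
have m1 : 0 < 2 * (mass D f + 1) by rewrite mulr_gt0// ltr_wpDl// mass_ge0.
have d0 : 0 < delta by rewrite divr_gt0.
have e20 : 0 < e / 2 by rewrite divr_gt0.
have [N1 _ hN1] := sector_X_sum_uniform r01 d0.
have [N2 _ hN2] := (cvg_rnormP _ _).1 (pairing_sum_cvg r01 mD Dr tf) _ e20.
pose N := maxn N1 N2.
have uN := hN1 N (leq_maxl _ _); have oN := hN2 N (leq_maxr _ _).
have F0 z : F 0 z = 0 by rewrite /F /X_partial_sum big_ord0.
have s0 : pairing_sum 0 D f = 0 by rewrite /pairing_sum big_ord0.
have tri (a b : X) c : rnorm a <= c -> rnorm (a - b) <= delta -> rnorm (b - 0) <= c + delta.
  move=> ac ab; rewrite subr0 -(subrK a b) addrC; apply: le_trans (rnormD _ _) _.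
  by apply: lerD => //; rewrite rnorm_distC.
have B := @pairing_sum_bound 0 N D r (fun v => Psi v + delta) f r01 mD Dr tf (leq0n N).
have mPsid : measurable_fun D (fun v => Psi v + delta).
  by apply: measurable_funD => //; exact: measurable_cst.
have {}B := B mPsid; rewrite s0 subr0 in B.
apply: (@le_trans _ _ ((rnorm (pairing_sum N D f))%:E + (e / 2)%:E)%E).
  rewrite -EFinD lee_fin -(subrK (pairing_sum N D f) (pairing_op D f)) addrC.
  by apply: le_trans (rnormD _ _) _; rewrite lerD2l.
rewrite [in leRHS](splitr e) EFinD addeA leeD2r//.
apply: le_trans (B _ _ _) _.
- by move=> v Dv; rewrite addr_ge0 ?Psi0// ltW.
- by move=> v Dv; rewrite F0; have [h _] := uN v (Dr v Dv); exact: tri (h1 v Dv) h.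
- by move=> v Dv; rewrite F0; have [_ h] := uN v (Dr v Dv); exact: tri (h2 v Dv) h.
have ma := measurable_pair_amp r01 mD Dr tf; have mw := measurable_wt r01 mD Dr.
under eq_integral => v _ do rewrite mulrDr mulrDl EFinD.
rewrite ge0_integralD//.
- rewrite (mass_scale _ r01 mD Dr tf) leeD2l// lee_fin ler_pdivlMr// mulrC mulrA.
  exact: share_le (mass_ge0 D f) (ltW e0).
- by move=> v Dv; rewrite lee_fin mulr_ge0 ?wt_ge0// mulr_ge0 ?pair_amp_ge0 ?Psi0.
- by apply/measurable_EFinP; apply: measurable_funM => //; apply: measurable_funM.
- by move=> v Dv; rewrite lee_fin mulr_ge0 ?wt_ge0// mulr_ge0 ?pair_amp_ge0// ltW.
- by apply/measurable_EFinP; apply: measurable_funM => //; apply: measurable_funM.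
Qed.

Lemma pairing_op_setU D D' r f : 0 < r < 1 -> measurable D -> measurable D' ->
  D `<=` sector r -> D' `<=` sector r -> [disjoint D & D'] -> polar_tame f ->
  pairing_op (D `|` D') f = pairing_op D f + pairing_op D' f.
Proof.
move=> r01 mD mD' Dr D'r dDD' tf.
have mU := measurableU _ _ mD mD'.
have Ur : D `|` D' `<=` sector r by move=> v [/Dr|/D'r].
apply: cvg_lim => //.
have -> : (fun N => pairing_sum N (D `|` D') f) = (fun N => pairing_sum N D f + pairing_sum N D' f).
  apply/funext => N; rewrite /pairing_sum -big_split/=; apply: eq_bigr => n _.
  rewrite -scalerDl /pairing cintegral_setU//; first exact: sector_sub_finite Ur.
  by apply: (tame_sub _ _ _ (tame_pairing_density al lam_ge0 n r01 tf)) => //; exact: measurable_sector.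
by apply: cvgD; exact: pairing_sum_cvg r01 _ _ tf.
Qed.

Lemma pairing_op_linear D r (a : R[i]) f g : 0 < r < 1 -> measurable D -> D `<=` sector r ->
  polar_tame f -> polar_tame g ->
  pairing_op D (fun z => a * f z + g z) = a *: pairing_op D f + pairing_op D g.
Proof.
move=> r01 mD Dr tf tg; apply: cvg_lim => //.
have -> : (fun N => pairing_sum N D (fun z => a * f z + g z)) =
    (fun N => a *: pairing_sum N D f + pairing_sum N D g).
  apply/funext => N; rewrite /pairing_sum scaler_sumr -big_split/=; apply: eq_bigr => n _.
  by rewrite (pairing_linear al lam_ge0 n a r01 mD Dr tf tg) scalerDl scalerA.
apply: cvgD; last exact: pairing_sum_cvg r01 _ _ tg.
by apply: cvgZl_tmp; exact: pairing_sum_cvg r01 _ _ tf.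
Qed.

End integral_operator.

(** * Continuity and measurability in polar coordinates *)

Section polar_measurability.
Variable R : realType.
Implicit Types (P : R * R -> R[i]) (v : R * R).

Let polar_disk : set (R * R) := [set v | `|v.1| < 1].

Let polar_disk_open : open polar_disk.
Proof.
rewrite (_ : polar_disk = fst @^-1` `]-1, 1[%classic); last first.
  by apply/seteqP; split => v; rewrite /polar_disk/= in_itv/= ltr_norml.
by apply: open_comp => [v _|]; [exact: cvg_fst|exact: interval_open].
Qed.

Let polar_disk2 v : polar_disk v -> disk2 (v.1 * cos v.2) (v.1 * sin v.2).
Proof.
move=> v1; rewrite /disk2 !exprMn -mulrDr cos2Dsin2 mulr1 -[v.1 ^+ 2]real_normK ?num_real//.
by rewrite exprn_ilt1.
Qed.

Let pair_continuous (g h : R * R -> R) v : {for v, continuous g} -> {for v, continuous h} ->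
  {for v, continuous (fun v => (g v, h v))}.
Proof. exact: cvg_pair. Qed.

Lemma measurable_amp_polar (lam : R) (f : R[i] -> R[i]) : lambda_analytic lam f ->
  measurable_fun (@polar_rect R) (fun v => amp f (v.1 * cos v.2) (v.1 * sin v.2)).
Proof.
move=> fan; apply: (@measurable_funS _ _ _ _ polar_disk).
- exact: open_measurable2.
- by move=> v [/andP[v0 v1] _]; rewrite /polar_disk/= gtr0_norm.
apply: continuous2_measurable => // v Dv.
have [c1 c2] := polar_point_continuous v.
apply: (@continuous_comp _ _ _ (fun v : R * R => (v.1 * cos v.2, v.1 * sin v.2))
  (fun p => amp f p.1 p.2)); first exact: pair_continuous.
exact: (amp_continuous fan (polar_disk2 Dv)).
Qed.

Lemma tame_polar_comp (lam : R) (f : R[i] -> R[i]) P (r : R) : lambda_analytic lam f -> 0 < r < 1 ->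
  (forall v, {for v, continuous (fun v => complex.Re (P v))}) ->
  (forall v, {for v, continuous (fun v => complex.Im (P v))}) ->
  (forall v, rnorm (P v) = `|v.1|) -> tame (sector r) (fun v => f (P v)).
Proof.
move=> fan /andP[r0 r1] cR cI nP.
have dP v : polar_disk v -> disk2 (complex.Re (P v)) (complex.Im (P v)).
  by move=> Dv; apply/disk2_sqrt; rewrite -rnorm_sqrt nP.
have c v : polar_disk v -> {for v, continuous (fun v => complex.Re (f (P v)))} /\
    {for v, continuous (fun v => complex.Im (f (P v)))}.
  move=> Dv; have [h1 h2] := lambda_analytic_continuous fan (v := (_, _)) (dP v Dv).
  have cP := pair_continuous (cR v) (cI v).
  have E : P = (fun v => complex.Re (P v) +i* complex.Im (P v)).
    by apply/funext => u; case: (P u).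
  rewrite E; split.
    exact: (@continuous_comp _ _ _ (fun v => (complex.Re (P v), complex.Im (P v))) (Re_xy f) _ cP h1).
  exact: (@continuous_comp _ _ _ (fun v => (complex.Re (P v), complex.Im (P v))) (Im_xy f) _ cP h2).
have sD : sector r `<=` polar_disk.
  move=> v [/=]; rewrite in_itv/= => /andP[v0 v1] _.
  by rewrite /polar_disk/= gtr0_norm// (le_lt_trans v1).
split.
- apply: measurable_funS (open_measurable2 polar_disk_open) sD _.
  by apply: continuous2_measurable => // v /c[].
- apply: measurable_funS (open_measurable2 polar_disk_open) sD _.
  by apply: continuous2_measurable => // v /c[].
pose K : set (R * R) := `[0, r] `*` `[0, pi].
have cK : compact K by apply: compact_setX; exact: segment_compact.
have KD : K `<=` polar_disk.
  move=> v [/=]; rewrite in_itv/= => /andP[v0 v1] _.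
  by rewrite /polar_disk/= ger0_norm// (le_lt_trans v1).
have cg : {within K, continuous (fun v => rnorm (f (P v)))}.
  apply: continuous_in_subspaceT => v /set_mem /KD /c[h1 h2].
  exact: (continuous_rnorm h1 h2).
have [M [_ hM]] := compact_bounded (continuous_compact cg cK).
exists (M + 1) => v [/= v1 v2]; apply: le_trans (ler_norm _) _.
apply: (hM (M + 1)); first by rewrite ltrDl.
exists v => //; split; rewrite /= in_itv/=.
  by move: v1; rewrite in_itv/= => /andP[/ltW-> ->].
by move: v2; rewrite in_itv/= => /andP[/ltW-> /ltW->].
Qed.

Lemma lambda_analytic_polar_tame (lam : R) (f : R[i] -> R[i]) : lambda_analytic lam f -> polar_tame f.
Proof.
move=> fan r r01.
have nP v : rnorm (polar_point v) = `|v.1|.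
  by rewrite rnormE !exprMn -mulrDr cos2Dsin2 mulr1 sqrtr_sqr.
split; apply: (tame_polar_comp fan r01) => v.
- exact: (polar_point_continuous v).1.
- exact: (polar_point_continuous v).2.
- exact: nP.
- exact: (polar_point_continuous v).1.
- by apply: cvgN; exact: (polar_point_continuous v).2.
- by rewrite rnormJ nP.
Qed.

Definition chord v : R := rnorm (1 - polar_point v ^+ 2).

Lemma chordJ v : rnorm (1 - ((polar_point v)^*)%C ^+ 2) = chord v.
Proof.
rewrite /chord /polar_point /= !expr2 !rnorm_sqrt/=; congr Num.sqrt; ring.
Qed.

(** With [t] the modulus and [y] the imaginary part of [z], [|1 - z^2|^2 = (1 - t^2)^2 + 4 y^2], so
    the chord is at most [(1 - t^2) + 2 y], and [1 - t^2 <= 2 (1 - t)]. *)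
Lemma chord_le v : polar_rect v -> 0 <= chord v <= 2 * (1 - v.1) + 2 * (v.1 * sin v.2).
Proof.
move=> [/andP[v0 v1] /andP[t0 tpi]].
have s0 : 0 < sin v.2 by rewrite sin_gt0_pi// t0.
rewrite /chord rnorm_ge0/= rnorm_sqrt /polar_point expr2/=.
have b0 : 0 <= 1 - v.1 ^+ 2 + 2 * (v.1 * sin v.2).
  by rewrite addr_ge0 ?mulr_ge0 ?(ltW v0) ?(ltW s0)// subr_ge0 exprn_ile1 ?(ltW v0) ?(ltW v1).
apply: (@le_trans _ _ (1 - v.1 ^+ 2 + 2 * (v.1 * sin v.2))); last first.
  rewrite lerD2r -subr_ge0 (_ : _ - _ = (1 - v.1) ^+ 2); last by ring.
  exact: sqr_ge0.
rewrite -[leRHS]ger0_norm// -sqrtr_sqr ler_wsqrtr//.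
have h : 0 <= 2 * (1 - v.1 ^+ 2) * (2 * (v.1 * sin v.2)).
  by rewrite !mulr_ge0 ?(ltW v0) ?(ltW s0)// subr_ge0 exprn_ile1 ?(ltW v0) ?(ltW v1).
rewrite -subr_ge0; apply: le_trans h _; rewrite le_eqVlt; apply/orP; left; apply/eqP.
have c2 : cos v.2 ^+ 2 = 1 - sin v.2 ^+ 2 by rewrite -[X in _ = X - _](cos2Dsin2 v.2) addrK.
move: c2; move: (sin v.2) (cos v.2) v.1 => s c t c2.
rewrite (_ : (1 - (t * c * (t * c) - t * s * (t * s))) ^+ 2 + (0 - (t * c * (t * s) + t * s * (t * c))) ^+ 2 =
  (1 - t ^+ 2 * c ^+ 2 + t ^+ 2 * s ^+ 2) ^+ 2 + 4 * t ^+ 4 * c ^+ 2 * s ^+ 2); last by ring.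
by rewrite c2; ring.
Qed.

Lemma measurable_chord : measurable_fun setT chord.
Proof.
apply: continuous2_measurable => [|v _]; first exact: openT.
have [c1 c2] := polar_point_continuous v.
apply: (@continuous_rnorm _ (fun v => 1 - polar_point v ^+ 2)).
  rewrite (_ : (fun _ => _) = (fun v : R * R => 1 - (v.1 * cos v.2 * (v.1 * cos v.2) - v.1 * sin v.2 * (v.1 * sin v.2)))); last first.
    by apply/funext => u; rewrite expr2.
  by apply: cvgB; [exact: cvg_cst|apply: cvgB; apply: cvgM].
rewrite (_ : (fun _ => _) = (fun v : R * R => 0 - (v.1 * cos v.2 * (v.1 * sin v.2) + v.1 * sin v.2 * (v.1 * cos v.2)))); last first.
  by apply/funext => u; rewrite expr2.
by apply: cvgB; [exact: cvg_cst|apply: cvgD; apply: cvgM].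
Qed.

Lemma measurable_weight_tail_sqrt (w : R -> R) : weight w ->
  measurable_fun setT (fun v : R * R => weight_tail w (Num.sqrt v.1)).
Proof.
move=> ww; pose V r := weight_tail w (Num.max r 0).
have mV : measurable_fun setT V.
  apply: nonincreasing_measurable => // r s rs; apply: (weight_tail_nonincreasing ww).
    by rewrite le_max lexx orbT.
  by rewrite ge_max !le_max rs lexx !orbT.
rewrite (_ : (fun _ => _) = (fun v : R * R => V (Num.sqrt v.1))); last first.
  by apply/funext => v; rewrite /V max_l// sqrtr_ge0.
apply: (measurableT_comp mV).
by apply: (measurableT_comp (continuous_measurable_fun (@sqrt_continuous R))).
Qed.

End polar_measurability.

(** * The bounded extension *)

Section lambda_polynomials.
Variables (R : realType) (lam : R).
Hypothesis lam_ge0 : 0 <= lam.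
Implicit Types c : nat -> R[i].

Definition phi_comb (N : nat) c (z : R[i]) : R[i] := \sum_(n < N) c n * phi lam n z.

Lemma phi_combS N c : phi_comb N.+1 c = (fun z => c N * phi lam N z + phi_comb N c z).
Proof. by apply/funext => z; rewrite /phi_comb big_ord_recr/= addrC. Qed.

Lemma phi_comb0 c : phi_comb 0 c = (fun=> 0).
Proof. by apply/funext => z; rewrite /phi_comb big_ord0. Qed.

Lemma phi_comb_polynomial N c : lambda_polynomial lam (phi_comb N c).
Proof. by exists N, c. Qed.

Lemma phi_polynomial n : lambda_polynomial lam (phi lam n).
Proof.
exists n.+1, (fun m => (m == n)%:R) => z; rewrite big_ord_recr/= eqxx mul1r big1 ?add0r// => i _.
by rewrite ltn_eqF// mul0r.
Qed.

Lemma polar_tame_comb N c : polar_tame (phi_comb N c).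
Proof.
elim: N => [|N IH]; first by rewrite phi_comb0 => r _; split; exact: tame_cst.
by rewrite phi_combS; apply: polar_tame_linear => //; exact: polar_tame_phi.
Qed.

Lemma linear_on_comb (X : completeNormedModType R[i]) (T : (R[i] -> R[i]) -> X) N c :
  linear_on (lambda_polynomial lam) T ->
  T (phi_comb N c) = \sum_(n < N) c n *: T (phi lam n).
Proof.
move=> lT; elim: N => [|N IH].
  have P0 := phi_comb_polynomial 0 c; rewrite big_ord0; apply/eqP.
  have := lT 1 _ _ P0 P0; rewrite scale1r.
  have -> : (fun z => 1 * phi_comb 0 c z + phi_comb 0 c z) = phi_comb 0 c.
    by apply/funext => z; rewrite phi_comb0 mulr0 addr0.
  by move/eqP; rewrite -subr_eq0 opprD addrA subrr sub0r oppr_eq0.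
rewrite phi_combS lT; [|exact: phi_polynomial|exact: phi_comb_polynomial].
by rewrite IH big_ord_recr/= addrC.
Qed.

Variable al : R.
Hypothesis al_gtN1 : -1 < al.

Lemma pairing_comb N c n r : 0 < r < 1 ->
  pairing lam al n (sector r) (phi_comb N c) =
  if (n < N)%N then c n * (2 * angular lam 0 0 * radial lam al (2 * n) r)%:C else 0.
Proof.
move=> r01; elim: N => [|N IH].
  rewrite phi_comb0 /pairing /cintegral.
  have E v : pairing_density lam al n (fun=> 0) v = 0 by rewrite /pairing_density !mul0r addr0 mul0r.
  under eq_Rintegral do rewrite E.
  under [X in _ +i* X]eq_Rintegral do rewrite E.
  by rewrite !Rintegral_cst ?mul0r//; exact: measurable_sector.
rewrite phi_combS (pairing_linear al lam_ge0 n (c N) r01 (measurable_sector r) (@subset_refl _ _)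
  (polar_tame_phi lam_ge0 N) (polar_tame_comb N c)).
rewrite pairing_phi// IH ltnS [in RHS]leq_eqVlt eq_sym.
by case: eqVneq => [->|_]; rewrite ?ltnn ?addr0// mulr0 add0r.
Qed.

(** By orthogonality the pairings of index at least [N] vanish, so the defining sequence is
    eventually constant. *)
Lemma pairing_op_comb (X : completeNormedModType R[i]) (x : nat -> X) N c r : 0 < r < 1 ->
  pairing_op lam al x (sector r) (phi_comb N c) =
  \sum_(n < N) (c n * (2 * angular lam 0 0 * radial lam al (2 * n) r)%:C) *: x n.
Proof.
move=> r01; apply: cvg_lim => //; apply: cvg_near_cst; exists N => // M NM.
rewrite /pairing_sum.
rewrite -(big_mkord xpredT (fun n => pairing lam al n (sector r) (phi_comb N c) *: x n)).
rewrite -(big_mkord xpredT (fun n => (c n * (2 * angular lam 0 0 * radial lam al (2 * n) r)%:C) *: x n)).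
rewrite (big_cat_nat (leq0n N) NM)/=.
rewrite [X in _ + X]big1_seq ?addr0 => [|n /andP[_]]; last first.
  by rewrite mem_index_iota => /andP[Nn _]; rewrite pairing_comb// ltnNge Nn scale0r.
by apply: eq_big_nat => n /andP[_ nN]; rewrite pairing_comb// nN.
Qed.

End lambda_polynomials.

Section extension.
Variables (R : realType) (lam p al : R) (w : R -> R).
Variables (X : completeNormedModType R[i]) (T : (R[i] -> R[i]) -> X).
Hypotheses (lam_ge0 : 0 <= lam) (p_gt0 : 0 < p) (p_le1 : p <= 1) (weight_w : weight w).
Hypothesis al_gtN1 : -1 < al.
Hypothesis w_tail : exists2 c : R, 0 < c &
  forall r, 0 < r < 1 -> weight_tail w r <= c * ((1 - r) * w r).
Hypothesis T_linear : linear_on (lambda_polynomial lam) T.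
Let x := F_coef lam al T.
Hypothesis F_analytic : X_lambda_analytic lam x.
Let mu2 := (@lebesgue_measure R \x @lebesgue_measure R)%E.
Let sec j := sector (exhaustion R j).
Implicit Types f : R[i] -> R[i].

Let kappa : R := 2 * angular lam 0 0 * radial_total lam al 0.

Let kappa_neq0 : kappa%:C != 0.
Proof.
rewrite eq_complex/= eqxx andbT gt_eqF// mulr_gt0//; last exact: radial_total0_gt0.
by rewrite mulr_gt0// angular0_gt0.
Qed.

(* By [radial_total_Gamma], the limit maps [phi lam n] to a multiple of
   [T (phi lam n)] that does not depend on [n]. *)
Definition extension f : X :=
  ((2 * angular lam 0 0 * radial_total lam al 0)%:C)^-1 *:
    limn (fun j => pairing_op lam al (F_coef lam al T) (sector (exhaustion R j)) f).

Lemma extension_polynomial f : lambda_polynomial lam f -> extension f = T f.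
Proof.
move=> [N [c fE]]; have -> : f = phi_comb lam N c by apply/funext.
rewrite [RHS]linear_on_comb// /extension -/kappa.
have -> : limn (fun j => pairing_op lam al x (sec j) (phi_comb lam N c)) =
    \sum_(n < N) (c n * (2 * angular lam 0 0 * radial_total lam al n)%:C) *: x n.
  apply: cvg_lim => //.
  rewrite (_ : (fun _ => _) = (fun j => \sum_(n < N)
      (c n * (2 * angular lam 0 0 * radial lam al (2 * n) (exhaustion R j))%:C) *: x n)); last first.
    by apply/funext => j; rewrite pairing_op_comb// exhaustion_gt0_lt1.
  apply: cvg_big => [|n _]; first exact: add_continuous.
  apply/cvg_rnormP => e e0.
  pose C := rnorm (c n *: x n) * (2 * angular lam 0 0) + 1.
  have a0 : 0 < 2 * angular lam 0 0 by rewrite mulr_gt0// angular0_gt0.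
  have C0 : 0 < C by rewrite ltr_wpDl// mulr_ge0 ?rnorm_ge0// ltW.
  have /cvgrPdist_le/(_ (e / C)) := @radial_total_cvg _ _ _ lam_ge0 al_gtN1 n.
  rewrite divr_gt0// => /(_ isT); apply: filterS => j hj.
  rewrite -scalerBl -mulrBr -rmorphB/= -mulrBr mulrC -scalerA rnormZ.
  rewrite (_ : rnorm _ = 2 * angular lam 0 0 * `|radial_total lam al n - radial lam al (2 * n) (exhaustion R j)|); last first.
    by rewrite rnormE expr0n addr0 sqrtr_sqr normrM gtr0_norm.
  apply: (@le_trans _ _ (C * (e / C))); last by rewrite mulrC divfK// gt_eqF.
  apply: le_trans (ler_wpM2l (ltW C0) hj).
  move: `|_ - _| (normr_ge0 (radial_total lam al n - radial lam al (2 * n) (exhaustion R j))) => d d0.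
  rewrite (_ : 2 * angular lam 0 0 * d * _ = rnorm (c n *: x n) * (2 * angular lam 0 0) * d); last by ring.
  by rewrite ler_wpM2r// /C lerDl.
rewrite scaler_sumr; apply: eq_bigr => n _; rewrite /x /F_coef !scalerA -mulrA -rmorphM/=.
congr (_ *: _); rewrite -[_ * radial_total _ _ _ * _]mulrA radial_total_Gamma// -/kappa.
by rewrite mulrCA mulVf ?mulr1.
Qed.

Variable c : R.
Hypothesis c_gt0 : 0 < c.
Hypothesis F_bound : forall z : R[i], unit_disk z ->
  rnorm (X_sum lam x z) `^ p <=
  c * (rnorm (1 - z ^+ 2) `^ (2 * lam * (1 - p)) / (1 - rnorm z) `^ ((al + 2) * p - 1)
       * weight_tail w (Num.sqrt (rnorm z))).

Let Psi0 (v : R * R) : R := (chord v `^ (2 * lam * (1 - p)) / (1 - v.1) `^ ((al + 2) * p - 1)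
  * weight_tail w (Num.sqrt v.1)) `^ p^-1.
Let Psi v := c `^ p^-1 * Psi0 v.
Let wt := @polar_weight R (2 * lam) al.
Let integrand f v := pair_amp f v * Psi v * wt v.

Let Psi0_ge0 v : 0 <= Psi0 v. Proof. exact: powR_ge0. Qed.

Let Psi_ge0 v : 0 <= Psi v. Proof. by rewrite mulr_ge0 ?powR_ge0. Qed.

Let X_sum_le (z : R[i]) v : unit_disk z -> rnorm z = v.1 -> rnorm (1 - z ^+ 2) = chord v ->
  rnorm (X_sum lam x z) <= Psi v.
Proof.
move=> Dz zv cv; have := F_bound Dz; rewrite zv cv => h.
have -> : rnorm (X_sum lam x z) = (rnorm (X_sum lam x z) `^ p) `^ p^-1.
  by rewrite -powRrM divff ?gt_eqF// powRr1// rnorm_ge0.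
have v1 : v.1 < 1 by rewrite -zv.
have B0 : 0 <= chord v `^ (2 * lam * (1 - p)) / (1 - v.1) `^ ((al + 2) * p - 1)
    * weight_tail w (Num.sqrt v.1).
  by rewrite !mulr_ge0 ?invr_ge0 ?powR_ge0// weight_tail_ge0// sqrtr_ge0.
rewrite /Psi /Psi0 -powRM ?(ltW c_gt0)//.
by apply: ler_powR_base; rewrite ?invr_ge0 ?powR_ge0 ?(ltW p_gt0).
Qed.

Let X_sum_polar_le r v : 0 < r < 1 -> sector r v ->
  rnorm (X_sum lam x (polar_point v)) <= Psi v /\
  rnorm (X_sum lam x ((polar_point v)^*)%C) <= Psi v.
Proof.
move=> /andP[r0 r1] [/=]; rewrite in_itv/= => /andP[v0 v1] _.
have nv := rnorm_polar_point (ltW v0).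
have Dv : unit_disk (polar_point v) by rewrite /unit_disk/= nv (le_lt_trans v1).
split; first exact: X_sum_le.
apply: X_sum_le; [|exact: etrans (rnormJ _) nv|exact: chordJ].
by change (is_true (rnorm ((polar_point v)^*)%C < 1)); rewrite rnormJ; exact: Dv.
Qed.

Let measurable_Psi0 : measurable_fun setT Psi0.
Proof.
apply: (measurableT_comp (measurable_powR _)); apply: measurable_funM; last exact: measurable_weight_tail_sqrt.
rewrite (_ : (fun _ => _) = (fun v => chord v `^ (2 * lam * (1 - p)) * (1 - v.1) `^ (- ((al + 2) * p - 1)))); last first.
  by apply/funext => v; rewrite powRN.
apply: measurable_funM; apply: (measurableT_comp (measurable_powR _)); first exact: measurable_chord.
by apply: measurable_funB; [exact: measurable_cst|exact: measurable_fst].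
Qed.

Let integrand_ge0 f v : (0 <= (integrand f v)%:E)%E.
Proof.
rewrite lee_fin; apply: mulr_ge0; last exact: polar_weight_ge0.
by apply: mulr_ge0; [rewrite addr_ge0 ?rnorm_ge0|exact: Psi_ge0].
Qed.

Let measurable_wt : measurable_fun setT wt.
Proof.
apply: measurable_funM; first exact: (measurableT_comp (measurable_radial_weight lam al)).
apply: (measurableT_comp (measurable_powR _)).
apply: (measurableT_comp (continuous_measurable_fun (@continuous_sin R))).
exact: measurable_snd.
Qed.

Let measurable_integrand f j : lambda_analytic lam f -> measurable_fun (sec j) (EFin \o integrand f).
Proof.
move=> fan; have [f1 f2] := lambda_analytic_polar_tame fan (exhaustion_gt0_lt1 R j).
apply/measurable_EFinP; apply: measurable_funM; last exact: measurable_funTS.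
apply: measurable_funM; first by apply: measurable_funD; exact: tame_rnorm.
by apply: measurable_funTS; apply: measurable_funM; [exact: measurable_cst|exact: measurable_Psi0].
Qed.

(** The constant is independent of [j], which gives both the convergence of the truncated operators
    and the bound of their limit. The [2] arises because [amp] dominates each of the two terms of
    [pair_amp]. *)
Lemma sector_integral_le_bergman : exists2 C : R, 0 < C & forall f, lambda_analytic lam f -> forall j,
  (\int[mu2]_(v in sec j) (integrand f v)%:E <= C%:E * bergman_norm p lam w f)%E.
Proof.
have [c' c'0 tw] := w_tail.
have [C C0 H] := bergman_polar_estimate al (introT andP (conj p_gt0 p_le1)) lam_ge0 weight_w c'0 tw.
have k0 : 0 < 2 * c `^ p^-1 by rewrite mulr_gt0// powR_gt0.
exists (2 * c `^ p^-1 * C) => [|f fan j]; first by rewrite mulr_gt0.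
have := H f fan (@chord R) (@chord_le R) => {}H.
rewrite EFinM -muleA; apply: le_trans (lee_wpmul2l _ H); last by rewrite lee_fin ltW.
have h0 v : 0 <= amp f (v.1 * cos v.2) (v.1 * sin v.2) * Psi0 v * wt v.
  by apply: mulr_ge0; [rewrite mulr_ge0 ?amp_ge0 ?Psi0_ge0|exact: polar_weight_ge0].
have mp : measurable (@polar_rect R).
  rewrite (_ : @polar_rect R = `]0, 1[ `*` `]0, pi[); first by apply: measurableX; exact: measurable_itv.
  by apply/seteqP; split => v; rewrite /polar_rect/= !in_itv/=.
rewrite -ge0_integralZl//; last 3 first.
- apply/measurable_EFinP; apply: measurable_funM; last exact: measurable_funTS.
  by apply: measurable_funM; [exact: measurable_amp_polar fan|exact: measurable_funTS].
- by move=> v _; rewrite lee_fin h0.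
- by rewrite lee_fin ltW.
apply: ge0_le_integral_subset => v; first by [].
  by move=> _; rewrite -EFinM lee_fin mulr_ge0 ?h0// ltW.
move=> [/=]; rewrite !in_itv/= => /andP[v0 v1] v2.
have /andP[_ r1] := exhaustion_gt0_lt1 R j.
split; first by split => //; rewrite v0 (le_lt_trans v1).
rewrite -EFinM lee_fin /integrand /Psi.
have [a1 a2] := rnorm_le_amp f (v.1 * cos v.2) (v.1 * sin v.2).
have ha : pair_amp f v <= 2 * amp f (v.1 * cos v.2) (v.1 * sin v.2).
  by rewrite mulr_natl mulr2n; apply: lerD.
have -> : 2 * c `^ p^-1 * (amp f (v.1 * cos v.2) (v.1 * sin v.2) * Psi0 v * wt v) =
  2 * amp f (v.1 * cos v.2) (v.1 * sin v.2) * (c `^ p^-1 * Psi0 v) * wt v by ring.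
rewrite ler_wpM2r//; first exact: polar_weight_ge0.
by rewrite ler_wpM2r// Psi_ge0.
Qed.

Let sec_sub i j : (i <= j)%N -> sec i `<=` sec j.
Proof.
move=> ij v [/= v1 v2]; split => //=; move: v1; rewrite !in_itv/= => /andP[-> h].
exact: le_trans h (exhaustion_nondecreasing R ij).
Qed.

Let G f j : R := \int[mu2]_(v in sec j) integrand f v.

Let op f j : X := pairing_op lam al x (sec j) f.

Let sec_integral_fin f j : bergman p lam w f -> (\int[mu2]_(v in sec j) (integrand f v)%:E)%E \is a fin_num.
Proof.
move=> [fan fn]; have [C C0 H] := sector_integral_le_bergman.
rewrite ge0_fin_numE; last by apply: integral_ge0 => v _; exact: integrand_ge0.
by apply: le_lt_trans (H f fan j) _; rewrite lte_mul_pinfty// lee_fin ltW.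
Qed.

Let op_le f D j : lambda_analytic lam f -> measurable D -> D `<=` sec j ->
  ((rnorm (pairing_op lam al x D f))%:E <= \int[mu2]_(v in D) (integrand f v)%:E)%E.
Proof.
move=> fan mD Dj; have r01 := exhaustion_gt0_lt1 R j.
apply: (pairing_op_bound al lam_ge0 F_analytic r01 mD Dj (lambda_analytic_polar_tame fan)).
- by apply: measurable_funTS; apply: measurable_funM; [exact: measurable_cst|exact: measurable_Psi0].
- by move=> v /Dj /(X_sum_polar_le r01)[].
- by move=> v /Dj /(X_sum_polar_le r01)[].
Qed.

(** By additivity the difference is the operator over the half annulus between the two radii, and
    the bound there is the increment of [G f]. *)
Let op_increment f i j : bergman p lam w f -> (i <= j)%N -> rnorm (op f j - op f i) <= G f j - G f i.
Proof.
move=> bf ij; have [fan _] := bf; have r01 := exhaustion_gt0_lt1 R j.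
have mD : measurable (sec j `\` sec i) by apply: measurableD; exact: measurable_sector.
have Dj : sec j `\` sec i `<=` sec j by move=> v [].
have dD : [disjoint sec i & sec j `\` sec i].
  by apply/disj_set2P; rewrite setDE setICA setICr setI0.
have UE : sec i `|` (sec j `\` sec i) = sec j by apply: setDUK; exact: sec_sub.
have E := pairing_op_setU al lam_ge0 F_analytic r01 (measurable_sector _) mD (sec_sub ij) Dj dD
  (lambda_analytic_polar_tame fan).
rewrite UE in E; rewrite /op E addrC addKr.
rewrite -lee_fin; apply: le_trans (op_le fan mD Dj) _.
have fi := sec_integral_fin i bf; have fj := sec_integral_fin j bf.
rewrite EFinB /G /Rintegral !fineK// leeBrDl//.
rewrite -ge0_integral_setU ?UE//; first exact: measurable_sector.
  exact: measurable_integrand.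
Qed.

Let G_le f C j : bergman p lam w f ->
  (\int[mu2]_(v in sec j) (integrand f v)%:E <= C%:E * bergman_norm p lam w f)%E ->
  0 < C -> G f j <= fine (C%:E * bergman_norm p lam w f)%E.
Proof.
move=> bf h C0; rewrite /G /Rintegral fine_le//; first exact: sec_integral_fin.
rewrite ge0_fin_numE; first by rewrite lte_mul_pinfty// ?lee_fin ?(ltW C0)//; case: bf.
by rewrite mule_ge0 ?lee_fin ?(ltW C0)// poweR_ge0.
Qed.

Let op_cvg f : bergman p lam w f -> op f j @[j --> \oo] --> limn (op f).
Proof.
move=> bf; have [C C0 H] := sector_integral_le_bergman.
apply: (@rnorm_increment_cvg _ _ _ (G f) (fine (C%:E * bergman_norm p lam w f)%E)) => [i j|j].
  exact: op_increment.
by apply: G_le => //; apply: H; case: bf.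
Qed.

Lemma extension_bounded : extends_boundedly p lam w T.
Proof.
have [C C0 H] := sector_integral_le_bergman.
exists extension; split; last exact: extension_polynomial.
- move=> a f g bf bg; rewrite /extension -/kappa -/x.
  rewrite scalerA mulrC -scalerA -scalerDr; congr (_ *: _); apply: cvg_lim => //.
  have E : op (fun z => a * f z + g z) = (fun j => a *: op f j + op g j).
    apply/funext => j; apply: (pairing_op_linear al lam_ge0 F_analytic a (exhaustion_gt0_lt1 R j)) => //.
    + exact: measurable_sector.
    + by apply: (@lambda_analytic_polar_tame _ lam); case: bf.
    + by apply: (@lambda_analytic_polar_tame _ lam); case: bg.
  change (op (fun z => a * f z + g z) j @[j --> \oo] --> a *: limn (op f) + limn (op g)).
  rewrite E.
  by apply: cvgD; [apply: cvgZl_tmp|]; exact: op_cvg.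
exists (rnorm (kappa%:C)^-1 * C) => f bf.
have fin : (C%:E * bergman_norm p lam w f)%E \is a fin_num.
  rewrite ge0_fin_numE; first by rewrite lte_mul_pinfty// ?lee_fin ?(ltW C0)//; case: bf.
  by rewrite mule_ge0 ?lee_fin ?(ltW C0)// poweR_ge0.
rewrite /extension -/kappa -/x rnormZ EFinM [(_ * C)%:E]EFinM -muleA.
apply: lee_wpmul2l; first by rewrite lee_fin rnorm_ge0.
rewrite -(fineK fin) lee_fin.
apply: (rnorm_lim_le (op_cvg bf)) => j.
apply: (@le_trans _ _ (G f j)); last by apply: G_le => //; apply: H; case: bf.
rewrite -lee_fin /G /Rintegral fineK; last exact: sec_integral_fin.
by apply: (op_le (j := j)); [case: bf|exact: measurable_sector|].
Qed.

End extension.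

Theorem theorem4p1 (R : realType) (lambda p q alpha : R) (w : R -> R)
    (X : completeNormedModType R[i]) (T : (R[i] -> R[i]) -> X)
    (lambda_ge0 : 0 <= lambda)
    (p_gt0 : 0 < p) (p0_le_p : 2 * lambda / (2 * lambda + 1) <= p)
    (p_le1 : p <= 1) (q_gt0 : 0 < q)
    (weight_w : weight w)
    (w_tail : exists2 c : R, 0 < c &
       forall r, 0 < r < 1 -> weight_tail w r <= c * ((1 - r) * w r))
    (alphaE : alpha = (q + 2 * lambda + 1) / p - 2 * lambda - 2)
    (T_linear : linear_on (lambda_polynomial lambda) T)
    (F_analytic : X_lambda_analytic lambda (F_coef lambda alpha T))
    (F_bound : exists2 c : R, 0 < c &
       forall z : R[i], unit_disk z ->
         rnorm (X_sum lambda (F_coef lambda alpha T) z) `^ p <=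
         c * (rnorm (1 - z ^+ 2) `^ (2 * lambda * (1 - p))
                / (1 - rnorm z) `^ ((alpha + 2) * p - 1)
              * weight_tail w (Num.sqrt (rnorm z)))) :
  extends_boundedly p lambda w T.
Proof.
(* As [p <= 1], the quotient in [alphaE] is at least [q + 2 * lambda + 1], so
   [alpha >= q - 1 > -1]. *)
have al_gtN1 : -1 < alpha.
  have h : q + 2 * lambda + 1 <= (q + 2 * lambda + 1) / p.
    rewrite ler_pdivlMr// -[leRHS]mulr1 ler_wpM2l// addr_ge0// addr_ge0 ?mulr_ge0//.
    exact: ltW.
  rewrite alphaE -addrA -opprD ltrBrDr; apply: lt_le_trans h.
  rewrite -subr_gt0 (_ : _ - _ = q) //; ring.
have [c c0 Fb] := F_bound.
exact: (extension_bounded lambda_ge0 p_gt0 p_le1 weight_w al_gtN1 w_tail T_linear F_analytic c0 Fb).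
Qed.
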